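(* Let $\lambda\in(-\pi/2,\pi/2)$ and let $f$ be a $\lambda$-spirallike function on the unit disk $\mathbb{D}=\{z\in\mathbb{C}:|z|<1\}$. Then for each $0<r<1$, $$2\sqrt{\pi A(r,f)}\le L(r,f)\le \sqrt{A(r,f)}\left(2\sqrt2\cos\lambda\,\log\frac{1+r}{1-r}+\sqrt2\,\pi\right).$$
   Context: For $\lambda\in(-\pi/2,\pi/2)$ and $w\in\mathbb{C}$, the $\lambda$-spiral segment joining $w$ and $0$ is $[0,w]_\lambda=\{w\exp(te^{i\lambda}):-\infty<t\le 0\}\cup\{0\}$. A domain $\Omega\subset\mathbb{C}$ with $0\in\Omega$ is called $\lambda$-spirallike with respect to the origin if $[0,w]_\lambda\subset\Omega$ whenever $w\in\Omega$. A holomorphic function $f$ on $\mathbb{D}$ is called $\lambda$-spirallike if $f(0)=0$ and $f$ maps $\mathbb{D}$ univalently (injectively) onto a domain that is $\lambda$-spirallike with respect to the origin. For $0<r<1$, $L(r,f)=\int_0^{2\pi}r|f'(re^{i\theta})|\,d\theta$ and $A(r,f)=\iint_{|z|\le r}|f'(z)|^2\,dx\,dy$ with $z=x+iy$. *)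

(* Defs.v *)
From Stdlib Require Import Reals.
From Coquelicot Require Import Coquelicot.
Open Scope R_scope.

Definition Cexp (z : C) : C := (exp (Re z) * cos (Im z), exp (Re z) * sin (Im z)).

Definition unit_disk (z : C) : Prop := Cmod z < 1.

(* Complex differentiability: the scalars are [C_AbsRing], not [R_AbsRing]. *)
Definition holomorphic_on (D : C -> Prop) (f : C -> C) : Prop :=
  forall z : C, D z -> @ex_derive C_AbsRing C_NormedModule f z.

Definition injective_on (D : C -> Prop) (f : C -> C) : Prop :=
  forall z w : C, D z -> D w -> f z = f w -> z = w.

Definition image (f : C -> C) (D : C -> Prop) (w : C) : Prop :=
  exists z : C, D z /\ f z = w.

(* Coquelicot's [is_connected] is about subsets of [R] only. *)
Definition connected_set (S : C -> Prop) : Prop :=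
  forall U V : C -> Prop,
    open U -> open V ->
    (forall z, S z -> U z \/ V z) ->
    (exists z, S z /\ U z) ->
    (exists z, S z /\ V z) ->
    exists z, S z /\ U z /\ V z.

Definition domain (Omega : C -> Prop) : Prop :=
  (exists z, Omega z) /\ open Omega /\ connected_set Omega.

Definition spiral_segment (lambda : R) (w z : C) : Prop :=
  (exists t : R, t <= 0 /\ z = (w * Cexp (t * Cexp (Ci * lambda)))%C) \/ z = 0.

Definition spirallike_domain (lambda : R) (Omega : C -> Prop) : Prop :=
  domain Omega /\ Omega 0 /\
  forall w : C, Omega w -> forall z : C, spiral_segment lambda w z -> Omega z.

Definition spirallike (lambda : R) (f : C -> C) : Prop :=
  holomorphic_on unit_disk f /\
  f 0 = 0 /\
  injective_on unit_disk f /\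
  spirallike_domain lambda (image f unit_disk).

Definition L (r : R) (f : C -> C) : R :=
  RInt (fun theta => r * Cmod (C_derive f (r * Cexp (Ci * theta))%C)) 0 (2 * PI).

(* Double integral of [g] over the closed disk [|z| <= r], [0 <= r], as an iterated
   Riemann integral over the vertical sections of the disk; this is meant for
   [g] continuous on the disk. *)
Definition RInt_disk (g : C -> R) (r : R) : R :=
  RInt (fun x =>
    RInt (fun y => g (x, y)) (- sqrt (r ^ 2 - x ^ 2)) (sqrt (r ^ 2 - x ^ 2)))
    (- r) r.

Definition A (r : R) (f : C -> C) : R :=
  RInt_disk (fun z => Cmod (C_derive f z) ^ 2) r.

(* Main.v *)
(** For [t <= 0] the map [f^-1 (exp (t e^(i lambda)) f)] sends the disk into itself and fixes 0, so
    Schwarz's lemma and differentiation at [t = 0] show that [Q z = e^(-i lambda) z f'(z) / f(z)] has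
    positive real part, with [Q 0 = e^(-i lambda)].

    Lower bound: the isoperimetric inequality for the image of the circle, whose enclosed area is
    [A] by Green's formula.  Cut the curve into two arcs of equal length; the distance to the common
    chord vanishes at both ends of each arc, and Wirtinger's inequality applies to it.

    Upper bound: put [C = cos lambda * ln ((1 + r) / (1 - r))].  On the circle [L = int |f| |Q|].
    Differentiating [int |f|^2 |Q|] in the radius, with [|Q'| <= 2 Re Q / (1 - rho^2)] and
    [int |f|^2 Re Q = 2 A cos lambda], gives [int |f|^2 |Q| <= 2 A (1 + C)].  The mean value of
    [Re (Q log Q)] gives [int |Q| <= 4 C + 4 lambda sin lambda + 2 PI cos lambda <= 4 (C + PI - 1)].
    By Cauchy-Schwarz [L^2 <= 8 A (1 + C) (C + PI - 1) <= 2 A (PI + 2 C)^2].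

    As [f] is only assumed complex differentiable, the continuity of [f'] rests on Goursat's theorem. *)

Require Import Defs.
From Stdlib Require Import Reals Lra Psatz Classical IndefiniteDescription.
From Coquelicot Require Import Coquelicot.
Open Scope R_scope.

(* [ring] must see the carrier [C] or [R], not the sort of a canonical structure over it. *)
Ltac cring := cbv beta; match goal with |- @eq _ ?a ?b => change (@eq C a b) end; ring.
Ltac rring := match goal with |- @eq _ ?a ?b => change (@eq R a b) end; ring.
Ltac cfield := cbv beta; match goal with |- @eq _ ?a ?b => change (@eq C a b) end; field.

(** The final constant comes from the inequality of the means:
    [L^2 <= 2 A (2 + 2 C) (2 C + 2 PI - 2)], and the two factors have mean [PI + 2 C]. The mean of
    [|Q|] is harder than that of [Re Q], because [|Q|] is not harmonic. With [q = |q| e^(i a)] one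
    has [|q| - Re q <= (2 / PI) a Im q], while [a Im q = Re q ln |q| - Re (q log q)]; the last term
    is harmonic, and [|Q 0| = 1] gives [ln |Q| <= ln ((1 + r) / (1 - r))]. A function that vanishes
    at both ends of an arc satisfies Wirtinger's inequality by completing a square, without Fourier
    series; the chord provides these zeros. Univalence enters mainly as [f' <> 0], which makes the
    image of the circle a regular curve and [|f f'|] differentiable away from 0. It is proved
    through the inverse function, whose possible singularity is removable. The area is defined by
    vertical sections, whereas every estimate runs over circles. Green's theorem for a vertical
    primitive turns the area into a function of the radius with derivative [r * int |f'|^2 dt]. *)

(** * Continuity rules for real- and complex-valued maps *)

Lemma continuous_pair_C {U : UniformSpace} (f g : U -> R) (x : U) :
  continuous f x -> continuous g x ->
  continuous (fun u => (f u, g u) : C) x.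
Proof.
  intros Hf Hg P [eps HP].
  assert (Hf' := Hf _ (locally_ball (f x) eps)).
  assert (Hg' := Hg _ (locally_ball (g x) eps)).
  unfold filtermap in *.
  generalize (filter_and _ _ Hf' Hg'). apply filter_imp.
  intros u [H1 H2]. apply HP. split; assumption.
Qed.

Lemma continuous_Re (z : C) : continuous Re z.
Proof. apply continuous_fst. Qed.
Lemma continuous_Im (z : C) : continuous Im z.
Proof. apply continuous_snd. Qed.

Lemma cts_Re {U : UniformSpace} (f : U -> C) (x : U) :
  continuous f x -> continuous (fun u => Re (f u)) x.
Proof. intros H. apply (continuous_comp f Re); [exact H | apply continuous_Re]. Qed.
Lemma cts_Im {U : UniformSpace} (f : U -> C) (x : U) :
  continuous f x -> continuous (fun u => Im (f u)) x.
Proof. intros H. apply (continuous_comp f Im); [exact H | apply continuous_Im]. Qed.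

Lemma cts_Rplus {U : UniformSpace} (f g : U -> R) (x : U) :
  continuous f x -> continuous g x -> continuous (fun u => f u + g u) x.
Proof. intros; now apply (continuous_plus f g). Qed.
Lemma cts_Ropp {U : UniformSpace} (f : U -> R) (x : U) :
  continuous f x -> continuous (fun u => - f u) x.
Proof. intros; now apply (continuous_opp f). Qed.
Lemma cts_Rminus {U : UniformSpace} (f g : U -> R) (x : U) :
  continuous f x -> continuous g x -> continuous (fun u => f u - g u) x.
Proof. intros; now apply (continuous_minus f g). Qed.
Lemma cts_Rmult {U : UniformSpace} (f g : U -> R) (x : U) :
  continuous f x -> continuous g x -> continuous (fun u => f u * g u) x.
Proof. intros; now apply (continuous_mult (K := R_AbsRing) f g). Qed.
Lemma cts_Rcomp {U : UniformSpace} (f : U -> R) (g : R -> R) (x : U) :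
  continuity_pt g (f x) -> continuous f x -> continuous (fun u => g (f u)) x.
Proof.
  intros Hg Hf. apply (continuous_comp f g); [exact Hf |].
  now apply continuity_pt_filterlim.
Qed.
Lemma cts_Rinv {U : UniformSpace} (f : U -> R) (x : U) :
  f x <> 0 -> continuous f x -> continuous (fun u => / f u) x.
Proof.
  intros H0 Hf. apply (continuous_comp f Rinv); [exact Hf |].
  now apply continuous_Rinv.
Qed.
Lemma cts_Rdiv {U : UniformSpace} (f g : U -> R) (x : U) :
  g x <> 0 -> continuous f x -> continuous g x -> continuous (fun u => f u / g u) x.
Proof. intros. unfold Rdiv. apply cts_Rmult; [| apply cts_Rinv]; assumption. Qed.
Lemma cts_Rpow {U : UniformSpace} (f : U -> R) (n : nat) (x : U) :
  continuous f x -> continuous (fun u => f u ^ n) x.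
Proof.
  intros Hf. induction n as [|n IH]; simpl.
  - apply continuous_const.
  - now apply cts_Rmult.
Qed.
Lemma cts_sin {U : UniformSpace} (f : U -> R) (x : U) :
  continuous f x -> continuous (fun u => sin (f u)) x.
Proof. intros H. apply cts_Rcomp; [apply continuity_sin | exact H]. Qed.
Lemma cts_cos {U : UniformSpace} (f : U -> R) (x : U) :
  continuous f x -> continuous (fun u => cos (f u)) x.
Proof. intros H. apply cts_Rcomp; [apply continuity_cos | exact H]. Qed.
Lemma cts_sqrt {U : UniformSpace} (f : U -> R) (x : U) :
  continuous f x -> continuous (fun u => sqrt (f u)) x.
Proof.
  intros H. apply (continuous_comp f sqrt); [exact H |]. apply continuous_sqrt.
Qed.

Lemma cts_ReIm {U : UniformSpace} (f : U -> C) (x : U) :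
  continuous (fun u => Re (f u)) x -> continuous (fun u => Im (f u)) x ->
  continuous f x.
Proof.
  intros H1 H2.
  apply (continuous_ext (fun u => (Re (f u), Im (f u)) : C)).
  - intros u. now destruct (f u).
  - now apply continuous_pair_C.
Qed.
Lemma cts_Cplus {U : UniformSpace} (f g : U -> C) (x : U) :
  continuous f x -> continuous g x -> continuous (fun u => (f u + g u)%C) x.
Proof.
  intros Hf Hg. apply cts_ReIm; simpl; apply cts_Rplus; now (apply cts_Re || apply cts_Im).
Qed.
Lemma cts_Copp {U : UniformSpace} (f : U -> C) (x : U) :
  continuous f x -> continuous (fun u => (- f u)%C) x.
Proof.
  intros Hf. apply cts_ReIm; simpl; apply cts_Ropp; now (apply cts_Re || apply cts_Im).
Qed.
Lemma cts_Cminus {U : UniformSpace} (f g : U -> C) (x : U) :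
  continuous f x -> continuous g x -> continuous (fun u => (f u - g u)%C) x.
Proof. intros Hf Hg. apply cts_Cplus; [| apply cts_Copp]; assumption. Qed.
Lemma cts_Cmult {U : UniformSpace} (f g : U -> C) (x : U) :
  continuous f x -> continuous g x -> continuous (fun u => (f u * g u)%C) x.
Proof.
  intros Hf Hg.
  assert (H1 := cts_Re _ _ Hf). assert (H2 := cts_Im _ _ Hf).
  assert (H3 := cts_Re _ _ Hg). assert (H4 := cts_Im _ _ Hg).
  apply cts_ReIm; simpl.
  - apply cts_Rminus; now apply cts_Rmult.
  - apply cts_Rplus; now apply cts_Rmult.
Qed.
Lemma cts_Cconj {U : UniformSpace} (f : U -> C) (x : U) :
  continuous f x -> continuous (fun u => Cconj (f u)) x.
Proof. intros Hf. apply cts_ReIm; simpl; [| apply cts_Ropp]; now (apply cts_Re || apply cts_Im). Qed.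
Lemma cts_RtoC {U : UniformSpace} (f : U -> R) (x : U) :
  continuous f x -> continuous (fun u => RtoC (f u)) x.
Proof. intros Hf. apply cts_ReIm; simpl; [exact Hf | apply continuous_const]. Qed.
Lemma Cmod2_neq0 (z : C) : z <> 0 -> Re z ^ 2 + Im z ^ 2 <> 0.
Proof.
  intros H H0. apply H. destruct z as [a b]; simpl in *.
  apply injective_projections; simpl; nra.
Qed.
Lemma cts_Cinv {U : UniformSpace} (f : U -> C) (x : U) :
  f x <> 0 -> continuous f x -> continuous (fun u => (/ f u)%C) x.
Proof.
  intros H0 Hf. apply Cmod2_neq0 in H0.
  assert (H1 := cts_Re _ _ Hf). assert (H2 := cts_Im _ _ Hf).
  assert (H3 : continuous (fun u => Re (f u) ^ 2 + Im (f u) ^ 2) x)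
    by (apply cts_Rplus; now apply cts_Rpow).
  apply cts_ReIm; simpl; (apply cts_Rdiv; [exact H0 | | exact H3]); [| apply cts_Ropp]; assumption.
Qed.
Lemma cts_Cdiv {U : UniformSpace} (f g : U -> C) (x : U) :
  g x <> 0 -> continuous f x -> continuous g x -> continuous (fun u => (f u / g u)%C) x.
Proof. intros. unfold Cdiv. apply cts_Cmult; [| apply cts_Cinv]; assumption. Qed.
Lemma cts_Cmod {U : UniformSpace} (f : U -> C) (x : U) :
  continuous f x -> continuous (fun u => Cmod (f u)) x.
Proof.
  intros Hf. unfold Cmod. apply cts_sqrt, cts_Rplus; apply cts_Rpow; now (apply cts_Re || apply cts_Im).
Qed.
Lemma cts_Cpow {U : UniformSpace} (f : U -> C) (n : nat) (x : U) :
  continuous f x -> continuous (fun u => (f u ^ n)%C) x.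
Proof.
  intros Hf. induction n as [|n IH]; simpl.
  - apply continuous_const.
  - now apply cts_Cmult.
Qed.
Lemma cts_comp {U V W : UniformSpace} (f : U -> V) (g : V -> W) (x : U) :
  continuous g (f x) -> continuous f x -> continuous (fun u => g (f u)) x.
Proof. intros; now apply (continuous_comp f g). Qed.

(** * The modulus and the topology of the plane *)

Lemma Re_le_Cmod (z : C) : Rabs (Re z) <= Cmod z.
Proof. apply Rle_trans with (2 := Rmax_Cmod z). apply Rmax_l. Qed.
Lemma Im_le_Cmod (z : C) : Rabs (Im z) <= Cmod z.
Proof. apply Rle_trans with (2 := Rmax_Cmod z). apply Rmax_r. Qed.
Lemma Cmod_le_ReIm (z : C) : Cmod z <= Rabs (Re z) + Rabs (Im z).
Proof.
  replace z with (Re z + Ci * Im z)%C at 1.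
  - eapply Rle_trans; [apply Cmod_triangle |].
    rewrite Cmod_mult, !Cmod_R, Cmod_Ci. lra.
  - destruct z; unfold RtoC, Ci, Cplus, Cmult; simpl; f_equal; ring.
Qed.

(** The balls of the uniform space [C] are squares, products of two intervals. A square of half-side
    [d / 2] fits into the disk of radius [d], so neighbourhoods may be measured by [Cmod]. *)
Lemma locally_Cmod (z : C) (P : C -> Prop) :
  locally z P <-> exists d, 0 < d /\ forall w, Cmod (w - z) < d -> P w.
Proof.
  split.
  - intros [d Hd]. exists d. split; [apply cond_pos |].
    intros w Hw. apply Hd. split.
    + apply Rle_lt_trans with (2 := Hw). apply (Re_le_Cmod (w - z)).
    + apply Rle_lt_trans with (2 := Hw). apply (Im_le_Cmod (w - z)).
  - intros (d & Hd & H). assert (Hd2 : 0 < d / 2) by lra.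
    exists (mkposreal _ Hd2). intros w [H1 H2]. apply H.
    eapply Rle_lt_trans; [apply Cmod_le_ReIm |].
    change (Rabs (Re (w - z)) < d / 2) in H1.
    change (Rabs (Im (w - z)) < d / 2) in H2. lra.
Qed.

Lemma continuous_C_eps {U : UniformSpace} (f : U -> C) (x : U) :
  continuous f x <-> forall e, 0 < e -> locally x (fun u => Cmod (f u - f x) < e).
Proof.
  split.
  - intros Hf e He. apply (Hf (fun w => Cmod (w - f x) < e)).
    apply locally_Cmod. exists e. split; [exact He | trivial].
  - intros H P HP. apply locally_Cmod in HP. destruct HP as (d & Hd & HP).
    unfold filtermap. generalize (H d Hd). apply filter_imp. intros u Hu. now apply HP.
Qed.

Lemma locally_R (x : R) (P : R -> Prop) :
  locally x P <-> exists d, 0 < d /\ forall y, Rabs (y - x) < d -> P y.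
Proof.
  split.
  - intros [d Hd]. exists d. split; [apply cond_pos | exact Hd].
  - intros (d & Hd & H). now exists (mkposreal _ Hd).
Qed.

(* Caratheodory's formulation: both the complex derivative ([i = id] on [C]) and the
   derivative of a path ([i = RtoC] on [R]) obey the same product, quotient and chain rules. *)
Definition cd {U : UniformSpace} (i : U -> C) (f : U -> C) (x : U) (l : C) : Prop :=
  exists q : U -> C, continuous q x /\ q x = l /\
    locally x (fun u => (f u - f x = (i u - i x) * q u)%C).

Notation cder := (cd (U := C_UniformSpace) (fun z : C => z)).
Notation pder := (cd (U := R_UniformSpace) RtoC).

(** * Rules of complex differentiation *)

Lemma cd_const {U : UniformSpace} (i : U -> C) (a : C) (x : U) : cd i (fun _ => a) x 0.
Proof.
  exists (fun _ => 0). split; [apply continuous_const | split; [reflexivity |]].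
  apply filter_forall. intros u. ring.
Qed.
Lemma cd_id {U : UniformSpace} (i : U -> C) (x : U) : cd i i x 1.
Proof.
  exists (fun _ => 1). split; [apply continuous_const | split; [reflexivity |]].
  apply filter_forall. intros u. ring.
Qed.
Lemma cd_cont {U : UniformSpace} (i f : U -> C) (x : U) (l : C) :
  continuous i x -> cd i f x l -> continuous f x.
Proof.
  intros Hi (q & Hq & Hl & H).
  apply continuous_ext_loc with (fun u => (f x + (i u - i x) * q u)%C).
  - revert H. apply filter_imp. intros u Hu. rewrite <- Hu. cring.
  - apply cts_Cplus; [apply continuous_const |].
    apply cts_Cmult; [| exact Hq]. apply cts_Cminus; [exact Hi | apply continuous_const].
Qed.
Lemma cder_cont (f : C -> C) (x l : C) : cder f x l -> continuous f x.
Proof. apply cd_cont. apply continuous_id. Qed.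
Lemma pder_cont (f : R -> C) (x : R) (l : C) : pder f x l -> continuous f x.
Proof. apply cd_cont. apply cts_RtoC, continuous_id. Qed.
Lemma cd_plus {U : UniformSpace} (i f g : U -> C) (x : U) (l m : C) :
  cd i f x l -> cd i g x m -> cd i (fun u => f u + g u)%C x (l + m)%C.
Proof.
  intros (p & Hp & Hl & H) (q & Hq & Hm & H').
  exists (fun u => p u + q u)%C. split; [now apply cts_Cplus | split; [congruence |]].
  generalize (filter_and _ _ H H'). apply filter_imp. intros u [E1 E2].
  replace (f u + g u - (f x + g x))%C with ((f u - f x) + (g u - g x))%C by ring.
  rewrite E1, E2. ring.
Qed.
Lemma cd_opp {U : UniformSpace} (i f : U -> C) (x : U) (l : C) :
  cd i f x l -> cd i (fun u => - f u)%C x (- l)%C.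
Proof.
  intros (p & Hp & Hl & H).
  exists (fun u => - p u)%C. split; [now apply cts_Copp | split; [congruence |]].
  revert H. apply filter_imp. intros u E1.
  replace (- f u - - f x)%C with (- (f u - f x))%C by ring.
  rewrite E1. ring.
Qed.
Lemma cd_minus {U : UniformSpace} (i f g : U -> C) (x : U) (l m : C) :
  cd i f x l -> cd i g x m -> cd i (fun u => f u - g u)%C x (l - m)%C.
Proof. intros Hf Hg. apply cd_plus; [| apply cd_opp]; assumption. Qed.
Lemma cd_mult {U : UniformSpace} (i f g : U -> C) (x : U) (l m : C) :
  continuous i x ->
  cd i f x l -> cd i g x m -> cd i (fun u => f u * g u)%C x (l * g x + f x * m)%C.
Proof.
  intros Hi Hf Hg. assert (Cg := cd_cont _ _ _ _ Hi Hg).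
  destruct Hf as (p & Hp & Hl & H). destruct Hg as (q & Hq & Hm & H').
  exists (fun u => p u * g u + f x * q u)%C.
  split; [apply cts_Cplus; apply cts_Cmult; trivial; apply continuous_const | split; [congruence |]].
  generalize (filter_and _ _ H H'). apply filter_imp. intros u [E1 E2].
  replace (f u * g u - f x * g x)%C with ((f u - f x) * g u + f x * (g u - g x))%C by ring.
  rewrite E1, E2. ring.
Qed.
Lemma continuous_neq0 {U : UniformSpace} (g : U -> C) (x : U) :
  continuous g x -> g x <> 0 -> locally x (fun u => g u <> 0).
Proof.
  intros Hg H0. assert (Hp : 0 < Cmod (g x)) by now apply Cmod_gt_0.
  generalize (proj1 (continuous_C_eps g x) Hg _ Hp). apply filter_imp.
  intros u Hu E. rewrite E in Hu.
  replace (0 - g x)%C with (- g x)%C in Hu by ring. rewrite Cmod_opp in Hu. lra.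
Qed.
Lemma cd_inv {U : UniformSpace} (i g : U -> C) (x : U) (m : C) :
  continuous i x -> g x <> 0 ->
  cd i g x m -> cd i (fun u => / g u)%C x (- m / (g x * g x))%C.
Proof.
  intros Hi H0 Hg. assert (Cg := cd_cont _ _ _ _ Hi Hg).
  destruct Hg as (q & Hq & Hm & H).
  exists (fun u => - q u / (g u * g x))%C. split; [| split; [congruence |]].
  - apply cts_Cdiv; [now apply Cmult_neq_0 | now apply cts_Copp |].
    apply cts_Cmult; [exact Cg | apply continuous_const].
  - generalize (filter_and _ _ H (continuous_neq0 _ _ Cg H0)). apply filter_imp.
    intros u [E1 E2].
    replace (/ g u - / g x)%C with (- (g u - g x) / (g u * g x))%C by (field; now split).
    rewrite E1. field; now split.
Qed.
Lemma cd_div {U : UniformSpace} (i f g : U -> C) (x : U) (l m : C) :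
  continuous i x -> g x <> 0 ->
  cd i f x l -> cd i g x m ->
  cd i (fun u => f u / g u)%C x ((l * g x - f x * m) / (g x * g x))%C.
Proof.
  intros Hi H0 Hf Hg.
  replace ((l * g x - f x * m) / (g x * g x))%C
    with (l * / g x + f x * (- m / (g x * g x)))%C by (field; trivial).
  apply (cd_mult i f (fun u => / g u)%C); [exact Hi | exact Hf | now apply cd_inv].
Qed.
Lemma cd_comp {U : UniformSpace} (i g : U -> C) (f : C -> C) (x : U) (l m : C) :
  continuous i x ->
  cder f (g x) l -> cd i g x m -> cd i (fun u => f (g u)) x (l * m)%C.
Proof.
  intros Hi Hf Hg. assert (Cg := cd_cont _ _ _ _ Hi Hg).
  destruct Hf as (p & Hp & Hl & H). destruct Hg as (q & Hq & Hm & H').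
  exists (fun u => p (g u) * q u)%C. split; [| split; [congruence |]].
  - apply cts_Cmult; [| exact Hq]. now apply (cts_comp g p).
  - assert (H1 : locally x (fun u => (f (g u) - f (g x))%C = ((g u - g x) * p (g u))%C))
      by exact (Cg _ H).
    generalize (filter_and _ _ H1 H'). apply filter_imp. intros u [E1 E2].
    rewrite E1, E2. ring.
Qed.
Lemma cd_ext_loc {U : UniformSpace} (i f g : U -> C) (x : U) (l : C) :
  locally x (fun u => f u = g u) -> cd i f x l -> cd i g x l.
Proof.
  intros He (q & Hq & Hl & H). exists q. split; [exact Hq | split; [exact Hl |]].
  assert (E := locally_singleton _ _ He).
  generalize (filter_and _ _ He H). apply filter_imp. intros u [E1 E2].
  now rewrite <- E1, <- E.
Qed.
Lemma cd_eq {U : UniformSpace} (i f : U -> C) (x : U) (l m : C) :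
  cd i f x l -> l = m -> cd i f x m.
Proof. intros H <-. exact H. Qed.

(** For the converse the slope function is the difference quotient, given the value [l] at [z]
    itself; its continuity at [z] is the estimate divided by [|w - z|]. *)
Lemma cder_eps (f : C -> C) (z l : C) :
  cder f z l <-> forall e, 0 < e -> exists d, 0 < d /\ forall w,
    Cmod (w - z) < d -> Cmod (f w - f z - (w - z) * l) <= e * Cmod (w - z).
Proof.
  split.
  - intros (q & Hq & Hl & H) e He.
    generalize (filter_and _ _ (proj1 (continuous_C_eps _ _) Hq e He) H).
    intros HH. apply locally_Cmod in HH. destruct HH as (d & Hd & HH).
    exists d. split; [exact Hd |]. intros w Hw. destruct (HH w Hw) as [H1 H2].
    rewrite H2, <- Hl.
    replace ((w - z) * q w - (w - z) * q z)%C with ((w - z) * (q w - q z))%C by ring.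
    rewrite Cmod_mult. assert (Hp := Cmod_ge_0 (w - z)). nra.
  - intros H.
    exists (fun w => if Ceq_dec w z then l else (f w - f z) / (w - z))%C.
    split; [| split].
    + apply continuous_C_eps. intros e He. assert (He2 : 0 < e / 2) by lra.
      destruct (H _ He2) as (d & Hd & HH). apply locally_Cmod. exists d. split; [exact Hd |].
      intros w Hw. destruct (Ceq_dec z z) as [_ | N]; [| now destruct N].
      destruct (Ceq_dec w z) as [-> | N].
      * replace (l - l)%C with (RtoC 0) by ring. rewrite Cmod_0. exact He.
      * assert (N' : (w - z <> 0)%C).
        { intros E. apply N. replace w with ((w - z) + z)%C by ring. rewrite E. ring. }
        replace ((f w - f z) / (w - z) - l)%C
          with ((f w - f z - (w - z) * l) * / (w - z))%C by (field; exact N').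
        rewrite Cmod_mult, Cmod_inv by exact N'.
        specialize (HH w Hw). assert (Hp : 0 < Cmod (w - z)) by now apply Cmod_gt_0.
        apply Rle_lt_trans with (e / 2); [| lra].
        apply Rmult_le_reg_r with (Cmod (w - z)); [exact Hp |].
        rewrite Rmult_assoc, Rinv_l, Rmult_1_r by lra. exact HH.
    + now destruct (Ceq_dec z z) as [_ | []].
    + apply filter_forall. intros w. destruct (Ceq_dec w z) as [-> | N]; [ring |].
      field. intros E. apply N. replace w with ((w - z) + z)%C by ring. rewrite E. ring.
Qed.

Lemma cder_is_derive (f : C -> C) (z l : C) :
  cder f z l <-> @is_derive C_AbsRing C_NormedModule f z l.
Proof.
  rewrite cder_eps. split.
  - intros H. split; [apply is_linear_scal_l |].
    intros x Hx. assert (E := is_filter_lim_locally_unique (K := C_AbsRing) (V := AbsRing_NormedModule C_AbsRing) z x Hx). rewrite <- E.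
    intros eps. destruct (H eps (cond_pos eps)) as (d & Hd & HH).
    exists (mkposreal d Hd). intros w Hw. apply HH. exact Hw.
  - intros [_ H] e He.
    specialize (H z (fun P HP => HP) (mkposreal e He)).
    destruct H as [d Hd]. exists d. split; [apply cond_pos |].
    intros w Hw. apply (Hd w). exact Hw.
Qed.

Lemma cder_C_derive (f : C -> C) (z l : C) : cder f z l -> C_derive f z = l.
Proof. intros H. now apply is_C_derive_unique, cder_is_derive. Qed.

Lemma cder_unique (f : C -> C) (z l m : C) : cder f z l -> cder f z m -> l = m.
Proof. intros H1 H2. rewrite <- (cder_C_derive _ _ _ H1). now apply cder_C_derive. Qed.

Lemma pder_quot (g : R -> C) (t : R) (d : C) :
  pder g t d <-> forall e, 0 < e -> exists h0, 0 < h0 /\ forall h, h <> 0 -> Rabs h < h0 ->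
    Cmod ((g (t + h)%R - g t) / h - d)%C < e.
Proof.
  split.
  - intros (q & Hq & Hd & H) e He.
    generalize (filter_and _ _ (proj1 (continuous_C_eps _ _) Hq e He) H).
    intros HH. apply locally_R in HH. destruct HH as (h0 & Hh0 & HH).
    exists h0. split; [exact Hh0 |]. intros h Hh Hlt.
    destruct (HH (t + h)) as [H1 H2]; [now replace (t + h - t) with h by ring |].
    rewrite H2, <- Hd.
    replace ((RtoC (t + h) - t) * q (t + h)%R / h)%C with (q (t + h)%R); [exact H1 |].
    rewrite RtoC_plus. cfield. intros E. apply Hh. now apply RtoC_inj.
  - intros H.
    exists (fun u => if Req_EM_T u t then d else (g u - g t) / (RtoC u - t))%C.
    assert (NZ : forall u, u <> t -> (RtoC u - t <> 0)%C).
    { intros u Hu E. apply Hu. apply (f_equal Re) in E. simpl in E. lra. }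
    split; [| split].
    + apply continuous_C_eps. intros e He.
      destruct (H _ He) as (h0 & Hh0 & HH). apply locally_R. exists h0. split; [exact Hh0 |].
      intros u Hu. destruct (Req_EM_T t t) as [_ | N]; [| now destruct N].
      destruct (Req_EM_T u t) as [-> | N].
      * replace (d - d)%C with (RtoC 0) by ring. rewrite Cmod_0. exact He.
      * specialize (HH (u - t)). replace (t + (u - t)) with u in HH by ring.
        rewrite RtoC_minus in HH. apply HH; [lra | exact Hu].
    + now destruct (Req_EM_T t t) as [_ | []].
    + apply filter_forall. intros u. destruct (Req_EM_T u t) as [-> | N]; [ring |].
      cfield. now apply NZ.
Qed.

Lemma ReIm_quot (g : R -> C) (t h : R) (d : C) : h <> 0 ->
  Re ((g (t + h)%R - g t) / h - d)%C = (Re (g (t + h)) - Re (g t)) / h - Re d /\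
  Im ((g (t + h)%R - g t) / h - d)%C = (Im (g (t + h)) - Im (g t)) / h - Im d.
Proof.
  intros Hh. destruct (g (t + h)) as [a b], (g t) as [a' b'], d as [c c'].
  simpl. split; field; exact Hh.
Qed.

(** Passing to coordinates makes [auto_derive], the real mean value theorem and real differentiation
    under the integral available for paths in the plane. *)
Lemma pder_parts (g : R -> C) (t : R) (d : C) :
  pder g t d <-> is_derive (fun u => Re (g u)) t (Re d) /\ is_derive (fun u => Im (g u)) t (Im d).
Proof.
  rewrite pder_quot. split.
  - intros H. split; apply is_derive_Reals; intros e He;
      destruct (H e He) as (h0 & Hh0 & HH); exists (mkposreal h0 Hh0); intros h Hh Hlt;
      specialize (HH h Hh Hlt); destruct (ReIm_quot g t h d Hh) as [E1 E2].
    + rewrite <- E1. eapply Rle_lt_trans; [apply Re_le_Cmod | exact HH].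
    + rewrite <- E2. eapply Rle_lt_trans; [apply Im_le_Cmod | exact HH].
  - intros [H1 H2] e He. apply is_derive_Reals in H1. apply is_derive_Reals in H2.
    assert (He2 : 0 < e / 2) by lra.
    destruct (H1 _ He2) as [d1 HH1]. destruct (H2 _ He2) as [d2 HH2].
    exists (Rmin d1 d2). split; [apply Rmin_glb_lt; apply cond_pos |].
    intros h Hh Hlt. destruct (ReIm_quot g t h d Hh) as [E1 E2].
    specialize (HH1 h Hh (Rlt_le_trans _ _ _ Hlt (Rmin_l _ _))).
    specialize (HH2 h Hh (Rlt_le_trans _ _ _ Hlt (Rmin_r _ _))).
    eapply Rle_lt_trans; [apply Cmod_le_ReIm |]. rewrite E1, E2. lra.
Qed.

Lemma pder_Re (g : R -> C) (t : R) (d : C) : pder g t d -> is_derive (fun u => Re (g u)) t (Re d).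
Proof. intros H. now apply pder_parts in H. Qed.
Lemma pder_Im (g : R -> C) (t : R) (d : C) : pder g t d -> is_derive (fun u => Im (g u)) t (Im d).
Proof. intros H. now apply pder_parts in H. Qed.
Lemma pder_RtoC (g : R -> R) (t d : R) : is_derive g t d -> pder (fun u => RtoC (g u)) t d.
Proof. intros H. apply pder_parts. simpl. split; [exact H | exact (is_derive_const 0 t)]. Qed.
Lemma pder_conj (g : R -> C) (t : R) (d : C) : pder g t d -> pder (fun u => Cconj (g u)) t (Cconj d).
Proof.
  intros H. apply pder_parts in H. apply pder_parts. simpl. split; [apply H |].
  apply (is_derive_opp (fun u => Im (g u)) t (Im d)). apply H.
Qed.
Lemma continuous_RtoC (t : R) : continuous RtoC t.
Proof. apply cts_RtoC, continuous_id. Qed.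
Lemma pder_mult (f g : R -> C) (t : R) (l m : C) :
  pder f t l -> pder g t m -> pder (fun u => f u * g u)%C t (l * g t + f t * m)%C.
Proof. apply cd_mult, continuous_RtoC. Qed.
Lemma pder_comp (f : C -> C) (g : R -> C) (t : R) (l m : C) :
  cder f (g t) l -> pder g t m -> pder (fun u => f (g u)) t (l * m)%C.
Proof. apply cd_comp, continuous_RtoC. Qed.
Lemma cder_mult (f g : C -> C) (z l m : C) :
  cder f z l -> cder g z m -> cder (fun u => f u * g u)%C z (l * g z + f z * m)%C.
Proof. apply cd_mult, continuous_id. Qed.
Lemma cder_div (f g : C -> C) (z l m : C) : g z <> 0 ->
  cder f z l -> cder g z m -> cder (fun u => f u / g u)%C z ((l * g z - f z * m) / (g z * g z))%C.
Proof. apply cd_div, continuous_id. Qed.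
Lemma cder_comp (f g : C -> C) (z l m : C) :
  cder f (g z) l -> cder g z m -> cder (fun u => f (g u)) z (l * m)%C.
Proof. apply cd_comp, continuous_id. Qed.

(** * The circle and its parametrisation *)

Definition eit (t : R) : C := (cos t, sin t).

Lemma Cmod_eit (t : R) : Cmod (eit t) = 1.
Proof.
  unfold Cmod, eit; cbn [fst snd]. rewrite <- sqrt_1. f_equal.
  assert (H := sin2_cos2 t). unfold Rsqr in H. lra.
Qed.
Lemma pder_eit (t : R) : pder eit t (Ci * eit t)%C.
Proof.
  apply pder_parts. unfold eit; simpl. split; auto_derive; trivial; ring.
Qed.
Lemma continuous_eit (t : R) : continuous eit t.
Proof. exact (pder_cont _ _ _ (pder_eit t)). Qed.
Lemma cts_eit {U : UniformSpace} (f : U -> R) (x : U) :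
  continuous f x -> continuous (fun u => eit (f u)) x.
Proof. apply cts_comp, continuous_eit. Qed.
Lemma eit_2PI : eit (2 * PI) = eit 0.
Proof. unfold eit. now rewrite cos_2PI, sin_2PI, cos_0, sin_0. Qed.

Lemma PI_pos : 0 < PI. Proof. exact PI_RGT_0. Qed.
Lemma PI2_nonneg : 0 <= 2 * PI. Proof. assert (H := PI_pos). lra. Qed.

Definition circle (r : R) (t : R) : C := (RtoC r * eit t)%C.

Lemma Cmod_circle (r t : R) : 0 <= r -> Cmod (circle r t) = r.
Proof. intros Hr. unfold circle. rewrite Cmod_mult, Cmod_eit, Cmod_R, Rabs_pos_eq; lra. Qed.
Lemma pder_circle (r t : R) : pder (circle r) t (Ci * circle r t)%C.
Proof.
  eapply cd_eq; [apply pder_mult; [apply cd_const | apply pder_eit] |]. unfold circle. cring.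
Qed.
Lemma cts_circle {U : UniformSpace} (r : R) (f : U -> R) (x : U) :
  continuous f x -> continuous (fun u => circle r (f u)) x.
Proof. intros H. apply cts_Cmult; [apply continuous_const | now apply cts_eit]. Qed.
Lemma circle_2PI (r : R) : circle r (2 * PI) = circle r 0.
Proof. unfold circle. now rewrite eit_2PI. Qed.

(** * Integrals of real and complex functions of a real variable *)

Lemma ex_RInt_cts (g : R -> R) (a b : R) : a <= b ->
  (forall t, a <= t <= b -> continuous g t) -> ex_RInt g a b.
Proof.
  intros Hab H. apply (ex_RInt_continuous (V := R_CompleteNormedModule)).
  intros t Ht. apply H. now rewrite Rmin_left, Rmax_right in Ht.
Qed.

Ltac ct_step := lazymatch goal with
  | |- continuous (fun _ => ?c) _ => apply continuous_const
  | |- continuous (fun u => u) _ => apply continuous_id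
  | |- continuous (fun p => fst p) _ => apply continuous_fst
  | |- continuous (fun p => snd p) _ => apply continuous_snd
  | |- continuous sin _ => apply continuous_sin
  | |- continuous cos _ => apply continuous_cos
  | |- continuous eit _ => apply continuous_eit
  | |- continuous (fun u => Rplus (@?f u) (@?g u)) _ => apply cts_Rplus
  | |- continuous (fun u => Rminus (@?f u) (@?g u)) _ => apply cts_Rminus
  | |- continuous (fun u => Rmult (@?f u) (@?g u)) _ => apply cts_Rmult
  | |- continuous (fun u => Ropp (@?f u)) _ => apply cts_Ropp
  | |- continuous (fun u => pow (@?f u) _) _ => apply cts_Rpow
  | |- continuous (fun u => sin (@?f u)) _ => apply cts_sin
  | |- continuous (fun u => cos (@?f u)) _ => apply cts_cos
  | |- continuous (fun u => Re (@?f u)) _ => apply (cts_Re f)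
  | |- continuous (fun u => Im (@?f u)) _ => apply (cts_Im f)
  | |- continuous (fun u => Cplus (@?f u) (@?g u)) _ => apply cts_Cplus
  | |- continuous (fun u => Cminus (@?f u) (@?g u)) _ => apply cts_Cminus
  | |- continuous (fun u => Cmult (@?f u) (@?g u)) _ => apply cts_Cmult
  | |- continuous (fun u => Copp (@?f u)) _ => apply cts_Copp
  | |- continuous (fun u => Cpow (@?f u) _) _ => apply cts_Cpow
  | |- continuous (fun u => Cconj (@?f u)) _ => apply cts_Cconj
  | |- continuous (fun u => Cmod (@?f u)) _ => apply (cts_Cmod f)
  | |- continuous (fun u => RtoC (@?f u)) _ => apply cts_RtoC
  | |- continuous (fun u => circle (@?r u) (@?f u)) _ => apply cts_Cmult
  | |- continuous (circle ?r) _ => apply (cts_circle r (fun u => u))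
  | |- continuous (fun u => eit (@?f u)) _ => apply cts_eit
  | |- continuous (fun u => (@?f u, @?g u)) _ => apply continuous_pair_C
  end.
Ltac ct := solve [intros; cbv beta; try apply ex_RInt_cts; intros;
  try solve [exact PI2_nonneg | lra]; repeat (solve [auto] || ct_step)].

Definition CInt (g : R -> C) (a b : R) : C :=
  (RInt (fun t => Re (g t)) a b, RInt (fun t => Im (g t)) a b).

Lemma ex_RInt_between (g : R -> R) (a b : R) :
  (forall t, Rmin a b <= t <= Rmax a b -> continuous g t) -> ex_RInt g a b.
Proof. apply (ex_RInt_continuous (V := R_CompleteNormedModule)). Qed.

Lemma is_derive_continuous (g : R -> R) (t d : R) : is_derive g t d -> continuous g t.
Proof. intros H. apply (ex_derive_continuous (V := R_NormedModule)). now exists d. Qed.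

Lemma RInt_scalR (g : R -> R) (k a b : R) : ex_RInt g a b ->
  RInt (fun t => k * g t) a b = k * RInt g a b.
Proof. apply (RInt_scal (V := R_CompleteNormedModule) g). Qed.

Lemma RInt_minusR (g h : R -> R) (a b : R) : ex_RInt g a b -> ex_RInt h a b ->
  RInt (fun t => g t - h t) a b = RInt g a b - RInt h a b.
Proof. apply (RInt_minus (V := R_CompleteNormedModule) g h). Qed.

Lemma RInt_plusR (g h : R -> R) (a b : R) : ex_RInt g a b -> ex_RInt h a b ->
  RInt (fun t => g t + h t) a b = RInt g a b + RInt h a b.
Proof. apply (RInt_plus (V := R_CompleteNormedModule) g h). Qed.

Lemma RInt_swapR (g : R -> R) (a b : R) : ex_RInt g a b -> RInt g b a = - RInt g a b.
Proof. intros H. symmetry. exact (opp_RInt_swap (V := R_CompleteNormedModule) g a b H). Qed.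

Lemma RInt_ChaslesR (g : R -> R) (a b c : R) : ex_RInt g a b -> ex_RInt g b c ->
  RInt g a b + RInt g b c = RInt g a c.
Proof. apply (RInt_Chasles (V := R_CompleteNormedModule) g). Qed.

Lemma RInt_comp_linR (g : R -> R) (u v a b : R) : ex_RInt g (u * a + v) (u * b + v) ->
  RInt (fun t => u * g (u * t + v)) a b = RInt g (u * a + v) (u * b + v).
Proof. apply (RInt_comp_lin (V := R_CompleteNormedModule) g). Qed.

Lemma RInt_constR (k a b : R) : RInt (fun _ => k) a b = k * (b - a).
Proof. rewrite RInt_const. apply Rmult_comm. Qed.

Lemma RInt_FTC (g d : R -> R) (a b : R) : a <= b ->
  (forall t, a <= t <= b -> is_derive g t (d t)) ->
  (forall t, a <= t <= b -> continuous d t) -> RInt d a b = g b - g a.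
Proof.
  intros Hab H1 H2. apply is_RInt_unique. apply (is_RInt_derive (V := R_CompleteNormedModule));
    rewrite Rmin_left, Rmax_right by exact Hab; assumption.
Qed.

Lemma CInt_FTC (g d : R -> C) (a b : R) : a <= b ->
  (forall t, a <= t <= b -> pder g t (d t)) ->
  (forall t, a <= t <= b -> continuous d t) -> CInt d a b = (g b - g a)%C.
Proof.
  intros Hab H1 H2. unfold CInt.
  rewrite (RInt_FTC (fun t => Re (g t)) (fun t => Re (d t)) a b),
    (RInt_FTC (fun t => Im (g t)) (fun t => Im (d t)) a b); trivial.
  - now intros t Ht; apply pder_Im, H1.
  - ct.
  - now intros t Ht; apply pder_Re, H1.
  - ct.
Qed.

Lemma RInt_lin (f g : R -> R) (k l a b : R) : ex_RInt f a b -> ex_RInt g a b ->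
  RInt (fun t => k * f t + l * g t) a b = k * RInt f a b + l * RInt g a b.
Proof.
  intros Hf Hg.
  rewrite RInt_plusR, !RInt_scalR; trivial.
  - now apply (ex_RInt_scal (V := R_CompleteNormedModule)).
  - now apply (ex_RInt_scal (V := R_CompleteNormedModule)).
Qed.

Lemma ex_RInt_Re (a b : R) (Hab : a <= b) (g : R -> C) : (forall t, a <= t <= b -> continuous g t) ->
  ex_RInt (fun t => Re (g t)) a b.
Proof. intros H. apply ex_RInt_cts; trivial. intros t Ht. now apply cts_Re, H. Qed.
Lemma ex_RInt_Im (a b : R) (Hab : a <= b) (g : R -> C) : (forall t, a <= t <= b -> continuous g t) ->
  ex_RInt (fun t => Im (g t)) a b.
Proof. intros H. apply ex_RInt_cts; trivial. intros t Ht. now apply cts_Im, H. Qed.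

Lemma CInt_scal (a b : R) (Hab : a <= b) (k : C) (g : R -> C) :
  (forall t, a <= t <= b -> continuous g t) ->
  CInt (fun t => k * g t)%C a b = (k * CInt g a b)%C.
Proof.
  intros Hg. assert (H1 := ex_RInt_Re a b Hab g Hg). assert (H2 := ex_RInt_Im a b Hab g Hg).
  unfold CInt, Cmult. simpl. f_equal.
  - transitivity (fst k * RInt (fun t => Re (g t)) a b + (- snd k) * RInt (fun t => Im (g t)) a b);
      [| rring].
    rewrite <- RInt_lin by trivial. apply RInt_ext. intros; unfold Re, Im; simpl; rring.
  - transitivity (fst k * RInt (fun t => Im (g t)) a b + (snd k) * RInt (fun t => Re (g t)) a b);
      [| rring].
    rewrite <- RInt_lin by trivial. apply RInt_ext. intros; unfold Re, Im; simpl; rring.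
Qed.

Lemma CInt_const (a b : R) (k : C) : CInt (fun _ => k) a b = (k * RtoC (b - a))%C.
Proof.
  unfold CInt. rewrite !RInt_constR.
  destruct k as [x y]. unfold RtoC, Cmult; simpl. f_equal; ring.
Qed.

(** Rotate the integral onto the real axis: with [X] its value, [|X|^2] is the integral of
    [Re (conj X * g)], which is at most [|X| * |g|] pointwise. *)
Lemma CInt_Cmod (a b : R) (Hab : a <= b) (g : R -> C) : (forall t, a <= t <= b -> continuous g t) ->
  Cmod (CInt g a b) <= RInt (fun t => Cmod (g t)) a b.
Proof.
  intros Hg. set (X := CInt g a b).
  assert (Hm : ex_RInt (fun t => Cmod (g t)) a b)
    by ct.
  destruct (Ceq_dec X 0) as [-> | N].
  - rewrite Cmod_0. apply RInt_ge_0; trivial. intros; apply Cmod_ge_0.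
  - assert (Hp : 0 < Cmod X) by now apply Cmod_gt_0.
    assert (E : (Cconj X * X)%C = (Cmod X * Cmod X)%R).
    { replace (Cmod X * Cmod X)%R with (Cmod X ^ 2)%R by ring. rewrite Cmod2_conj. ring. }
    unfold X at 2 in E. rewrite <- CInt_scal in E by trivial.
    apply (f_equal Re) in E. simpl in E.
    apply Rmult_le_reg_l with (Cmod X); [exact Hp |]. rewrite <- E.
    assert (E2 : Cmod X * RInt (fun t => Cmod (g t)) a b =
        RInt (fun t => Cmod X * Cmod (g t)) a b)
      by now rewrite RInt_scalR.
    rewrite E2. apply RInt_le; trivial.
    + apply (ex_RInt_Re a b Hab (fun t => Cconj X * g t)%C). intros t Ht.
      apply cts_Cmult; [apply continuous_const | now apply Hg].
    + ct.
    + intros t Ht. eapply Rle_trans; [apply Rle_abs |].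
      eapply Rle_trans; [apply (Re_le_Cmod (Cconj X * g t)%C) |].
      rewrite Cmod_mult, Cmod_conj. apply Rle_refl.
Qed.

Lemma CInt_bound (a b : R) (Hab : a <= b) (g : R -> C) (M : R) : (forall t, a <= t <= b -> continuous g t) ->
  (forall t, a <= t <= b -> Cmod (g t) <= M) -> Cmod (CInt g a b) <= M * (b - a).
Proof.
  intros Hg HM. eapply Rle_trans; [now apply CInt_Cmod |].
  replace (M * (b - a)) with (RInt (fun _ => M) a b)
    by apply RInt_constR.
  apply RInt_le; trivial.
  - ct.
  - apply ex_RInt_const.
  - intros t Ht. apply HM. lra.
Qed.

(** Differentiation under the integral with hypotheses on an open rectangle around [{x}] times
    [[a, b]] only, since the integrands to come are controlled only inside a disk. *)
Lemma RInt_param_derive_loc (H H' : R -> R -> R) (lo hi lo' hi' a b x : R) :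
  a <= b -> lo' < a -> b < hi' -> lo < x < hi ->
  (forall u t, lo < u < hi -> lo' < t < hi' -> is_derive (fun v => H v t) u (H' u t)) ->
  (forall u t, lo < u < hi -> lo' < t < hi' ->
    continuous (fun p : R * R => H' (fst p) (snd p)) (u, t)) ->
  (forall u t, lo < u < hi -> lo' < t < hi' -> continuous (H u) t) ->
  is_derive (fun u => RInt (H u) a b) x (RInt (H' x) a b).
Proof.
  intros Hab Ha Hb Hx HD HC HC0.
  assert (Loc : forall l h y, l < y < h -> locally y (fun u => l < u < h)).
  { intros l h y Hy. apply locally_R. exists (Rmin (y - l) (h - y)).
    split; [apply Rmin_glb_lt; lra |].
    intros z Hz. assert (H1 := Rmin_l (y - l) (h - y)). assert (H2 := Rmin_r (y - l) (h - y)).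
    apply Rabs_def2 in Hz. lra. }
  assert (Lx := Loc lo hi x Hx).
  replace (RInt (H' x) a b) with (RInt (fun t => Derive (fun u => H u t) x) a b).
  - apply is_derive_RInt_param.
    + revert Lx. apply filter_imp. intros u Hu t Ht.
      rewrite Rmin_left, Rmax_right in Ht by exact Hab. eexists. apply HD; [exact Hu | lra].
    + intros t Ht. rewrite Rmin_left, Rmax_right in Ht by exact Hab.
      apply continuity_2d_pt_filterlim.
      assert (E : Derive (fun z => H z t) x = H' x t) by (apply is_derive_unique, HD; lra).
      rewrite E.
      assert (HC1 : continuous (fun p : R * R => Derive (fun z => H z (snd p)) (fst p)) (x, t)).
      { apply (continuous_ext_loc _ (fun p : R * R => H' (fst p) (snd p))); [| apply HC; lra].
        destruct Lx as [d Hd]. destruct (Loc lo' hi' t ltac:(lra)) as [d' Hd'].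
        exists (mkposreal _ (Rmin_stable_in_posreal d d')). intros [u v] [Hu Hv]. simpl in Hu, Hv |- *.
        symmetry. apply is_derive_unique, HD.
        - apply Hd. eapply Rlt_le_trans; [exact Hu | apply Rmin_l].
        - apply Hd'. eapply Rlt_le_trans; [exact Hv | apply Rmin_r]. }
      unfold continuous in HC1. simpl in HC1. rewrite E in HC1. exact HC1.
    + revert Lx. apply filter_imp. intros u Hu. apply ex_RInt_cts; trivial.
      intros t Ht. apply HC0; lra.
  - apply RInt_ext. intros t Ht. rewrite Rmin_left, Rmax_right in Ht by exact Hab.
    apply is_derive_unique, HD; lra.
Qed.

Lemma RInt_param_derive (H H' : R -> R -> R) (lo hi a b x : R) :
  a <= b -> lo < x < hi ->
  (forall u t, lo < u < hi -> is_derive (fun v => H v t) u (H' u t)) ->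
  (forall u t, lo < u < hi -> continuous (fun p : R * R => H' (fst p) (snd p)) (u, t)) ->
  (forall u t, lo < u < hi -> continuous (H u) t) ->
  is_derive (fun u => RInt (H u) a b) x (RInt (H' x) a b).
Proof.
  intros Hab Hx HD HC HC0.
  apply (RInt_param_derive_loc H H' lo hi (a - 1) (b + 1)); try lra; auto.
Qed.

Lemma CInt_param_derive (H H' : R -> R -> C) (lo hi a b x : R) :
  a <= b -> lo < x < hi ->
  (forall u t, lo < u < hi -> pder (fun v => H v t) u (H' u t)) ->
  (forall u t, lo < u < hi -> continuous (fun p : R * R => H' (fst p) (snd p)) (u, t)) ->
  (forall u t, lo < u < hi -> continuous (H u) t) ->
  pder (fun u => CInt (H u) a b) x (CInt (H' x) a b).
Proof.
  intros Hab Hx HD HC HC0. apply pder_parts. unfold CInt; simpl. split.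
  - apply (RInt_param_derive (fun u t => Re (H u t)) (fun u t => Re (H' u t)) lo hi); trivial.
    + intros u t Hu. now apply pder_Re, HD.
    + ct.
    + ct.
  - apply (RInt_param_derive (fun u t => Im (H u t)) (fun u t => Im (H' u t)) lo hi); trivial.
    + intros u t Hu. now apply pder_Im, HD.
    + ct.
    + ct.
Qed.

Lemma const_of_derive0 (g : R -> R) (a b : R) : a <= b ->
  (forall t, a < t < b -> is_derive g t 0) -> (forall t, a <= t <= b -> continuous g t) ->
  g b = g a.
Proof.
  intros Hab HD HC.
  destruct (MVT_gen g a b (fun _ => 0)) as (c & _ & E).
  - rewrite Rmin_left, Rmax_right by exact Hab. exact HD.
  - rewrite Rmin_left, Rmax_right by exact Hab. intros t Ht.
    apply continuity_pt_filterlim. now apply HC.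
  - lra.
Qed.

Lemma const_of_pder0 (g : R -> C) (a b : R) : a <= b ->
  (forall t, a < t < b -> pder g t 0) -> (forall t, a <= t <= b -> continuous g t) ->
  g b = g a.
Proof.
  intros Hab HD HC. apply injective_projections.
  - apply (const_of_derive0 (fun t => Re (g t)) a b Hab).
    + intros t Ht. apply (pder_Re g t 0). now apply HD.
    + ct.
  - apply (const_of_derive0 (fun t => Im (g t)) a b Hab).
    + intros t Ht. apply (pder_Im g t 0). now apply HD.
    + ct.
Qed.

(** The endpoints are unordered because a primitive on a disk integrates from 0 to coordinates of
    either sign. *)
Definition cts_between (g : R -> C) (a b : R) : Prop :=
  forall t, Rmin a b <= t <= Rmax a b -> continuous g t.

Lemma cts_between_Re (g : R -> C) (a b : R) : cts_between g a b ->
  ex_RInt (fun t => Re (g t)) a b.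
Proof.
  intros H. apply ex_RInt_between.
  intros t Ht. now apply cts_Re, H.
Qed.
Lemma cts_between_Im (g : R -> C) (a b : R) : cts_between g a b ->
  ex_RInt (fun t => Im (g t)) a b.
Proof.
  intros H. apply ex_RInt_between.
  intros t Ht. now apply cts_Im, H.
Qed.

Lemma CInt_swap (g : R -> C) (a b : R) : cts_between g a b -> CInt g b a = (- CInt g a b)%C.
Proof.
  intros H. unfold CInt, Copp; simpl.
  f_equal.
  - now apply (RInt_swapR (fun t => Re (g t))), cts_between_Re.
  - now apply (RInt_swapR (fun t => Im (g t))), cts_between_Im.
Qed.

Lemma CInt_Chasles (g : R -> C) (a b c : R) : cts_between g a b -> cts_between g b c ->
  (CInt g a b + CInt g b c)%C = CInt g a c.
Proof.
  intros H1 H2. unfold CInt, Cplus; simpl. f_equal.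
  - apply (RInt_ChaslesR (fun t => Re (g t))); now apply cts_between_Re.
  - apply (RInt_ChaslesR (fun t => Im (g t))); now apply cts_between_Im.
Qed.

Lemma CInt_plus (g h : R -> C) (a b : R) : cts_between g a b -> cts_between h a b ->
  CInt (fun t => g t + h t)%C a b = (CInt g a b + CInt h a b)%C.
Proof.
  intros Hg Hh. unfold CInt, Cplus. simpl. f_equal.
  - apply (RInt_plusR (fun t => Re (g t)) (fun t => Re (h t)));
      now apply cts_between_Re.
  - apply (RInt_plusR (fun t => Im (g t)) (fun t => Im (h t)));
      now apply cts_between_Im.
Qed.

Lemma CInt_minus (g h : R -> C) (a b : R) : cts_between g a b -> cts_between h a b ->
  CInt (fun t => g t - h t)%C a b = (CInt g a b - CInt h a b)%C.
Proof.
  intros Hg Hh. unfold CInt, Cminus, Cplus. simpl. f_equal.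
  - apply (RInt_minusR (fun t => Re (g t)) (fun t => Re (h t)));
      now apply cts_between_Re.
  - apply (RInt_minusR (fun t => Im (g t)) (fun t => Im (h t)));
      now apply cts_between_Im.
Qed.

Lemma CInt_ext (g h : R -> C) (a b : R) : (forall t, g t = h t) -> CInt g a b = CInt h a b.
Proof. intros H. unfold CInt. f_equal; apply RInt_ext; intros; now rewrite H. Qed.

Lemma CInt_bound_between (g : R -> C) (a b M : R) : cts_between g a b ->
  (forall t, Rmin a b <= t <= Rmax a b -> Cmod (g t) <= M) ->
  Cmod (CInt g a b) <= M * Rabs (b - a).
Proof.
  intros Hg HM. destruct (Rle_dec a b) as [Hab | Hab].
  - rewrite Rabs_pos_eq by lra. unfold cts_between in Hg.
    rewrite Rmin_left, Rmax_right in Hg, HM by lra. now apply CInt_bound.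
  - rewrite (CInt_swap g b a).
    + rewrite Cmod_opp, Rabs_left, Ropp_minus_distr by lra. unfold cts_between in Hg.
      rewrite Rmin_right, Rmax_left in Hg, HM by lra. apply CInt_bound; trivial. lra.
    + intros t Ht. apply Hg. now rewrite Rmin_comm, Rmax_comm.
Qed.

(** * Goursat's theorem *)

(** The counterclockwise integral of [f dz] around a rectangle: [dz = dx] on the bottom and top
    edges, [dz = i dy] on the right and left ones. *)
Definition bdry (f : C -> C) (a b c d : R) : C :=
  (CInt (fun x => f (x, c) - f (x, d)) a b + Ci * CInt (fun y => f (b, y) - f (a, y)) c d)%C.

Definition box (a b c d : R) (z : C) : Prop :=
  Rmin a b <= Re z <= Rmax a b /\ Rmin c d <= Im z <= Rmax c d.

Definition cts_on (D : C -> Prop) (f : C -> C) : Prop := forall z, D z -> continuous f z.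

Lemma continuous_hline (f : C -> C) (x y : R) :
  continuous f ((x, y) : C) -> continuous (fun s => f (s, y)) x.
Proof.
  intros H. apply (cts_comp (fun s : R => (s, y) : C) f); [exact H |].
  apply continuous_pair_C; [apply continuous_id | apply continuous_const].
Qed.
Lemma continuous_vline (f : C -> C) (x y : R) :
  continuous f ((x, y) : C) -> continuous (fun t => f (x, t)) y.
Proof.
  intros H. apply (cts_comp (fun t : R => (x, t) : C) f); [exact H |].
  apply continuous_pair_C; [apply continuous_const | apply continuous_id].
Qed.
Lemma cts_h (f : C -> C) (a b c d y : R) : cts_on (box a b c d) f ->
  Rmin c d <= y <= Rmax c d -> cts_between (fun s => f (s, y)) a b.
Proof. intros H Hy t Ht. now apply continuous_hline, H. Qed.
Lemma cts_v (f : C -> C) (a b c d x : R) : cts_on (box a b c d) f ->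
  Rmin a b <= x <= Rmax a b -> cts_between (fun s => f (x, s)) c d.
Proof. intros H Hy t Ht. now apply continuous_vline, H. Qed.

Lemma cts_between_minus (g h : R -> C) (a b : R) : cts_between g a b -> cts_between h a b ->
  cts_between (fun t => g t - h t)%C a b.
Proof. intros Hg Hh t Ht. apply cts_Cminus; [now apply Hg | now apply Hh]. Qed.

Ltac minmax := unfold Rmin, Rmax in *; repeat destruct Rle_dec; try lra.

(** The common edge [Re z = m] is traversed once in each direction and cancels. *)
Lemma bdry_splitx (f : C -> C) (a m b c d : R) :
  Rmin a b <= m <= Rmax a b -> cts_on (box a b c d) f ->
  bdry f a b c d = (bdry f a m c d + bdry f m b c d)%C.
Proof.
  intros Hm H. unfold bdry.
  assert (Hc : Rmin c d <= c <= Rmax c d) by minmax.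
  assert (Hd : Rmin c d <= d <= Rmax c d) by minmax.
  assert (Ha : Rmin a b <= a <= Rmax a b) by minmax.
  assert (Hb : Rmin a b <= b <= Rmax a b) by minmax.
  assert (K := cts_between_minus _ _ _ _ (cts_h f a b c d c H Hc) (cts_h f a b c d d H Hd)).
  rewrite <- (CInt_Chasles _ a m b).
  - rewrite (CInt_ext (fun y => f (b, y) - f (a, y))%C
      (fun y => (f (m, y) - f (a, y)) + (f (b, y) - f (m, y)))%C) by (intros; ring).
    rewrite CInt_plus; [ring | |]; apply cts_between_minus; now apply (cts_v f a b c d).
  - intros t Ht. apply K. minmax.
  - intros t Ht. apply K. minmax.
Qed.

Lemma bdry_splity (f : C -> C) (a b c m d : R) :
  Rmin c d <= m <= Rmax c d -> cts_on (box a b c d) f ->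
  bdry f a b c d = (bdry f a b c m + bdry f a b m d)%C.
Proof.
  intros Hm H. unfold bdry.
  assert (Hc : Rmin c d <= c <= Rmax c d) by minmax.
  assert (Hd : Rmin c d <= d <= Rmax c d) by minmax.
  assert (Ha : Rmin a b <= a <= Rmax a b) by minmax.
  assert (Hb : Rmin a b <= b <= Rmax a b) by minmax.
  assert (K := cts_between_minus _ _ _ _ (cts_v f a b c d b H Hb) (cts_v f a b c d a H Ha)).
  rewrite <- (CInt_Chasles (fun y => f (b, y) - f (a, y))%C c m d).
  - rewrite (CInt_ext (fun y => f (y, c) - f (y, d))%C
      (fun y => (f (y, c) - f (y, m)) + (f (y, m) - f (y, d)))%C) by (intros; ring).
    rewrite CInt_plus; [ring | |]; apply cts_between_minus; now apply (cts_h f a b c d).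
  - intros t Ht. apply K. minmax.
  - intros t Ht. apply K. minmax.
Qed.

Lemma nested_intervals (u v : nat -> R) :
  (forall n, u n <= u (S n)) -> (forall n, v (S n) <= v n) -> (forall n, u n <= v n) ->
  exists x, forall n, u n <= x <= v n.
Proof.
  intros Hu Hv Huv.
  assert (Mu : forall n k, u n <= u (n + k)%nat).
  { intros n k. induction k as [|k IH]; [rewrite Nat.add_0_r; lra |].
    rewrite Nat.add_succ_r. specialize (Hu (n + k)%nat). lra. }
  assert (Mv : forall n k, v (n + k)%nat <= v n).
  { intros n k. induction k as [|k IH]; [rewrite Nat.add_0_r; lra |].
    rewrite Nat.add_succ_r. specialize (Hv (n + k)%nat). lra. }
  assert (UV : forall n m, u n <= v m).
  { intros n m. specialize (Mu n m). specialize (Mv m n). specialize (Huv (n + m)%nat).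
    rewrite (Nat.add_comm m n) in Mv. lra. }
  destruct (completeness (fun x => exists n, x = u n)) as [x [H1 H2]].
  - exists (v O). intros x [n ->]. apply UV.
  - exists (u O). now exists O.
  - exists x. intros n. split; [apply H1; now exists n |].
    apply H2. intros y [m ->]. apply UV.
Qed.

(** Produces the sequence of bisected rectangles; the subtype carries the invariant [P] along the
    recursion, and the link [Q] records the nesting. *)
Lemma dependent_choice {T : Type} (P : nat -> T -> Prop) (Q : nat -> T -> T -> Prop) (x0 : T) :
  P O x0 -> (forall n x, P n x -> exists y, P (S n) y /\ Q n x y) ->
  exists s : nat -> T, s O = x0 /\ forall n, P n (s n) /\ Q n (s n) (s (S n)).
Proof.
  intros H0 HS.
  set (step := fun n (x : {x | P n x}) =>
    constructive_indefinite_description _ (HS n (proj1_sig x) (proj2_sig x))).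
  set (s := fix s n : {x | P n x} := match n with
    | O => exist _ x0 H0
    | S m => exist _ (proj1_sig (step m (s m))) (proj1 (proj2_sig (step m (s m))))
    end).
  exists (fun n => proj1_sig (s n)). split; [reflexivity |].
  intros n. split; [exact (proj2_sig (s n)) |].
  simpl. exact (proj2 (proj2_sig (step n (s n)))).
Qed.

(** The affine part of [f] at the point has boundary integral zero, so only the remainder counts,
    and it is at most [e / 2] times the half-perimeter. *)
Lemma bdry_small (f : C -> C) (x0 y0 : R) (l : C) (e : R) :
  0 < e -> cder f ((x0, y0) : C) l ->
  exists delta, 0 < delta /\ forall a b c d, a <= x0 <= b -> c <= y0 <= d ->
    (b - a) + (d - c) < delta -> cts_on (box a b c d) f ->
    Cmod (bdry f a b c d) <= e * ((b - a) + (d - c)) ^ 2.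
Proof.
  intros He Hf. assert (He2 : 0 < e / 2) by lra.
  destruct (proj1 (cder_eps _ _ _) Hf _ He2) as (delta & Hd & HH).
  exists delta. split; [exact Hd |]. intros a b c d Hx Hy Hsmall Hc.
  set (s := (b - a) + (d - c)) in *.
  assert (E : forall x y, a <= x <= b -> c <= y <= d ->
    Cmod (f (x, y) - f (x0, y0) - ((x, y) - (x0, y0)) * l)%C <= e / 2 * s).
  { intros x y H1 H2.
    assert (B : Cmod ((x, y) - (x0, y0))%C <= s).
    { eapply Rle_trans; [apply Cmod_le_ReIm |]. simpl. unfold s.
      assert (Rabs (x + - x0) <= b - a) by (apply Rabs_le; lra).
      assert (Rabs (y + - y0) <= d - c) by (apply Rabs_le; lra). lra. }
    eapply Rle_trans; [apply HH; lra |]. apply Rmult_le_compat_l; lra. }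
  assert (Hhc := cts_h f a b c d c Hc ltac:(minmax)).
  assert (Hhd := cts_h f a b c d d Hc ltac:(minmax)).
  assert (Hva := cts_v f a b c d a Hc ltac:(minmax)).
  assert (Hvb := cts_v f a b c d b Hc ltac:(minmax)).
  assert (Kx := cts_between_minus _ _ _ _ Hhc Hhd).
  assert (Ky := cts_between_minus _ _ _ _ Hvb Hva).
  (* [k1] and [k2] are the differences of the linear part between opposite edges, constant along
     each edge; [k1 * (b - a) + Ci * k2 * (d - c)] vanishes, so subtracting them leaves [bdry]
     unchanged. *)
  set (k1 := (Ci * RtoC (c - d) * l)%C). set (k2 := (RtoC (b - a) * l)%C).
  assert (E1 : Cmod (CInt (fun x => f (x, c) - f (x, d) - k1)%C a b) <= e * s * (b - a)).
  { replace (e * s * (b - a)) with (e * s * Rabs (b - a)) by (rewrite Rabs_pos_eq; lra).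
    apply CInt_bound_between.
    - intros t Ht. apply cts_Cminus; [now apply Kx | apply continuous_const].
    - intros t Ht. rewrite Rmin_left, Rmax_right in Ht by lra.
      replace (f (t, c) - f (t, d) - k1)%C with
        ((f (t, c) - f (x0, y0) - ((t, c) - (x0, y0)) * l) -
         (f (t, d) - f (x0, y0) - ((t, d) - (x0, y0)) * l))%C.
      + eapply Rle_trans; [apply Cmod_triangle |]. rewrite Cmod_opp.
        assert (A1 := E t c Ht ltac:(lra)). assert (A2 := E t d Ht ltac:(lra)). lra.
      + unfold k1.
        replace ((t, c) - (x0, y0))%C with (((t, d) - (x0, y0)) + Ci * RtoC (c - d))%C; [cring |].
        apply injective_projections; simpl; ring. }
  assert (E2 : Cmod (CInt (fun y => f (b, y) - f (a, y) - k2)%C c d) <= e * s * (d - c)).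
  { replace (e * s * (d - c)) with (e * s * Rabs (d - c)) by (rewrite Rabs_pos_eq; lra).
    apply CInt_bound_between.
    - intros t Ht. apply cts_Cminus; [now apply Ky | apply continuous_const].
    - intros t Ht. rewrite Rmin_left, Rmax_right in Ht by lra.
      replace (f (b, t) - f (a, t) - k2)%C with
        ((f (b, t) - f (x0, y0) - ((b, t) - (x0, y0)) * l) -
         (f (a, t) - f (x0, y0) - ((a, t) - (x0, y0)) * l))%C.
      + eapply Rle_trans; [apply Cmod_triangle |]. rewrite Cmod_opp.
        assert (A1 := E b t ltac:(lra) Ht). assert (A2 := E a t ltac:(lra) Ht). lra.
      + unfold k2.
        replace ((b, t) - (x0, y0))%C with (((a, t) - (x0, y0)) + RtoC (b - a))%C; [cring |].
        apply injective_projections; simpl; ring. }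
  rewrite CInt_minus in E1; [| exact Kx | intros t _; apply continuous_const].
  rewrite CInt_minus in E2; [| exact Ky | intros t _; apply continuous_const].
  rewrite CInt_const in E1, E2.
  replace (bdry f a b c d) with
    ((CInt (fun t => f (t, c) - f (t, d)) a b - k1 * RtoC (b - a)) +
     Ci * (CInt (fun t => f (b, t) - f (a, t)) c d - k2 * RtoC (d - c)))%C.
  - eapply Rle_trans; [apply Cmod_triangle |]. rewrite Cmod_mult, Cmod_Ci.
    replace (e * s ^ 2) with (e * s * (b - a) + 1 * (e * s * (d - c))) by (unfold s; ring).
    apply Rplus_le_compat; [exact E1 |]. lra.
  - unfold bdry, k1, k2. rewrite !RtoC_minus. ring.
Qed.

Lemma pow2_small (s delta : R) : 0 < delta -> exists n : nat, s / 2 ^ n < delta.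
Proof.
  intros Hd. destruct (Rle_dec s 0) as [H | H].
  - exists O. simpl. lra.
  - assert (P : forall n, INR n < 2 ^ n).
    { induction n as [|n IH]; [simpl; lra |]. rewrite S_INR. simpl.
      assert (1 <= 2 ^ n) by (apply pow_R1_Rle; lra). lra. }
    destruct (INR_archimed delta s Hd) as [n Hn]. exists n.
    assert (P2 : 0 < 2 ^ n) by (apply pow_lt; lra).
    apply Rmult_lt_reg_r with (2 ^ n); [exact P2 |].
    unfold Rdiv. rewrite Rmult_assoc, Rinv_l by lra. specialize (P n). nra.
Qed.

(** Bisection. The bound [e * (w + h) ^ 2] is the sum of the same bounds for the four quarters, so a
    failure is inherited by some quarter. The nested quarters shrink to a point, where [bdry_small]
    contradicts the failure. *)
Lemma goursat (f : C -> C) (a b c d : R) : a <= b -> c <= d ->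
  (forall z, box a b c d z -> exists l, cder f z l) -> bdry f a b c d = 0.
Proof.
  intros Hab Hcd Hf.
  assert (Hc : cts_on (box a b c d) f).
  { intros z Hz. destruct (Hf z Hz) as [l Hl]. exact (cder_cont _ _ _ Hl). }
  set (w := b - a). set (h := d - c).
  enough (Main : forall e, 0 < e -> Cmod (bdry f a b c d) <= e * (w + h) ^ 2).
  { apply Cmod_eq_0. apply Rle_antisym; [| apply Cmod_ge_0].
    apply Rnot_lt_le. intros Hp.
    assert (Hq : 0 <= (w + h) ^ 2) by apply pow2_ge_0.
    (* For this [e] the bound is at most half of the modulus that it dominates; the [+ 1] covers a
       rectangle reduced to a point. *)
    specialize (Main (Cmod (bdry f a b c d) / (2 * ((w + h) ^ 2 + 1)))).
    assert (He : 0 < Cmod (bdry f a b c d) / (2 * ((w + h) ^ 2 + 1)))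
      by (apply Rdiv_lt_0_compat; lra).
    specialize (Main He).
    set (B := Cmod (bdry f a b c d)) in *.
    assert (E : B / (2 * ((w + h) ^ 2 + 1)) * (2 * ((w + h) ^ 2 + 1)) = B) by (field; lra).
    nra. }
  intros e He. apply Rnot_lt_le. intros Hbad.
  (* The invariant at depth [n]: [p] is the lower left corner of a rectangle with sides [w / 2 ^ n]
     and [h / 2 ^ n] on which the scaled bound fails. *)
  set (R0 := fun (n : nat) (p : R * R) =>
    a <= fst p /\ fst p + w / 2 ^ n <= b /\ c <= snd p /\ snd p + h / 2 ^ n <= d /\
    e * ((w + h) / 2 ^ n) ^ 2 <
      Cmod (bdry f (fst p) (fst p + w / 2 ^ n) (snd p) (snd p + h / 2 ^ n))).
  set (Q := fun (n : nat) (p q : R * R) =>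
    fst p <= fst q /\ fst q + w / 2 ^ (S n) <= fst p + w / 2 ^ n /\
    snd p <= snd q /\ snd q + h / 2 ^ (S n) <= snd p + h / 2 ^ n).
  assert (Hw : 0 <= w) by (unfold w; lra). assert (Hh : 0 <= h) by (unfold h; lra).
  destruct (dependent_choice R0 Q (a, c)) as (s & Hs0 & Hs).
  - unfold R0; simpl. replace (a + w / 1) with b by (unfold w; field).
    replace (c + h / 1) with d by (unfold h; field).
    replace ((w + h) / 1) with (w + h) by field. simpl in Hbad.
    repeat split; try lra.
  - intros n [p q] (H1 & H2 & H3 & H4 & H5). simpl in H1, H2, H3, H4, H5.
    assert (P2 : 0 < 2 ^ n) by (apply pow_lt; lra).
    set (w' := w / 2 ^ n) in *. set (h' := h / 2 ^ n) in *.
    assert (Ew : w / 2 ^ S n = w' / 2) by (unfold w'; simpl; field; lra).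
    assert (Eh : h / 2 ^ S n = h' / 2) by (unfold h'; simpl; field; lra).
    assert (Es : (w + h) / 2 ^ S n = (w' + h') / 2) by (unfold w', h'; simpl; field; lra).
    assert (Es' : (w + h) / 2 ^ n = w' + h') by (unfold w', h'; field; lra).
    assert (Hw' : 0 <= w') by (unfold w'; apply Rdiv_le_0_compat; lra).
    assert (Hh' : 0 <= h') by (unfold h'; apply Rdiv_le_0_compat; lra).
    assert (Sub : cts_on (box p (p + w') q (q + h')) f).
    { intros z [B1 B2]. apply Hc. split; minmax. }
    assert (Split : bdry f p (p + w') q (q + h') =
      (bdry f p (p + w' / 2) q (q + h' / 2) + bdry f p (p + w' / 2) (q + h' / 2) (q + h' / 2 + h' / 2) +
      (bdry f (p + w' / 2) (p + w' / 2 + w' / 2) q (q + h' / 2) +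
       bdry f (p + w' / 2) (p + w' / 2 + w' / 2) (q + h' / 2) (q + h' / 2 + h' / 2)))%C).
    { replace (p + w') with (p + w' / 2 + w' / 2) in Sub |- * by field.
      replace (q + h') with (q + h' / 2 + h' / 2) in Sub |- * by field.
      rewrite (bdry_splitx f p (p + w' / 2)); [| minmax | exact Sub].
      rewrite (bdry_splity f p (p + w' / 2) q (q + h' / 2)); [| minmax |].
      - rewrite (bdry_splity f (p + w' / 2) (p + w' / 2 + w' / 2) q (q + h' / 2));
          [reflexivity | minmax |].
        intros z [B1 B2]. apply Sub. split; minmax.
      - intros z [B1 B2]. apply Sub. split; minmax. }
    rewrite Es' in H5.
    change (e * (w' + h') ^ 2 < Cmod (bdry f p (p + w') q (q + h'))) in H5.
    assert (Some : forall p' q', (p' = p \/ p' = p + w' / 2) -> (q' = q \/ q' = q + h' / 2) ->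
      e * ((w' + h') / 2) ^ 2 < Cmod (bdry f p' (p' + w' / 2) q' (q' + h' / 2)) ->
      exists y, R0 (S n) y /\ Q n (p, q) y).
    { intros p' q' Hp' Hq' HB. exists (p', q'). unfold R0, Q; simpl fst; simpl snd.
      rewrite Ew, Eh, Es. fold w' h'. repeat split; destruct Hp', Hq'; subst; try lra; exact HB. }
    destruct (Rlt_dec (e * ((w' + h') / 2) ^ 2) (Cmod (bdry f p (p + w' / 2) q (q + h' / 2))))
      as [T1 | N1]; [now apply (Some p q); auto |].
    destruct (Rlt_dec (e * ((w' + h') / 2) ^ 2)
      (Cmod (bdry f p (p + w' / 2) (q + h' / 2) (q + h' / 2 + h' / 2))))
      as [T2 | N2]; [now apply (Some p (q + h' / 2)); auto |].
    destruct (Rlt_dec (e * ((w' + h') / 2) ^ 2)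
      (Cmod (bdry f (p + w' / 2) (p + w' / 2 + w' / 2) q (q + h' / 2))))
      as [T3 | N3]; [now apply (Some (p + w' / 2) q); auto |].
    destruct (Rlt_dec (e * ((w' + h') / 2) ^ 2)
      (Cmod (bdry f (p + w' / 2) (p + w' / 2 + w' / 2) (q + h' / 2) (q + h' / 2 + h' / 2))))
      as [T4 | N4]; [now apply (Some (p + w' / 2) (q + h' / 2)); auto |].
    exfalso. apply Rnot_lt_le in N1, N2, N3, N4.
    apply (Rlt_not_le _ _ H5). rewrite Split.
    eapply Rle_trans; [apply Cmod_triangle |].
    replace (e * (w' + h') ^ 2) with ((e * ((w' + h') / 2) ^ 2 + e * ((w' + h') / 2) ^ 2) +
      (e * ((w' + h') / 2) ^ 2 + e * ((w' + h') / 2) ^ 2)) by field.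
    apply Rplus_le_compat; (eapply Rle_trans; [apply Cmod_triangle |]); lra.
  - destruct (nested_intervals (fun n => fst (s n)) (fun n => fst (s n) + w / 2 ^ n)) as [x0 Hx0].
    + intros n. apply (proj2 (Hs n)).
    + intros n. apply (proj2 (Hs n)).
    + intros n. assert (0 <= w / 2 ^ n) by (apply Rdiv_le_0_compat; [lra | apply pow_lt; lra]). lra.
    + destruct (nested_intervals (fun n => snd (s n)) (fun n => snd (s n) + h / 2 ^ n)) as [y0 Hy0].
      * intros n. apply (proj2 (Hs n)).
      * intros n. apply (proj2 (Hs n)).
      * intros n. assert (0 <= h / 2 ^ n) by (apply Rdiv_le_0_compat; [lra | apply pow_lt; lra]). lra.
      * destruct (Hf (x0, y0)) as [l Hl].
        { assert (A1 := Hx0 O). assert (A2 := Hy0 O). rewrite Hs0 in A1, A2. simpl in A1, A2.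
          unfold w in A1. unfold h in A2. split; simpl; minmax. }
        destruct (bdry_small f x0 y0 l e He Hl) as (delta & Hd & HB).
        destruct (pow2_small (w + h) delta Hd) as [n Hn].
        destruct (proj1 (Hs n)) as (H1 & H2 & H3 & H4 & H5).
        assert (P2 : 0 < 2 ^ n) by (apply pow_lt; lra).
        apply (Rlt_not_le _ _ H5).
        replace ((w + h) / 2 ^ n) with ((fst (s n) + w / 2 ^ n - fst (s n)) +
          (snd (s n) + h / 2 ^ n - snd (s n))) by (field; lra).
        apply HB; [apply Hx0 | apply Hy0 | |].
        -- lra.
        -- assert (0 <= w / 2 ^ n) by (apply Rdiv_le_0_compat; lra).
           assert (0 <= h / 2 ^ n) by (apply Rdiv_le_0_compat; lra).
           intros z [B1 B2]. apply Hc. split; minmax.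
Qed.

(** * Primitives on a disk *)

Definition disk (rad : R) (z : C) : Prop := Cmod z < rad.

Lemma bdry_swapx (f : C -> C) (a b c d : R) : cts_on (box a b c d) f ->
  bdry f b a c d = (- bdry f a b c d)%C.
Proof.
  intros H. unfold bdry.
  assert (Hhc := cts_h f a b c d c H ltac:(minmax)).
  assert (Hhd := cts_h f a b c d d H ltac:(minmax)).
  assert (Hva := cts_v f a b c d a H ltac:(minmax)).
  assert (Hvb := cts_v f a b c d b H ltac:(minmax)).
  rewrite (CInt_swap _ a b) by now apply cts_between_minus.
  rewrite !CInt_minus by assumption. ring.
Qed.
Lemma bdry_swapy (f : C -> C) (a b c d : R) : cts_on (box a b c d) f ->
  bdry f a b d c = (- bdry f a b c d)%C.
Proof.
  intros H. unfold bdry.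
  assert (Hhc := cts_h f a b c d c H ltac:(minmax)).
  assert (Hhd := cts_h f a b c d d H ltac:(minmax)).
  assert (Hva := cts_v f a b c d a H ltac:(minmax)).
  assert (Hvb := cts_v f a b c d b H ltac:(minmax)).
  rewrite (CInt_swap _ c d) by now apply cts_between_minus.
  rewrite !CInt_minus by assumption. ring.
Qed.

Lemma box_swapx (a b c d : R) (z : C) : box b a c d z <-> box a b c d z.
Proof. unfold box. now rewrite Rmin_comm, Rmax_comm. Qed.
Lemma box_swapy (a b c d : R) (z : C) : box a b d c z <-> box a b c d z.
Proof. unfold box. now rewrite (Rmin_comm d), (Rmax_comm d). Qed.

(** A rectangle with opposite corners 0 and [z] may lie in any quadrant, so both sides may run
    backwards. *)
Lemma goursat_oriented (f : C -> C) (a b c d : R) :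
  (forall z, box a b c d z -> exists l, cder f z l) -> bdry f a b c d = 0.
Proof.
  intros Hf.
  assert (Hc : cts_on (box a b c d) f).
  { intros z Hz. destruct (Hf z Hz) as [l Hl]. exact (cder_cont _ _ _ Hl). }
  assert (Half : forall a b, (forall z, box a b c d z -> exists l, cder f z l) ->
    cts_on (box a b c d) f -> a <= b -> bdry f a b c d = 0).
  { clear a b Hf Hc. intros a b Hf Hc Hab. destruct (Rle_dec c d) as [Hcd | Hcd].
    - now apply goursat.
    - rewrite (bdry_swapy f a b d c).
      + rewrite goursat; [apply Copp_0 | exact Hab | lra |].
        intros z Hz. apply Hf. now apply box_swapy.
      + intros z Hz. apply Hc. now apply box_swapy. }
  destruct (Rle_dec a b) as [Hab | Hab].
  - now apply Half.
  - rewrite (bdry_swapx f b a c d).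
    + rewrite Half; [apply Copp_0 | | | lra].
      * intros z Hz. apply Hf. now apply box_swapx.
      * intros z Hz. apply Hc. now apply box_swapx.
    + intros z Hz. apply Hc. now apply box_swapx.
Qed.

Lemma Rabs_between0 (a x t : R) : 0 <= a <= 1 -> Rmin (a * x) x <= t <= Rmax (a * x) x ->
  Rabs t <= Rabs x.
Proof. intros Ha Ht. unfold Rmin, Rmax in Ht. unfold Rabs. repeat destruct Rcase_abs; repeat destruct Rle_dec; nra. Qed.

Lemma Cmod_le_coord (x y x' y' : R) : Rabs x' <= Rabs x -> Rabs y' <= Rabs y ->
  Cmod (x', y') <= Cmod (x, y).
Proof.
  intros H1 H2. unfold Cmod; cbn [fst snd]. apply sqrt_le_1_alt.
  rewrite <- (pow2_abs x), <- (pow2_abs x'), <- (pow2_abs y), <- (pow2_abs y').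
  assert (A1 := Rabs_pos x'). assert (A2 := Rabs_pos y').
  apply Rplus_le_compat; apply pow_incr; lra.
Qed.

(** The factor 2 comes from applying the real mean value theorem to each coordinate separately; no
    sharp constant is needed. *)
Lemma mean_value_ineq (g d : R -> C) (a b e : R) :
  (forall t, Rmin a b <= t <= Rmax a b -> pder g t (d t) /\ Cmod (d t) <= e) ->
  Cmod (g b - g a) <= 2 * e * Rabs (b - a).
Proof.
  intros H.
  assert (Part : forall (p : R -> R) (dp : R -> R),
    (forall t, Rmin a b <= t <= Rmax a b -> is_derive p t (dp t) /\ Rabs (dp t) <= e) ->
    Rabs (p b - p a) <= e * Rabs (b - a)).
  { intros p dp Hp. destruct (MVT_gen p a b dp) as (c & Hc & E).
    - intros t Ht. apply Hp. lra.
    - intros t Ht. apply continuity_pt_filterlim.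
      eapply is_derive_continuous. now apply Hp.
    - rewrite E, Rabs_mult. apply Rmult_le_compat_r; [apply Rabs_pos |]. now apply Hp. }
  assert (H1 := Part (fun t => Re (g t)) (fun t => Re (d t))).
  assert (H2 := Part (fun t => Im (g t)) (fun t => Im (d t))).
  eapply Rle_trans; [apply Cmod_le_ReIm |].
  replace (2 * e * Rabs (b - a)) with (e * Rabs (b - a) + e * Rabs (b - a)) by ring.
  apply Rplus_le_compat.
  - apply H1. intros t Ht. destruct (H t Ht) as [A1 A2]. split; [now apply pder_Re |].
    eapply Rle_trans; [apply Re_le_Cmod | exact A2].
  - apply H2. intros t Ht. destruct (H t Ht) as [A1 A2]. split; [now apply pder_Im |].
    eapply Rle_trans; [apply Im_le_Cmod | exact A2].
Qed.

(** Continuous partial derivatives that satisfy the Cauchy-Riemann equations. The increment is split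
    into a vertical and a horizontal leg, each costing [2 * (e / 4)] times its length, and each
    length is at most [Cmod D]. *)
Lemma cder_of_partials (F f : C -> C) (z : C) : continuous f z ->
  locally z (fun w => pder (fun s => F (s, Im w)) (Re w) (f w) /\
                      pder (fun t => F (Re w, t)) (Im w) (Ci * f w)%C) ->
  cder F z (f z).
Proof.
  intros Hc Hl. apply cder_eps. intros e He. assert (He4 : 0 < e / 4) by lra.
  generalize (filter_and _ _ (proj1 (continuous_C_eps f z) Hc _ He4) Hl). intros H.
  apply locally_Cmod in H. destruct H as (d & Hd & H).
  exists d. split; [exact Hd |]. intros w Hw.
  destruct z as [x y]. destruct w as [x' y'].
  set (D := ((x', y') - (x, y))%C) in *.
  assert (HDx : Rabs (x' - x) <= Cmod D) by apply (Re_le_Cmod D).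
  assert (HDy : Rabs (y' - y) <= Cmod D) by apply (Im_le_Cmod D).
  assert (Near : forall p q, Rabs (p - x) <= Rabs (x' - x) -> Rabs (q - y) <= Rabs (y' - y) ->
    Cmod ((p, q) - (x, y))%C < d).
  { intros p q Hp Hq. eapply Rle_lt_trans; [| exact Hw].
    now apply (Cmod_le_coord (x' - x) (y' - y) (p - x) (q - y)). }
  assert (E1 : Cmod ((F (x', y') - RtoC x' * f (x, y)) - (F (x, y') - RtoC x * f (x, y)))%C
     <= 2 * (e / 4) * Rabs (x' - x)).
  { apply (mean_value_ineq (fun s => F (s, y') - RtoC s * f (x, y))%C
      (fun s => f (s, y') - 1 * f (x, y))%C x x').
    intros s Hs. destruct (H (s, y')) as [A1 [A2 _]].
    - apply Near; [| lra]. unfold Rmin, Rmax in Hs. unfold Rabs.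
      repeat destruct Rcase_abs; repeat destruct Rle_dec; lra.
    - split.
      + apply cd_minus; [exact A2 |].
        eapply cd_eq; [apply pder_mult; [apply cd_id | apply cd_const] | cring].
      + left. replace (1 * f (x, y))%C with (f (x, y)) by ring. exact A1. }
  assert (E2 : Cmod ((F (x, y') - RtoC y' * (Ci * f (x, y))) - (F (x, y) - RtoC y * (Ci * f (x, y))))%C
     <= 2 * (e / 4) * Rabs (y' - y)).
  { apply (mean_value_ineq (fun s => F (x, s) - RtoC s * (Ci * f (x, y)))%C
      (fun s => Ci * f (x, s) - 1 * (Ci * f (x, y)))%C y y').
    intros s Hs. destruct (H (x, s)) as [A1 [_ A2]].
    - apply Near; [rewrite Rminus_diag, Rabs_R0; apply Rabs_pos |].
      unfold Rmin, Rmax in Hs. unfold Rabs.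
      repeat destruct Rcase_abs; repeat destruct Rle_dec; lra.
    - split.
      + apply cd_minus; [exact A2 |].
        eapply cd_eq; [apply pder_mult; [apply cd_id | apply cd_const] | cring].
      + left. replace (Ci * f (x, s) - 1 * (Ci * f (x, y)))%C
          with (Ci * (f (x, s) - f (x, y)))%C by ring.
        rewrite Cmod_mult, Cmod_Ci, Rmult_1_l. exact A1. }
  replace (F (x', y') - F (x, y) - D * f (x, y))%C with
    (((F (x', y') - RtoC x' * f (x, y)) - (F (x, y') - RtoC x * f (x, y))) +
     ((F (x, y') - RtoC y' * (Ci * f (x, y))) - (F (x, y) - RtoC y * (Ci * f (x, y)))))%C.
  - eapply Rle_trans; [apply Cmod_triangle |]. nra.
  - replace D with ((RtoC x' - RtoC x) + Ci * (RtoC y' - RtoC y))%C; [cring |].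
    unfold D. apply injective_projections; simpl; ring.
Qed.

Lemma pder_CInt_upper (g : R -> C) (a x : R) :
  locally x (fun u => cts_between g a u) -> pder (fun u => CInt g a u) x (g x).
Proof.
  intros H. assert (Hx := locally_singleton _ _ H).
  apply pder_parts. unfold CInt; simpl. split.
  - apply (is_derive_RInt (fun t => Re (g t)) _ a x).
    + revert H. apply filter_imp. intros u Hu. apply (RInt_correct (V := R_CompleteNormedModule)).
      now apply cts_between_Re.
    + apply cts_Re. apply Hx. minmax.
  - apply (is_derive_RInt (fun t => Im (g t)) _ a x).
    + revert H. apply filter_imp. intros u Hu. apply (RInt_correct (V := R_CompleteNormedModule)).
      now apply cts_between_Im.
    + apply cts_Im. apply Hx. minmax.
Qed.

Lemma disk_open (rad : R) (z : C) : disk rad z -> locally z (disk rad).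
Proof.
  intros Hz. apply locally_Cmod. exists (rad - Cmod z). unfold disk in *. split; [lra |].
  intros w Hw. replace w with (z + (w - z))%C by ring.
  eapply Rle_lt_trans; [apply Cmod_triangle |]. lra.
Qed.

(** When the last leg of the path from 0 is vertical, the vertical derivative is immediate. By
    Goursat's theorem the path may be exchanged for one with a horizontal last leg, which yields the
    other partial derivative. The rectangle stays in the disk, as its points have coordinates no
    larger than those of the corner. *)
Lemma primitive_disk (f : C -> C) (rad : R) :
  (forall z, disk rad z -> exists l, cder f z l) ->
  exists F, forall z, disk rad z -> cder F z (f z).
Proof.
  intros Hf.
  assert (Hc : cts_on (disk rad) f) by (intros z Hz; destruct (Hf z Hz); eapply cder_cont; eassumption).
  assert (Sub : forall x y z, disk rad (x, y) -> box 0 x 0 y z -> disk rad z).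
  { intros x y [p q] Hxy [H1 H2]. cbn in H1, H2. unfold disk in *.
    eapply Rle_lt_trans; [| exact Hxy]. apply Cmod_le_coord.
    - replace 0 with (0 * x) in H1 by ring. apply (Rabs_between0 0 x p) in H1; lra.
    - replace 0 with (0 * y) in H2 by ring. apply (Rabs_between0 0 y q) in H2; lra. }
  set (F := fun z : C => (CInt (fun s => f (s, 0%R)) 0 (Re z) +
    Ci * CInt (fun t => f (Re z, t)) 0 (Im z))%C).
  assert (E : forall z, disk rad z -> F z = (CInt (fun s => f (s, Im z)) 0 (Re z) +
    Ci * CInt (fun t => f (0%R, t)) 0 (Im z))%C).
  { intros [x y] Hz. unfold F; cbn [Re Im fst snd].
    assert (Hcb : cts_on (box 0 x 0 y) f) by (intros w Hw; apply Hc, (Sub x y); trivial).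
    assert (G : bdry f 0 x 0 y = 0).
    { apply goursat_oriented. intros w Hw. apply Hf. now apply (Sub x y). }
    unfold bdry in G. rewrite !CInt_minus in G;
      [| apply (cts_v f 0 x 0 y); trivial; minmax | apply (cts_v f 0 x 0 y); trivial; minmax
       | apply (cts_h f 0 x 0 y); trivial; minmax | apply (cts_h f 0 x 0 y); trivial; minmax].
    replace (CInt (fun s => f (s, 0%R)) 0 x) with (CInt (fun s => f (s, y)) 0 x -
      Ci * (CInt (fun t => f (x, t)) 0 y - CInt (fun t => f (0%R, t)) 0 y) +
      (CInt (fun s => f (s, 0%R)) 0 x - CInt (fun s => f (s, y)) 0 x +
       Ci * (CInt (fun t => f (x, t)) 0 y - CInt (fun t => f (0%R, t)) 0 y)))%C by ring.
    rewrite G. ring. }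
  assert (BR : forall a b t, Rmin 0 b <= t <= Rmax 0 b -> disk rad (a, b) -> disk rad (a, t)).
  { intros a b t Ht H. apply (Sub a b); trivial. split; cbn; [minmax | exact Ht]. }
  assert (BL : forall a b t, Rmin 0 a <= t <= Rmax 0 a -> disk rad (a, b) -> disk rad (t, b)).
  { intros a b t Ht H. apply (Sub a b); trivial. split; cbn; [exact Ht | minmax]. }
  exists F. intros z Hz. apply cder_of_partials; [now apply Hc |].
  generalize (disk_open rad z Hz). apply filter_imp. intros [x y] Hw. cbn [Re Im fst snd].
  assert (Lx : locally x (fun s => disk rad (s, y))).
  { assert (K : continuous (fun s : R => (s, y) : C) x)
      by ct.
    exact (K _ (disk_open rad (x, y) Hw)). }
  assert (Ly : locally y (fun t => disk rad (x, t))).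
  { assert (K : continuous (fun t : R => (x, t) : C) y)
      by ct.
    exact (K _ (disk_open rad (x, y) Hw)). }
  split.
  - apply (cd_ext_loc _ (fun s => (CInt (fun u => f (u, y)) 0 s +
      Ci * CInt (fun t => f (0%R, t)) 0 y)%C)).
    { revert Lx. apply filter_imp. intros s Hs. now rewrite E. }
    eapply cd_eq; [apply cd_plus; [| apply cd_const] |].
    + apply (pder_CInt_upper (fun u => f (u, y)) 0 x).
      revert Lx. apply filter_imp. intros s Hs t Ht.
      apply continuous_hline, Hc. now apply (BL s y t).
    + cring.
  - unfold F; cbn [Re Im fst snd].
    eapply cd_eq; [apply cd_plus; [apply cd_const | apply pder_mult; [apply cd_const |]] |].
    + apply (pder_CInt_upper (fun u => f (x, u)) 0 y).
      revert Ly. apply filter_imp. intros s Hs t Ht.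
      apply continuous_vline, Hc. now apply (BR x s t).
    + cring.
Qed.

(** * Cauchy's formula *)

Lemma Cmod_sub_pos (z w : C) : Cmod z < Cmod w -> (w - z <> 0)%C.
Proof.
  intros H E. replace w with z in H; [lra |].
  replace w with ((w - z) + z)%C by ring. rewrite E. ring.
Qed.

Lemma Cmod_RtoC_mult (s : R) (z : C) : Cmod (RtoC s * z)%C = Rabs s * Cmod z.
Proof. now rewrite Cmod_mult, Cmod_R. Qed.

Lemma cts_bounded (g : R -> C) (a b : R) : a <= b -> (forall t, a <= t <= b -> continuous g t) ->
  exists M, 0 <= M /\ forall t, a <= t <= b -> Cmod (g t) <= M.
Proof.
  intros Hab H. destruct (continuity_ab_maj (fun t => Cmod (g t)) a b Hab) as (m & Hm & Hm').
  - intros c Hc. apply continuity_pt_filterlim. now apply (cts_Cmod g), H.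
  - exists (Cmod (g m)). split; [apply Cmod_ge_0 | exact Hm].
Qed.

Lemma cder_of_quadratic (F : C -> C) (z l : C) (K d : R) : 0 < d ->
  (forall w, Cmod (w - z) < d -> Cmod (F w - F z - (w - z) * l) <= K * Cmod (w - z) ^ 2) ->
  cder F z l.
Proof.
  intros Hd H. apply cder_eps. intros e He.
  (* [K] may be zero or negative, whereas the radius below divides by the constant. *)
  set (K1 := Rmax K 1). assert (HK : K <= K1) by apply Rmax_l.
  assert (HK1 : 1 <= K1) by apply Rmax_r.
  exists (Rmin d (e / K1)). split.
  - apply Rmin_glb_lt; [exact Hd |]. apply Rdiv_lt_0_compat; lra.
  - intros w Hw. assert (H1 := Rmin_l d (e / K1)). assert (H2 := Rmin_r d (e / K1)).
    eapply Rle_trans; [apply H; lra |].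
    assert (H0 := Cmod_ge_0 (w - z)). set (h := Cmod (w - z)) in *.
    assert (H3 : h * K1 <= e / K1 * K1) by (apply Rmult_le_compat_r; lra).
    replace (e / K1 * K1) with e in H3 by (field; lra). nra.
Qed.

(** A Cauchy-type integral against [dt] with arbitrary density; the factor [zeta / (2 PI)] of
    Cauchy's formula is absorbed in [phi]. General exponents make the family closed under
    differentiation. *)
Definition ckernel (rho : R) (phi : R -> C) (k : nat) (z : C) : C :=
  CInt (fun t => phi t * (/ (circle rho t - z)) ^ k)%C 0 (2 * PI).

Lemma kernel_bounds (rho : R) (z w : C) (t : R) : Cmod z < rho ->
  Cmod (w - z) < (rho - Cmod z) / 2 ->
  (circle rho t - w <> 0)%C /\ Cmod (/ (circle rho t - w)) <= 2 / (rho - Cmod z).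
Proof.
  intros Hz Hw. assert (Hr : 0 <= rho) by (assert (H := Cmod_ge_0 z); lra).
  assert (B : (rho - Cmod z) / 2 <= Cmod (circle rho t - w)%C).
  { assert (T := Cmod_triangle (circle rho t - w) ((w - z) + z)).
    replace (circle rho t - w + (w - z + z))%C with (circle rho t) in T by ring.
    assert (T2 := Cmod_triangle (w - z) z). rewrite Cmod_circle in T by exact Hr. lra. }
  assert (NZ : (circle rho t - w <> 0)%C).
  { intros E. rewrite E, Cmod_0 in B. lra. }
  split; [exact NZ |]. rewrite Cmod_inv by exact NZ.
  replace (2 / (rho - Cmod z)) with (/ ((rho - Cmod z) / 2)) by (field; lra).
  apply Rinv_le_contravar; lra.
Qed.

Lemma ckernel_cont (rho : R) (phi : R -> C) (k : nat) (z : C) (t : R) : Cmod z < rho ->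
  continuous phi t -> continuous (fun t => phi t * (/ (circle rho t - z)) ^ k)%C t.
Proof.
  intros Hz Hphi. apply cts_Cmult; [exact Hphi |]. apply cts_Cpow, cts_Cinv.
  - apply Cmod_sub_pos. rewrite Cmod_circle; [exact Hz |]. assert (H := Cmod_ge_0 z); lra.
  - ct.
Qed.

Lemma Cmod_le_mult (x y : C) (a b : R) : Cmod x <= a -> Cmod y <= b -> Cmod (x * y)%C <= a * b.
Proof.
  intros H1 H2. rewrite Cmod_mult. assert (A := Cmod_ge_0 x). assert (B := Cmod_ge_0 y). nra.
Qed.
Lemma Cmod_le_plus (x y : C) (a b : R) : Cmod x <= a -> Cmod y <= b -> Cmod (x + y)%C <= a + b.
Proof. intros H1 H2. eapply Rle_trans; [apply Cmod_triangle | lra]. Qed.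

(** With [a = 1 / (zeta - z)], [b = 1 / (zeta - w)] and [h = w - z] the hypothesis is the resolvent
    identity, and the conclusion bounds the second-order remainder of [(zeta - z)^(-k)]. The
    constant depends on [K] and [k] only, so the estimate survives integration over the circle. *)
Lemma ckernel_pow_estimate (K : R) (k : nat) : 0 <= K -> exists B, forall a b h : C,
  Cmod a <= K -> Cmod b <= K -> (b - a = h * (a * b))%C ->
  Cmod (b ^ k - a ^ k - h * (RtoC (INR k) * a ^ S k))%C <= B * Cmod h ^ 2.
Proof.
  intros HK. induction k as [|k [B IH]].
  - exists 0. intros a b h _ _ _. simpl.
    replace (1 - 1 - h * (0 * (a * 1)))%C with (RtoC 0) by ring. rewrite Cmod_0. lra.
  - exists (K * B + INR (S k) * (K ^ S (S k) * K)). intros a b h Ha Hb E.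
    specialize (IH a b h Ha Hb E).
    replace (b ^ S k - a ^ S k - h * (RtoC (INR (S k)) * a ^ S (S k)))%C with
      (b * (b ^ k - a ^ k - h * (RtoC (INR k) * a ^ S k)) +
       RtoC (INR (S k)) * (a ^ S (S k) * b) * (h * h))%C.
    + rewrite Rmult_plus_distr_r, (Rmult_assoc K).
      replace (Cmod h ^ 2) with (Cmod h * Cmod h) in IH |- * by ring.
      apply Cmod_le_plus; [now apply Cmod_le_mult |].
      apply Cmod_le_mult; [| rewrite Cmod_mult; lra].
      apply Cmod_le_mult; [rewrite Cmod_R, Rabs_pos_eq; [lra | apply pos_INR] |].
      apply Cmod_le_mult; [| exact Hb]. rewrite Cmod_pow. apply pow_incr.
      split; [apply Cmod_ge_0 | exact Ha].
    + rewrite S_INR, RtoC_plus. simpl Cpow. set (c := RtoC (INR k)). set (p := (a ^ k)%C).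
      transitivity (b * (b ^ k - p - h * (c * (a * p))) + (c + 1) * (a * p * h * (h * (a * b))))%C;
        [ring |].
      rewrite <- E.
      transitivity (b * b ^ k - b * p - h * ((c + 1) * (a * (a * p))) + p * (h * (a * b)))%C; [ring |].
      rewrite <- E. ring.
Qed.

(** The quadratic remainder of the integrand is uniform in the angle, hence integrates to a
    quadratic remainder. Cauchy-type integrals are thus differentiable any number of times. *)
Lemma ckernel_der (rho : R) (phi : R -> C) (k : nat) (z : C) : Cmod z < rho ->
  (forall t, continuous phi t) ->
  cder (ckernel rho phi k) z (RtoC (INR k) * ckernel rho phi (S k) z)%C.
Proof.
  intros Hz Hphi.
  destruct (cts_bounded phi 0 (2 * PI) PI2_nonneg) as (M & HM & HMt); [trivial |].
  assert (HK : 0 <= 2 / (rho - Cmod z)) by (apply Rdiv_le_0_compat; lra).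
  destruct (ckernel_pow_estimate _ k HK) as [B HB].
  apply (cder_of_quadratic _ _ _ (M * B * (2 * PI)) ((rho - Cmod z) / 2)); [lra |].
  intros w Hw. unfold ckernel.
  assert (Hw' : Cmod w < rho).
  { replace w with ((w - z) + z)%C by ring. eapply Rle_lt_trans; [apply Cmod_triangle |]. lra. }
  assert (Hzz : Cmod (z - z)%C < (rho - Cmod z) / 2).
  { replace (z - z)%C with (RtoC 0) by ring. rewrite Cmod_0. lra. }
  assert (Cw := fun t => ckernel_cont rho phi k w t Hw' (Hphi t)).
  assert (Cz := fun t => ckernel_cont rho phi k z t Hz (Hphi t)).
  assert (Cz' := fun t => ckernel_cont rho phi (S k) z t Hz (Hphi t)).
  set (g := fun t => (phi t * (/ (circle rho t - z)) ^ S k)%C) in *.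
  rewrite <- (CInt_scal 0 (2 * PI) PI2_nonneg (RtoC (INR k)) g) by auto.
  rewrite <- (CInt_scal 0 (2 * PI) PI2_nonneg (w - z)) by ct.
  rewrite <- (CInt_minus _ (fun t => phi t * (/ (circle rho t - z)) ^ k)%C)
    by (intros t _; auto).
  rewrite <- CInt_minus by (intros t _; ct).
  unfold g in *. clear g.
  replace (M * B * (2 * PI) * Cmod (w - z) ^ 2) with (M * (B * Cmod (w - z) ^ 2) * (2 * PI - 0)) by ring.
  apply CInt_bound; [apply PI2_nonneg | ct |].
  intros t Ht. destruct (kernel_bounds rho z w t Hz Hw) as [N1 B1].
  destruct (kernel_bounds rho z z t Hz Hzz) as [N2 B2].
  set (a := (/ (circle rho t - z))%C) in *. set (b := (/ (circle rho t - w))%C) in *.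
  replace (phi t * b ^ k - phi t * a ^ k - (w - z) * (RtoC (INR k) * (phi t * a ^ S k)))%C with
    (phi t * (b ^ k - a ^ k - (w - z) * (RtoC (INR k) * a ^ S k)))%C by ring.
  apply Cmod_le_mult; [now apply HMt |]. apply HB; trivial.
  unfold a, b. field. now split.
Qed.

Lemma derive_zero_const (rad : R) (f : C -> C) (a : C) :
  (forall z, Cmod (z - a) < rad -> cder f z 0) -> forall z, Cmod (z - a) < rad -> f z = f a.
Proof.
  intros H z Hz.
  assert (E := const_of_pder0 (fun s => f (a + RtoC s * (z - a))%C) 0 1 Rle_0_1).
  assert (D : forall s, 0 <= s <= 1 -> pder (fun s => f (a + RtoC s * (z - a))%C) s 0).
  { intros s Hs. eapply cd_eq.
    - apply (pder_comp f (fun s => a + RtoC s * (z - a))%C).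
      + apply H. replace (a + RtoC s * (z - a) - a)%C with (RtoC s * (z - a))%C by ring.
        rewrite Cmod_RtoC_mult, Rabs_pos_eq by lra. assert (P := Cmod_ge_0 (z - a)). nra.
      + apply cd_plus; [apply cd_const | apply pder_mult; [apply cd_id | apply cd_const]].
    - cring. }
  specialize (E (fun s Hs => D s ltac:(lra)) (fun s Hs => pder_cont _ _ _ (D s Hs))).
  cbv beta in E. replace (a + RtoC 1 * (z - a))%C with z in E by ring.
  replace (a + RtoC 0 * (z - a))%C with a in E by ring. exact E.
Qed.

(** As a function of [z] the integral has derivative zero: up to the factor [Ci], the differentiated
    integrand is the angular derivative of [1 / (zeta - z)] along a closed curve. At [z = 0] the
    integrand is 1. *)
Lemma cauchy_index (rho : R) (z : C) : Cmod z < rho ->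
  CInt (fun t => circle rho t / (circle rho t - z))%C 0 (2 * PI) = RtoC (2 * PI).
Proof.
  intros Hz. assert (Hr : 0 < rho) by (assert (H := Cmod_ge_0 z); lra).
  assert (NZ : forall w t, Cmod w < rho -> (circle rho t - w <> 0)%C).
  { intros w t Hw. apply Cmod_sub_pos. rewrite Cmod_circle; lra. }
  assert (Cc : forall t, continuous (circle rho) t) by ct.
  assert (D : forall w, Cmod w < rho -> cder (ckernel rho (circle rho) 1) w 0).
  { intros w Hw. eapply cd_eq; [now apply ckernel_der |].
    assert (Cd : forall t, continuous (fun t => - (Ci * circle rho t) /
      ((circle rho t - w) * (circle rho t - w)))%C t).
    { intros t. apply cts_Cdiv; [apply Cmult_neq_0; now apply NZ | ct | ct]. }
    unfold ckernel.
    rewrite (CInt_ext _ (fun t => Ci * (- (Ci * circle rho t) /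
      ((circle rho t - w) * (circle rho t - w))))%C).
    - rewrite CInt_scal by auto using PI2_nonneg.
      rewrite (CInt_FTC (fun t => / (circle rho t - w))%C); auto using PI2_nonneg.
      + rewrite circle_2PI. ring.
      + intros t _. apply (cd_inv RtoC (fun t => circle rho t - w)%C);
          [apply continuous_RtoC | now apply NZ |].
        eapply cd_eq; [apply cd_minus; [apply pder_circle | apply cd_const] | cring].
    - intros t. assert (HI : (Ci * Ci = - (1))%C) by (apply injective_projections; simpl; ring).
      transitivity (- (Ci * Ci) * circle rho t / ((circle rho t - w) * (circle rho t - w)))%C;
        [rewrite HI; simpl |]; field; now apply NZ. }
  assert (Z : Cmod (z - 0)%C < rho) by (replace (z - 0)%C with z by ring; exact Hz).
  assert (E := derive_zero_const rho _ 0 (fun w Hw => D w ltac:(now replace (w - 0)%C with w in Hw by ring))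
    z Z).
  unfold ckernel in E.
  rewrite (CInt_ext _ (fun t => circle rho t * (/ (circle rho t - z)) ^ 1)%C)
    by (intros t; unfold Cdiv; simpl; ring).
  rewrite E, (CInt_ext _ (fun _ => RtoC 1)).
  - rewrite CInt_const, Rminus_0_r. ring.
  - intros t. simpl. assert (N := NZ 0 t ltac:(rewrite Cmod_0; exact Hr)).
    replace (circle rho t - 0)%C with (circle rho t) in N |- * by ring. field. exact N.
Qed.

(** Contract the circle to [z] along [w s t = z + s (zeta - z)]. The integral [Phi s] does not
    depend on [s]; [Phi 1] is the left-hand side and [Phi 0] is [F z] times the index. *)
Lemma cauchy_formula (F f : C -> C) (rad rho : R) (z : C) :
  (forall w, disk rad w -> cder F w (f w)) -> cts_on (disk rad) f ->
  rho < rad -> Cmod z < rho ->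
  CInt (fun t => F (circle rho t) * (circle rho t / (circle rho t - z)))%C 0 (2 * PI)
    = (RtoC (2 * PI) * F z)%C.
Proof.
  intros HF Hf HR Hz. assert (Hz0 := Cmod_ge_0 z).
  (* The margin lets [s] range over an open interval around [[0, 1]]: as [|zeta - z| <= 2 rho],
     overshooting by less than [delta] moves a point by less than [rad - rho]. *)
  set (delta := (rad - rho) / (2 * rho)).
  assert (Hd : 0 < delta) by (apply Rdiv_lt_0_compat; lra).
  assert (Hdr : delta * (2 * rho) = rad - rho) by (unfold delta; field; lra).
  set (w := fun (s t : R) => (z + RtoC s * (circle rho t - z))%C).
  assert (NZ : forall t, (circle rho t - z <> 0)%C).
  { intros t. apply Cmod_sub_pos. now rewrite Cmod_circle by lra. }
  assert (Hw : forall s t, - delta < s < 1 + delta -> disk rad (w s t)).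
  { intros s t Hs. unfold disk.
    assert (B : Cmod (circle rho t - z)%C <= 2 * rho).
    { eapply Rle_trans; [apply Cmod_triangle |]. rewrite Cmod_opp, Cmod_circle; lra. }
    destruct (Rle_dec s 0) as [H0 | H0]; [| destruct (Rle_dec s 1) as [H1 | H1]].
    - unfold w. eapply Rle_lt_trans; [apply Cmod_triangle |].
      rewrite Cmod_RtoC_mult, Rabs_left1 by lra. nra.
    - replace (w s t) with (RtoC (1 - s) * z + RtoC s * circle rho t)%C
        by (unfold w; rewrite RtoC_minus; ring).
      eapply Rle_lt_trans; [apply Cmod_triangle |].
      rewrite !Cmod_RtoC_mult, Cmod_circle, !Rabs_pos_eq by lra. nra.
    - replace (w s t) with (circle rho t + RtoC (s - 1) * (circle rho t - z))%C
        by (unfold w; rewrite RtoC_minus; ring).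
      eapply Rle_lt_trans; [apply Cmod_triangle |].
      rewrite Cmod_RtoC_mult, Cmod_circle, Rabs_pos_eq by lra. nra. }
  assert (Cw : forall s t, continuous (fun p : R * R => w (fst p) (snd p)) (s, t)).
  { intros s t. apply cts_Cplus; [apply continuous_const |]. apply cts_Cmult.
    - apply cts_RtoC, continuous_fst.
    - apply cts_Cminus; [apply cts_circle, continuous_snd | apply continuous_const]. }
  assert (Cwt : forall s t, continuous (w s) t).
  { intros s t. apply cts_Cplus; [apply continuous_const |]. apply cts_Cmult; [apply continuous_const |].
    apply cts_Cminus; [apply cts_circle, continuous_id | apply continuous_const]. }
  set (Phi := fun s => CInt (fun t => F (w s t) * (circle rho t / (circle rho t - z)))%C 0 (2 * PI)).
  set (Phi' := fun s t => (f (w s t) * circle rho t)%C).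
  assert (DP : forall s, - delta < s < 1 + delta -> pder Phi s (CInt (Phi' s) 0 (2 * PI))).
  { intros s Hs.
    apply (CInt_param_derive (fun s t => F (w s t) * (circle rho t / (circle rho t - z)))%C Phi'
      (- delta) (1 + delta)); trivial using PI2_nonneg.
    - intros u t Hu. eapply cd_eq; [apply pder_mult; [| apply cd_const] |].
      + apply (pder_comp F (fun v => w v t)); [apply HF; now apply Hw |].
        apply cd_plus; [apply cd_const | apply pder_mult; [apply cd_id | apply cd_const]].
      + unfold Phi'. cfield. apply NZ.
    - intros u t Hu. apply cts_Cmult.
      + apply (cts_comp (fun p : R * R => w (fst p) (snd p)) f); [| apply Cw].
        apply Hf. now apply Hw.
      + apply cts_circle, continuous_snd.
    - intros u t Hu. apply cts_Cmult.
      + apply (cts_comp (w u) F); [| apply Cwt]. apply (cder_cont _ _ _ (HF _ (Hw u t Hu))).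
      + apply cts_Cdiv; [apply NZ | apply cts_circle, continuous_id |].
        apply cts_Cminus; [apply cts_circle, continuous_id | apply continuous_const]. }
  assert (D0 : forall s, 0 < s < 1 -> pder Phi s 0).
  { intros s Hs. assert (Hs' : - delta < s < 1 + delta) by lra.
    eapply cd_eq; [now apply DP |].
    assert (CP : forall t, continuous (Phi' s) t).
    { intros t. apply cts_Cmult; [| apply cts_circle, continuous_id].
      apply (cts_comp (w s) f); [| apply Cwt]. apply Hf. now apply Hw. }
    (* [s * i * Phi' s t] is the derivative in [t] of [F (w s t)] along a closed curve. Cancelling
       the factor requires [s <> 0]. *)
    assert (E : ((RtoC s * Ci) * CInt (Phi' s) 0 (2 * PI) = 0)%C).
    { rewrite <- CInt_scal by trivial using PI2_nonneg.
      rewrite (CInt_FTC (fun t => F (w s t))); trivial using PI2_nonneg.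
      - unfold w. rewrite circle_2PI. ring.
      - intros t _. eapply cd_eq.
        + apply (pder_comp F (w s)); [apply HF; now apply Hw |].
          apply cd_plus; [apply cd_const | apply pder_mult; [apply cd_const |]].
          apply cd_minus; [apply pder_circle | apply cd_const].
        + unfold Phi'. cring.
      - ct. }
    destruct (Ceq_dec (CInt (Phi' s) 0 (2 * PI)) 0) as [E0 | N0]; [exact E0 |].
    exfalso. revert E. apply Cmult_neq_0; [| exact N0]. apply Cmult_neq_0.
    - intros E. apply RtoC_inj in E. lra.
    - intros E. apply (f_equal Im) in E. simpl in E. lra. }
  assert (E' : Phi 1 = Phi 0).
  { apply (const_of_pder0 Phi 0 1 Rle_0_1 D0).
    intros s Hs. eapply pder_cont. apply DP. lra. }
  unfold Phi in E'.
  rewrite (CInt_ext _ (fun t => F (w 1 t) * (circle rho t / (circle rho t - z)))%C)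
    by (intros t; replace (w 1 t) with (circle rho t) by (unfold w; ring); reflexivity).
  rewrite E', (CInt_ext _ (fun t => F z * (circle rho t / (circle rho t - z)))%C)
    by (intros t; replace (w 0 t) with z by (unfold w; ring); reflexivity).
  rewrite CInt_scal, cauchy_index; trivial using PI2_nonneg; [ring |].
  intros t _. apply cts_Cdiv; [apply NZ | ct | ct].
Qed.

Lemma cauchy_kernel (F f : C -> C) (rad rho : R) :
  (forall w, disk rad w -> cder F w (f w)) -> cts_on (disk rad) f -> 0 < rho < rad ->
  exists phi, (forall t, continuous phi t) /\
    forall z, disk rho z -> F z = ckernel rho phi 1 z.
Proof.
  intros HF Hf [Hr Hrho].
  exists (fun t => / RtoC (2 * PI) * (F (circle rho t) * circle rho t))%C.
  assert (NP : RtoC (2 * PI) <> 0).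
  { intros E. apply RtoC_inj in E. assert (H := PI_pos). lra. }
  assert (Cc : forall t, continuous (fun t => (F (circle rho t) * circle rho t)%C) t).
  { intros t. assert (C1 : continuous (circle rho) t) by apply cts_circle, continuous_id.
    apply cts_Cmult; [| exact C1]. apply (cts_comp (circle rho) F); [| exact C1].
    apply (cder_cont _ _ _ (HF (circle rho t) ltac:(unfold disk; rewrite Cmod_circle; lra))). }
  split.
  - ct.
  - intros z Hz. assert (G := cauchy_formula F f rad rho z HF Hf Hrho Hz).
    unfold ckernel.
    rewrite (CInt_ext _ (fun t => / RtoC (2 * PI) * (F (circle rho t) * (circle rho t / (circle rho t - z))))%C)
      by (intros t; unfold Cdiv; ring).
    rewrite CInt_scal; [| apply PI2_nonneg |].
    + rewrite G. field. exact NP.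
    + intros t _. apply (continuous_ext (fun t => (F (circle rho t) * circle rho t) * (/ (circle rho t - z)) ^ 1)%C).
      * intros u. unfold Cdiv. cring.
      * now apply ckernel_cont.
Qed.

(** [F] is a Cauchy-type integral of exponent 1, so [f] is one of exponent 2 and its derivative
    twice one of exponent 3, which is continuous. *)
Lemma derivative_regular (F f : C -> C) (rad : R) :
  (forall w, disk rad w -> cder F w (f w)) -> cts_on (disk rad) f ->
  forall z, disk rad z -> cder f z (C_derive f z) /\ continuous (C_derive f) z.
Proof.
  intros HF Hf.
  intros z Hz. unfold disk in Hz. assert (Hz0 := Cmod_ge_0 z).
  destruct (cauchy_kernel F f rad ((Cmod z + rad) / 2) HF Hf ltac:(lra)) as (phi & Hphi & E). set (rho := (Cmod z + rad) / 2) in *.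
  assert (Hzr : disk rho z) by (unfold disk, rho; lra).
  assert (E2 : forall w, disk rho w -> f w = ckernel rho phi 2 w).
  { intros w Hw. apply (cder_unique F w).
    - apply HF. unfold disk, rho in *. lra.
    - apply (cd_ext_loc _ (ckernel rho phi 1)); [| eapply cd_eq; [now apply ckernel_der | simpl; ring]].
      generalize (disk_open rho w Hw). apply filter_imp. intros u Hu. now rewrite E. }
  assert (E3 : forall w, disk rho w -> cder f w (INR 2 * ckernel rho phi 3 w)%C).
  { intros w Hw. apply (cd_ext_loc _ (ckernel rho phi 2)); [| now apply ckernel_der].
    generalize (disk_open rho w Hw). apply filter_imp. intros u Hu. now rewrite E2. }
  split.
  - rewrite (cder_C_derive _ _ _ (E3 z Hzr)). now apply E3.
  - apply (continuous_ext_loc _ (fun w => INR 2 * ckernel rho phi 3 w)%C).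
    + generalize (disk_open rho z Hzr). apply filter_imp. intros u Hu.
      symmetry. now apply cder_C_derive, E3.
    + apply cts_Cmult; [apply continuous_const |].
      eapply cder_cont. now apply ckernel_der.
Qed.

(** * Holomorphic functions on a disk: regularity, mean values, maximum principle *)

Definition hol (rad : R) (f : C -> C) : Prop := forall z, disk rad z -> cder f z (C_derive f z).

Lemma hol_intro (rad : R) (f : C -> C) : (forall z, disk rad z -> exists l, cder f z l) -> hol rad f.
Proof. intros H z Hz. destruct (H z Hz) as [l Hl]. now rewrite (cder_C_derive _ _ _ Hl). Qed.

Lemma hol_cts (rad : R) (f : C -> C) (z : C) : hol rad f -> disk rad z -> continuous f z.
Proof. intros H Hz. exact (cder_cont _ _ _ (H z Hz)). Qed.

(** [derivative_regular] is applied twice: to a primitive of [f], which shows that [C_derive f] is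
    continuous, and then to [f] itself, for which this continuity is the missing hypothesis. *)
Lemma hol_derive (rad : R) (f : C -> C) : hol rad f -> hol rad (C_derive f).
Proof.
  intros Hf. destruct (primitive_disk f rad) as [F HF]; [intros z Hz; eexists; now apply Hf |].
  assert (H := derivative_regular F f rad HF (fun z Hz => hol_cts rad f z Hf Hz)).
  intros z Hz. apply (derivative_regular f (C_derive f) rad); trivial.
  intros w Hw. now apply H.
Qed.

Lemma hol_pow (rad : R) (f : C -> C) (n : nat) : hol rad f -> hol rad (fun z => f z ^ n)%C.
Proof.
  intros Hf. apply hol_intro. intros z Hz. induction n as [|n [l IH]]; simpl.
  - eexists. apply cd_const.
  - eexists. apply cder_mult; [now apply Hf | exact IH].
Qed.

Lemma hol_shift (rad : R) (f : C -> C) (a : C) :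
  (forall z, Cmod (z - a) < rad -> exists l, cder f z l) -> hol rad (fun w => f (a + w)%C).
Proof.
  intros H. apply hol_intro. intros w Hw. destruct (H (a + w)%C) as [l Hl].
  - now replace (a + w - a)%C with w by ring.
  - exists (l * (0 + 1))%C. apply (cder_comp f (fun w => a + w)%C); [exact Hl |].
    apply cd_plus; [apply cd_const | apply cd_id].
Qed.

Lemma cder_unshift (f : C -> C) (a w l : C) :
  cder (fun w => f (a + w)%C) w l -> cder f (a + w)%C l.
Proof.
  intros H. apply (cd_ext_loc _ (fun z => f (a + (z - a))%C)).
  - apply filter_forall. intros z. f_equal. ring.
  - eapply cd_eq; [apply (cder_comp (fun w => f (a + w)%C) (fun z => z - a)%C) |].
    + replace (a + w - a)%C with w by ring. exact H.
    + apply cd_minus; [apply cd_id | apply cd_const].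
    + cring.
Qed.

Lemma hol_cauchy (rad rho : R) (f : C -> C) (z : C) : hol rad f -> rho < rad -> Cmod z < rho ->
  CInt (fun t => f (circle rho t) * (circle rho t / (circle rho t - z)))%C 0 (2 * PI)
    = (RtoC (2 * PI) * f z)%C.
Proof.
  intros Hf HR Hz. apply (cauchy_formula f (C_derive f) rad); trivial.
  intros w Hw. apply (hol_cts rad); trivial. now apply hol_derive.
Qed.

Lemma hol_circle_cts (rad r : R) (f : C -> C) (t : R) : hol rad f -> 0 <= r < rad ->
  continuous (fun t => f (circle r t)) t.
Proof.
  intros Hf Hr. apply (cts_comp (circle r) f); [| apply cts_circle, continuous_id].
  apply (hol_cts rad); trivial. unfold disk. rewrite Cmod_circle; lra.
Qed.

Lemma mean_value_property (rad r : R) (f : C -> C) : hol rad f -> 0 < r < rad ->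
  CInt (fun t => f (circle r t)) 0 (2 * PI) = (RtoC (2 * PI) * f 0)%C.
Proof.
  intros Hf Hr. rewrite <- (hol_cauchy rad r f 0 Hf); [| lra | rewrite Cmod_0; lra].
  apply CInt_ext. intros t. field.
  assert (H : Cmod (circle r t) = r) by (apply Cmod_circle; lra).
  intros E. rewrite E, Cmod_0 in H. lra.
Qed.

Lemma mean_value_bound (rad r M : R) (f : C -> C) : hol rad f -> 0 < r < rad ->
  (forall t, Cmod (f (circle r t)) <= M) -> Cmod (f 0) <= M.
Proof.
  intros Hf Hr HM.
  assert (B : Cmod (CInt (fun t => f (circle r t)) 0 (2 * PI)) <= M * (2 * PI - 0)).
  { apply CInt_bound; trivial using PI2_nonneg.
    intros t _. apply (hol_circle_cts rad); trivial. lra. }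
  rewrite (mean_value_property rad), Cmod_RtoC_mult, Rabs_pos_eq in B;
    trivial using PI2_nonneg. assert (H := PI_pos). nra.
Qed.

(** If [q > M > 0], Bernoulli's inequality makes [(q / M) ^ n] grow at least linearly, beyond any
    [K]. This stands in for [n]-th roots and limits. *)
Lemma pow_ratio_bound (q M K : R) : 0 <= M -> (forall n, q ^ n <= K * M ^ n) -> q <= M.
Proof.
  intros HM H. apply Rnot_lt_le. intros Hq.
  destruct (Req_dec M 0) as [-> | N].
  - specialize (H 1%nat). simpl in H. lra.
  - assert (Hx : 0 < q / M - 1).
    { apply Rmult_lt_reg_r with M; [lra |].
      replace ((q / M - 1) * M) with (q - M) by (field; lra). lra. }
    destruct (INR_archimed (q / M - 1) K Hx) as [n Hn].
    specialize (H n).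
    assert (P : 0 < M ^ n) by (apply pow_lt; lra).
    assert (Br := poly n (q / M - 1) Hx).
    replace (1 + (q / M - 1)) with (q / M) in Br by ring.
    assert (E : q ^ n = (q / M) ^ n * M ^ n) by (rewrite <- Rpow_mult_distr; f_equal; field; lra).
    rewrite E in H. apply Rmult_le_reg_r in H; [| exact P]. lra.
Qed.

(* Landau's trick: Cauchy's formula for [f ^ n], whose constant disappears as n grows. *)
Lemma max_principle (rad r M : R) (f : C -> C) (z : C) : hol rad f -> r < rad -> Cmod z < r ->
  (forall t, Cmod (f (circle r t)) <= M) -> Cmod (f z) <= M.
Proof.
  intros Hf HR Hz HM. assert (Hz0 := Cmod_ge_0 z).
  assert (HM0 : 0 <= M) by (eapply Rle_trans; [apply Cmod_ge_0 | apply (HM 0)]).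
  apply (pow_ratio_bound _ _ (r / (r - Cmod z)) HM0). intros n.
  assert (G := hol_cauchy rad r (fun w => f w ^ n)%C z (hol_pow rad f n Hf) HR Hz).
  assert (B : Cmod (CInt (fun t => f (circle r t) ^ n *
    (circle r t / (circle r t - z)))%C 0 (2 * PI)) <= M ^ n * (r / (r - Cmod z)) * (2 * PI - 0)).
  { apply CInt_bound; trivial using PI2_nonneg.
    - intros t _. apply cts_Cmult; [apply cts_Cpow, (hol_circle_cts rad); trivial; lra |].
      apply cts_Cdiv; [| apply cts_circle, continuous_id |].
      + apply Cmod_sub_pos. rewrite Cmod_circle; lra.
      + ct.
    - intros t _. apply Cmod_le_mult.
      + rewrite Cmod_pow. apply pow_incr. split; [apply Cmod_ge_0 | apply HM].
      + assert (NZ : (circle r t - z <> 0)%C) by (apply Cmod_sub_pos; rewrite Cmod_circle; lra).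
        unfold Cdiv, Rdiv. apply Cmod_le_mult; [rewrite Cmod_circle; lra |].
        rewrite Cmod_inv by exact NZ. apply Rinv_le_contravar; [lra |].
        assert (T := Cmod_triangle (circle r t - z) z).
        replace (circle r t - z + z)%C with (circle r t) in T by ring.
        rewrite Cmod_circle in T; lra. }
  rewrite G, Cmod_RtoC_mult, Rabs_pos_eq, Cmod_pow in B by apply PI2_nonneg.
  assert (H := PI_pos). nra.
Qed.

(** * Division by z, Schwarz's lemma and isolated zeros *)

Definition dslope (f : C -> C) (z : C) : C :=
  if Ceq_dec z 0 then C_derive f 0 else ((f z - f 0) / z)%C.

Lemma dslope_eq (f : C -> C) (z : C) : f z = (f 0 + z * dslope f z)%C.
Proof. unfold dslope. destruct (Ceq_dec z 0) as [-> | N]; [ring | field; exact N]. Qed.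

Lemma dslope_0 (f : C -> C) : dslope f 0 = C_derive f 0.
Proof. unfold dslope. destruct (Ceq_dec 0 0) as [E | N]; [reflexivity | now destruct N]. Qed.

(* [1 / (zeta - z) - 1 / zeta = z / (zeta * (zeta - z))]: the slope of a Cauchy integral with
   density [phi] is the Cauchy integral with density [phi / zeta]. *)
Lemma dslope_hol (rad : R) (f : C -> C) : hol rad f -> hol rad (dslope f).
Proof.
  intros Hf. apply hol_intro. intros z Hz. unfold disk in Hz. assert (Hz0 := Cmod_ge_0 z).
  assert (Hf1 := hol_derive rad f Hf).
  destruct (cauchy_kernel f (C_derive f) rad ((Cmod z + rad) / 2) Hf
    (fun w Hw => hol_cts rad _ w Hf1 Hw) ltac:(lra)) as (phi & Hphi & E).
  set (rho := (Cmod z + rad) / 2) in *. assert (Hr : 0 < rho) by (unfold rho; lra).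
  assert (D0 : disk rho 0) by (unfold disk; now rewrite Cmod_0).
  assert (NZ : forall w t, disk rho w -> (circle rho t - w <> 0)%C).
  { intros w t Hw. apply Cmod_sub_pos. rewrite Cmod_circle; [exact Hw | lra]. }
  assert (NZ0 : forall t, circle rho t <> 0).
  { intros t K. apply (NZ 0 t D0). rewrite K. ring. }
  set (psi := fun t => (phi t / circle rho t)%C).
  assert (Hpsi : forall t, continuous psi t) by (intros t; apply cts_Cdiv; [apply NZ0 | ct | ct]).
  assert (Ed : forall w, disk rho w -> dslope f w = ckernel rho psi 1 w).
  { intros w Hw. unfold dslope. destruct (Ceq_dec w 0) as [-> | N].
    - apply cder_C_derive. apply (cd_ext_loc _ (ckernel rho phi 1)).
      + generalize (disk_open rho 0 D0). apply filter_imp. intros u Hu. now rewrite E.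
      + eapply cd_eq; [now apply ckernel_der |]. simpl INR. unfold ckernel, psi. rewrite Cmult_1_l.
        apply CInt_ext. intros t. simpl. replace (circle rho t - 0)%C with (circle rho t) by ring.
        field. apply NZ0.
    - rewrite !E by trivial. unfold ckernel. rewrite <- CInt_minus.
      + rewrite (CInt_ext _ (fun t => w * (psi t * (/ (circle rho t - w)) ^ 1))%C).
        * rewrite CInt_scal; [field; exact N | apply PI2_nonneg |].
          intros t _. now apply ckernel_cont.
        * intros t. unfold psi. simpl. replace (circle rho t - 0)%C with (circle rho t) by ring.
          field. split; [now apply NZ | apply NZ0].
      + intros t _. now apply ckernel_cont.
      + intros t _. apply ckernel_cont; [exact D0 | apply Hphi]. }
  assert (Hzr : disk rho z) by (unfold disk, rho; lra).
  eexists. apply (cd_ext_loc _ (ckernel rho psi 1)); [| now apply ckernel_der].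
  generalize (disk_open rho z Hzr). apply filter_imp. intros u Hu. now rewrite Ed.
Qed.

(* [z * f z] is differentiable at 0 as well, and [f] is its slope. *)
Lemma removable_singularity (rad : R) (f : C -> C) : cts_on (disk rad) f ->
  (forall z, disk rad z -> z <> 0 -> exists l, cder f z l) -> hol rad f.
Proof.
  intros Hc Hf. set (g := fun z => (z * f z)%C).
  assert (D0 : disk rad 0 -> cder g (RtoC 0) (f 0)).
  { intros H0. exists f. split; [now apply Hc | split; [reflexivity |]].
    apply filter_forall. intros u. unfold g. ring. }
  assert (Hg : hol rad g).
  { apply hol_intro. intros z Hz. destruct (Ceq_dec z 0) as [-> | N]; [eexists; now apply D0 |].
    destruct (Hf z Hz N) as [l Hl]. eexists. apply cder_mult; [apply cd_id | exact Hl]. }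
  intros z Hz.
  assert (Eg : forall w, disk rad w -> dslope g w = f w).
  { intros w Hw. unfold dslope. destruct (Ceq_dec w 0) as [-> | N].
    - now apply cder_C_derive, D0.
    - unfold g. field. exact N. }
  revert z Hz. apply hol_intro. intros z Hz. eexists.
  apply (cd_ext_loc _ (dslope g)); [| now apply (dslope_hol rad)].
  generalize (disk_open rad z Hz). apply filter_imp. exact Eg.
Qed.

(** On the circle of radius [r] the slope is at most [1 / r] in modulus; the maximum principle
    carries this inside, and [r] tends to 1. *)
Lemma schwarz_dslope (w : C -> C) (z : C) : hol 1 w -> w 0 = 0 ->
  (forall u, disk 1 u -> Cmod (w u) <= 1) -> disk 1 z -> Cmod (dslope w z) <= 1.
Proof.
  intros Hw H0 H1 Hz. unfold disk in Hz. assert (Hz0 := Cmod_ge_0 z).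
  assert (B : forall r, Cmod z < r < 1 -> r * Cmod (dslope w z) <= 1).
  { intros r Hr. assert (G : Cmod (dslope w z) <= / r).
    { apply (max_principle 1 r); [now apply dslope_hol | lra | lra |].
      intros t. assert (Hc : Cmod (circle r t) = r) by (apply Cmod_circle; lra).
      apply Rmult_le_reg_l with r; [lra |]. rewrite Rinv_r by lra.
      rewrite <- Hc at 1. rewrite <- Cmod_mult.
      replace (circle r t * dslope w (circle r t))%C with (w (circle r t)).
      - apply H1. unfold disk. lra.
      - rewrite (dslope_eq w (circle r t)) at 1. rewrite H0. ring. }
    apply Rmult_le_compat_l with (r := r) in G; [| lra]. rewrite Rinv_r in G; lra. }
  assert (Hp := Cmod_ge_0 (dslope w z)). apply Rnot_lt_le. intros Hbad.
  set (k := Cmod (dslope w z)) in *.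
  (* If the modulus [k] exceeded 1, this radius would lie in the disk, beyond both [|z|] and
     [1 / k], which contradicts [r * k <= 1]. *)
  set (r := (1 + Rmax (Cmod z) (/ k)) / 2).
  assert (Hik : / k < 1) by (rewrite <- Rinv_1; apply Rinv_lt_contravar; lra).
  assert (M1 := Rmax_l (Cmod z) (/ k)). assert (M2 := Rmax_r (Cmod z) (/ k)).
  assert (M3 : Rmax (Cmod z) (/ k) < 1) by (apply Rmax_lub_lt; lra).
  specialize (B r ltac:(unfold r; lra)).
  assert (E : / k * k = 1) by (apply Rinv_l; lra).
  assert (/ k < r) by (unfold r; lra). nra.
Qed.

Lemma schwarz_lemma (w : C -> C) (z : C) : hol 1 w -> w 0 = 0 ->
  (forall u, disk 1 u -> Cmod (w u) <= 1) -> disk 1 z -> Cmod (w z) <= Cmod z.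
Proof.
  intros Hw H0 H1 Hz. rewrite (dslope_eq w z), H0.
  replace (0 + z * dslope w z)%C with (z * dslope w z)%C by ring.
  rewrite Cmod_mult. assert (B := schwarz_dslope w z Hw H0 H1 Hz).
  assert (A := Cmod_ge_0 z). nra.
Qed.

(** Extrema on a circle come from compactness of [[0, 2 PI]], while bounds on a circle are stated
    for all real angles. *)
Lemma eit_period (t : R) : exists s, 0 <= s <= 2 * PI /\ eit s = eit t.
Proof.
destruct (Rle_dec 0 (sin t)) as [H | H].
  - exists (acos (cos t)). assert (B := acos_bound (cos t)). assert (CB := COS_bound t).
    split; [lra |]. unfold eit. rewrite cos_acos, sin_acos by lra. f_equal.
    rewrite <- (Rabs_pos_eq (sin t) H), <- sqrt_Rsqr_abs. f_equal.
    assert (S := sin2_cos2 t). unfold Rsqr in *. lra.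
  - exists (2 * PI - acos (cos t)). assert (B := acos_bound (cos t)). assert (CB := COS_bound t).
    split; [lra |]. unfold eit. apply Rnot_le_lt in H.
    rewrite cos_minus, sin_minus, cos_2PI, sin_2PI, cos_acos, sin_acos by lra.
    assert (S := sin2_cos2 t). unfold Rsqr in *.
    replace (1 - cos t * cos t) with ((- sin t) * (- sin t)) by lra.
    rewrite sqrt_square by lra. f_equal; ring.
Qed.

(** If zeros accumulate at 0, every quotient of [h] by a power of [z] vanishes at 0 by continuity
    and can be divided once more, so [h = z^n g] for all [n]. The maximum principle for [g] gives
    [|h z| <= M (|z| / r)^n] with [|z| < r], which forces [h z = 0]. *)
Lemma isolated_zeros (rad : R) (h : C -> C) : 0 < rad -> hol rad h ->
  (forall z, disk rad z -> h z = 0) \/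
  exists d, 0 < d /\ forall z : C, z <> 0 -> Cmod z < d -> h z <> 0.
Proof.
  intros HR Hh.
  destruct (classic (exists d, 0 < d /\ forall z : C, z <> 0 -> Cmod z < d -> h z <> 0)) as [Y | N];
    [now right | left].
  assert (Acc : forall d, 0 < d -> exists z : C, z <> 0 /\ Cmod z < d /\ h z = 0).
  { intros d Hd. apply NNPP. intros K. apply N. exists d. split; [exact Hd |].
    intros z Hz Hzd E. apply K. now exists z. }
  assert (Fact : forall n, exists g, hol rad g /\ forall z, h z = (z ^ n * g z)%C).
  { induction n as [|n (g & Hg & E)].
    - exists h. split; [exact Hh |]. intros z. simpl. ring.
    - assert (g0 : g 0 = 0).
      { apply NNPP. intros K.
        assert (D0 : disk rad 0) by (unfold disk; rewrite Cmod_0; exact HR).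
        assert (L := continuous_neq0 g (RtoC 0) (hol_cts rad g 0 Hg D0) K).
        destruct (proj1 (locally_Cmod (RtoC 0) (fun u => g u <> 0)) L) as (d & Hd & HH).
        destruct (Acc d Hd) as (z & Hz & Hzd & Ez). rewrite E in Ez.
        revert Ez. apply Cmult_neq_0.
        - now apply Cpow_nz.
        - apply HH. now replace (z - 0)%C with z by ring. }
      exists (dslope g). split; [now apply dslope_hol |].
      intros z. rewrite E, (dslope_eq g z), g0. simpl. ring. }
  intros z Hz. unfold disk in Hz. assert (Hz0 := Cmod_ge_0 z).
  set (r := (Cmod z + rad) / 2).
  destruct (cts_bounded (fun t => h (circle r t)) 0 (2 * PI) PI2_nonneg) as (M & HM & HMt).
  { intros t _. apply (hol_circle_cts rad); trivial. unfold r; lra. }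
  assert (HMt' : forall t, 0 <= t <= 2 * PI -> Cmod (h (circle r t)) <= M) by exact HMt.
  assert (Hr : 0 < r) by (unfold r; lra).
  apply Cmod_eq_0. apply Rle_antisym; [| apply Cmod_ge_0]. apply Rnot_lt_le. intros Hp.
  assert (B : r <= Cmod z).
  { apply (pow_ratio_bound _ _ (M / Cmod (h z)) Hz0). intros n.
    destruct (Fact n) as (g & Hg & E).
    assert (P : 0 < r ^ n) by now apply pow_lt.
    assert (G : Cmod (g z) <= M / r ^ n).
    { apply (max_principle rad r); [exact Hg | unfold r; lra | unfold r; lra |].
      intros t. destruct (eit_period t) as (s & Hs & Es).
      replace (circle r t) with (circle r s) by (unfold circle; now rewrite Es).
      specialize (HMt' s Hs). rewrite E, Cmod_mult, Cmod_pow, Cmod_circle in HMt' by lra.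
      apply Rmult_le_reg_l with (r ^ n); [exact P |].
      replace (r ^ n * (M / r ^ n)) with M by (field; lra). exact HMt'. }
    apply Rmult_le_compat_l with (r := r ^ n) in G; [| lra].
    replace (r ^ n * (M / r ^ n)) with M in G by (field; lra).
    assert (Ez : Cmod (h z) = Cmod z ^ n * Cmod (g z)) by now rewrite E, Cmod_mult, Cmod_pow.
    apply Rmult_le_reg_r with (Cmod (h z)); [exact Hp |].
    replace (M / Cmod (h z) * Cmod z ^ n * Cmod (h z)) with (M * Cmod z ^ n) by (field; lra).
    rewrite Ez. assert (Hzn : 0 <= Cmod z ^ n) by now apply pow_le.
    replace (r ^ n * (Cmod z ^ n * Cmod (g z))) with (r ^ n * Cmod (g z) * Cmod z ^ n) by ring.
    now apply Rmult_le_compat_r. }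
  unfold r in B. lra.
Qed.

(** * Injective holomorphic maps *)

(** By injectivity [|f - f z0|] has a positive minimum [m] on a small circle around [z0]. If a value
    [w] with [|w - f z0| < m / 2] were omitted inside, [1 / (f - w)] would be holomorphic there and
    at most [2 / m] on the circle, but larger at the centre, against the mean value property. *)
Lemma univalent_open (f : C -> C) (z0 : C) (e : R) : hol 1 f -> injective_on (disk 1) f ->
  disk 1 z0 -> 0 < e ->
  exists d, 0 < d /\ forall w, Cmod (w - f z0) < d ->
    exists z, disk 1 z /\ Cmod (z - z0) < e /\ f z = w.
Proof.
  intros Hf Hi Hz0 He. unfold disk in Hz0.
  set (e' := Rmin e (1 - Cmod z0)).
  assert (He' : 0 < e') by (apply Rmin_glb_lt; lra).
  assert (He1 : e' <= e) by apply Rmin_l. assert (He2 : e' <= 1 - Cmod z0) by apply Rmin_r.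
  assert (InD : forall z, Cmod (z - z0) < e' -> disk 1 z).
  { intros z Hz. unfold disk. replace z with ((z - z0) + z0)%C by ring.
    eapply Rle_lt_trans; [apply Cmod_triangle |]. lra. }
  assert (Hsh : hol e' (fun u => f (z0 + u)%C)).
  { apply hol_shift. intros z Hz. eexists. now apply Hf, InD. }
  set (r := e' / 2). assert (Hr : 0 < r < e') by (unfold r; lra).
  destruct (continuity_ab_min (fun t => Cmod (f (z0 + circle r t)%C - f z0)) 0 (2 * PI) PI2_nonneg)
    as (t0 & Ht0 & Ht0').
  { intros t _. apply continuity_pt_filterlim.
    apply (cts_Cmod (fun t => f (z0 + circle r t)%C - f z0)%C).
    apply cts_Cminus; [| apply continuous_const].
    apply (hol_circle_cts e' r (fun u => f (z0 + u)%C)); [exact Hsh | lra]. }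
  set (m := Cmod (f (z0 + circle r t0)%C - f z0)) in *.
  assert (Hm : 0 < m).
  { apply Cmod_gt_0. intros E.
    assert (E' : (z0 + circle r t0)%C = z0).
    { apply Hi; [| exact Hz0 |].
      - apply InD. replace (z0 + circle r t0 - z0)%C with (circle r t0) by ring.
        rewrite Cmod_circle; lra.
      - replace (f (z0 + circle r t0)%C) with ((f (z0 + circle r t0)%C - f z0) + f z0)%C by ring.
        rewrite E. ring. }
    assert (H : Cmod (circle r t0) = 0).
    { replace (circle r t0) with ((z0 + circle r t0) - z0)%C by ring. rewrite E'.
      replace (z0 - z0)%C with (RtoC 0) by ring. apply Cmod_0. }
    rewrite Cmod_circle in H; lra. }
  assert (Hmall : forall t, m <= Cmod (f (z0 + circle r t)%C - f z0)).
  { intros t.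
    destruct (eit_period t) as (s & Hs & Es).
    replace (circle r t) with (circle r s) by (unfold circle; now rewrite Es). now apply Ht0. }
  exists (m / 2). split; [lra |]. intros w Hw.
  apply NNPP. intros K.
  assert (NZ : forall u, disk e' u -> (f (z0 + u) - w <> 0)%C).
  { intros u Hu E. apply K. exists (z0 + u)%C.
    assert (Ez : (z0 + u - z0)%C = u) by ring.
    repeat split.
    - apply InD. now rewrite Ez.
    - rewrite Ez. unfold disk in Hu. lra.
    - replace (f (z0 + u)%C) with ((f (z0 + u)%C - w) + w)%C by ring. rewrite E. ring. }
  assert (Hg : hol e' (fun u => / (f (z0 + u) - w))%C).
  { apply hol_intro. intros u Hu. eexists.
    apply (cd_inv _ (fun u => f (z0 + u) - w)%C); [apply continuous_id | now apply NZ |].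
    apply cd_minus; [now apply Hsh | apply cd_const]. }
  assert (B := mean_value_bound e' r (2 / m) _ Hg Hr).
  assert (B' : Cmod (/ (f (z0 + 0) - w))%C <= 2 / m).
  { apply B. intros t. rewrite Cmod_inv.
    - replace (2 / m) with (/ (m / 2)) by (field; lra).
      apply Rinv_le_contravar; [lra |].
      assert (T := Cmod_triangle (f (z0 + circle r t)%C - w) (w - f z0)).
      replace (f (z0 + circle r t)%C - w + (w - f z0))%C with (f (z0 + circle r t)%C - f z0)%C in T by ring.
      specialize (Hmall t). lra.
    - apply NZ. unfold disk. rewrite Cmod_circle; lra. }
  assert (D0 : disk e' 0) by (unfold disk; rewrite Cmod_0; lra).
  rewrite Cmod_inv in B' by now apply NZ.
  assert (NZ0 := NZ 0 D0). apply Cmod_gt_0 in NZ0.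
  replace (z0 + 0)%C with z0 in B', NZ0 by ring.
  replace (f z0 - w)%C with (- (w - f z0))%C in B', NZ0 by ring.
  rewrite Cmod_opp in B', NZ0.
  assert (G : / (m / 2) < / Cmod (w - f z0)) by (apply Rinv_lt_contravar; [nra | lra]).
  replace (/ (m / 2)) with (2 / m) in G by (field; lra). lra.
Qed.

Lemma inverse_exists (f : C -> C) : injective_on (disk 1) f ->
  exists k : C -> C, forall z, disk 1 z -> k (f z) = z.
Proof.
  intros Hi.
  assert (H : forall w, exists z, (exists z', disk 1 z' /\ f z' = w) -> disk 1 z /\ f z = w).
  { intros w. destruct (classic (exists z', disk 1 z' /\ f z' = w)) as [[z Hz] | N].
    - now exists z.
    (* The inverse is a total function; off the image its value is 0 and carries no information. *)
    - exists 0. now intros. }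
  exists (fun w => proj1_sig (constructive_indefinite_description _ (H w))).
  intros z Hz. destruct constructive_indefinite_description as [z' Hz']; simpl.
  destruct Hz' as [H1 H2]; [now exists z |]. now apply Hi.
Qed.

Lemma inverse_cts (f k : C -> C) (z0 : C) : hol 1 f -> injective_on (disk 1) f ->
  (forall z, disk 1 z -> k (f z) = z) -> disk 1 z0 -> continuous k (f z0).
Proof.
  intros Hf Hi Hk Hz0. apply continuous_C_eps. intros e He.
  destruct (univalent_open f z0 e Hf Hi Hz0 He) as (d & Hd & H).
  apply locally_Cmod. exists d. split; [exact Hd |]. intros w Hw.
  destruct (H w Hw) as (z & Hz & Hze & <-). now rewrite !Hk.
Qed.

(** The slope of [k] is the reciprocal of the slope of [f] read through [k]; openness ensures that
    every point near [f z0] is a value of [f]. *)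
Lemma inverse_cder (f k : C -> C) (z0 l : C) : hol 1 f -> injective_on (disk 1) f ->
  (forall z, disk 1 z -> k (f z) = z) -> disk 1 z0 ->
  cder f z0 l -> l <> 0 -> cder k (f z0) (/ l)%C.
Proof.
  intros Hf Hi Hk Hz0 Hl N.
  assert (Ck := inverse_cts f k z0 Hf Hi Hk Hz0).
  destruct (univalent_open f z0 1 Hf Hi Hz0 Rlt_0_1) as (d & Hd & Hop).
  destruct Hl as (q & Hq & El & H).
  assert (Cqk : continuous (fun w => q (k w)) (f z0)).
  { apply (cts_comp k q); [| exact Ck]. now rewrite Hk. }
  assert (Nq : q (k (f z0)) <> 0) by (rewrite Hk, El; trivial).
  exists (fun w => / q (k w))%C. split; [now apply cts_Cinv |].
  split; [rewrite Hk, El; trivial |].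
  assert (L1 : locally (f z0) (fun w => Cmod (w - f z0)%C < d)).
  { apply locally_Cmod. now exists d. }
  assert (L2 : locally (f z0) (fun w => (f (k w) - f z0)%C = ((k w - z0) * q (k w))%C)).
  { assert (Ck' := Ck). unfold continuous in Ck'. rewrite Hk in Ck' by exact Hz0. exact (Ck' _ H). }
  generalize (filter_and _ _ L1 (filter_and _ _ L2 (continuous_neq0 _ _ Cqk Nq))).
  apply filter_imp. intros w (A1 & A2 & A3).
  destruct (Hop w A1) as (z & Hz & _ & <-). rewrite !Hk in * by assumption.
  rewrite A2. field. exact A3.
Qed.

(** Suppose [f' z0 = 0]. Zeros of [f'] cannot fill a neighbourhood of [z0], where [f] would be
    constant, so [z0] is isolated among them. Then the inverse is continuous near [f z0] and
    differentiable except at [f z0], hence there too by removability; the chain rule for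
    [f (k w) = w] reads [0 = 1]. *)
Lemma univalent_derive_neq0 (f : C -> C) (z0 : C) : hol 1 f -> injective_on (disk 1) f ->
  disk 1 z0 -> C_derive f z0 <> 0.
Proof.
  intros Hf Hi Hz0 E0. assert (Hz0' := Hz0). unfold disk in Hz0'.
  set (rad := 1 - Cmod z0). assert (HR : 0 < rad) by (unfold rad; lra).
  assert (InD : forall z, Cmod (z - z0) < rad -> disk 1 z).
  { intros z Hz. unfold disk. replace z with ((z - z0) + z0)%C by ring.
    eapply Rle_lt_trans; [apply Cmod_triangle |]. unfold rad in Hz. lra. }
  assert (Hsh : hol rad (fun u => C_derive f (z0 + u)%C)).
  { apply hol_shift. intros z Hz. eexists. apply (hol_derive 1 f Hf). now apply InD. }
  destruct (isolated_zeros rad _ HR Hsh) as [Z | (d & Hd & Iso)].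
  - assert (Cst : forall z, Cmod (z - z0) < rad -> f z = f z0).
    { apply (derive_zero_const rad). intros z Hz. eapply cd_eq; [apply Hf; now apply InD |].
      replace z with (z0 + (z - z0))%C by ring. now apply Z. }
    assert (Hr : Cmod (z0 + RtoC (rad / 2) - z0)%C < rad).
    { replace (z0 + RtoC (rad / 2) - z0)%C with (RtoC (rad / 2)) by ring.
      rewrite Cmod_R, Rabs_pos_eq; lra. }
    assert (E := Hi _ _ (InD _ Hr) Hz0 (Cst _ Hr)).
    assert (E' : RtoC (rad / 2) = 0).
    { replace (RtoC (rad / 2)) with (z0 + RtoC (rad / 2) - z0)%C by ring. rewrite E. ring. }
    apply RtoC_inj in E'. lra.
  - destruct (inverse_exists f Hi) as [k Hk].
    destruct (univalent_open f z0 d Hf Hi Hz0 Hd) as (eta & Heta & Hop).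
    assert (Hk0 : hol eta (fun u => k (f z0 + u)%C)).
    { apply removable_singularity.
      - intros u Hu. destruct (Hop (f z0 + u)%C) as (z & Hz & _ & Ez).
        { replace (f z0 + u - f z0)%C with u by ring. exact Hu. }
        apply (cts_comp (fun u => f z0 + u)%C k).
        + rewrite <- Ez. now apply inverse_cts.
        + ct.
      - intros u Hu Nu. destruct (Hop (f z0 + u)%C) as (z & Hz & Hzd & Ez).
        { replace (f z0 + u - f z0)%C with u by ring. exact Hu. }
        eexists. apply (cder_comp k (fun u => f z0 + u)%C).
        + rewrite <- Ez. apply inverse_cder; trivial; [now apply Hf |].
          replace z with (z0 + (z - z0))%C by ring. apply Iso; [| exact Hzd].
          intros E. apply Nu. replace u with ((f z0 + u) - f z0)%C by ring. rewrite <- Ez.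
          replace z with ((z - z0) + z0)%C by ring. rewrite E.
          replace (0 + z0)%C with z0 by ring. ring.
        + apply cd_plus; [apply cd_const | apply cd_id]. }
    assert (D0 : disk eta 0) by (unfold disk; rewrite Cmod_0; exact Heta).
    assert (Dk := cder_unshift k (f z0) 0 _ (Hk0 0 D0)).
    set (l := C_derive (fun u => k (f z0 + u)%C) 0) in *.
    replace (f z0 + 0)%C with (f z0) in Dk by ring.
    assert (Dfk : cder (fun w => f (k w)) (f z0) (C_derive f z0 * l)%C).
    { apply (cder_comp f k); [| exact Dk]. rewrite Hk by exact Hz0. now apply Hf. }
    assert (Did : cder (fun w => f (k w)) (f z0) 1).
    { apply (cd_ext_loc _ (fun w => w)); [| apply cd_id].
      apply locally_Cmod. exists eta. split; [exact Heta |]. intros w Hw.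
      destruct (Hop w Hw) as (z & Hz & _ & <-). now rewrite Hk. }
    assert (E := cder_unique _ _ _ _ Dfk Did). rewrite E0, Cmult_0_l in E.
    apply RtoC_inj in E. lra.
Qed.

Lemma Cmod_sqr (z : C) : Cmod z ^ 2 = Re z ^ 2 + Im z ^ 2.
Proof. unfold Cmod. apply pow2_sqrt. unfold Re, Im. nra. Qed.

Lemma Cmod_le_sqr (z w : C) : Re z ^ 2 + Im z ^ 2 <= Re w ^ 2 + Im w ^ 2 -> Cmod z <= Cmod w.
Proof. intros H. unfold Cmod. now apply sqrt_le_1_alt. Qed.

(** * Functions with nonnegative real part *)

Lemma caratheodory_neq0 (p q : C) : 0 <= Re p -> 0 < Re q -> (p + Cconj q <> 0)%C.
Proof. intros Hp Hq E. apply (f_equal Re) in E. simpl in E. unfold Re in *. lra. Qed.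

(** For [Re q > 0], the Moebius map of the right half-plane onto the unit disk that sends [q] to
    0. *)
Definition cayley (q p : C) : C := ((p - q) / (p + Cconj q))%C.

Lemma cayley_le1 (p q : C) : 0 <= Re p -> 0 < Re q -> Cmod (cayley q p) <= 1.
Proof.
  intros Hp Hq. assert (N := caratheodory_neq0 p q Hp Hq).
  unfold cayley. rewrite Cmod_div by exact N.
  assert (P := proj1 (Cmod_gt_0 _) N).
  apply Rmult_le_reg_r with (Cmod (p + Cconj q)); [exact P |].
  unfold Rdiv. rewrite Rmult_assoc, Rinv_l, Rmult_1_l, Rmult_1_r by lra.
  apply Cmod_le_sqr. destruct p as [a b], q as [c d]; simpl in *. nra.
Qed.

Lemma cayley_inv (p q : C) : 0 <= Re p -> 0 < Re q -> (1 - cayley q p <> 0)%C /\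
  p = ((q + Cconj q * cayley q p) / (1 - cayley q p))%C.
Proof.
  intros Hp Hq. assert (N := caratheodory_neq0 p q Hp Hq).
  assert (Nq : (q + Cconj q <> 0)%C) by (apply caratheodory_neq0; lra).
  assert (E : (1 - cayley q p = (q + Cconj q) / (p + Cconj q))%C)
    by (unfold cayley; field; exact N).
  assert (N1 : (1 - cayley q p <> 0)%C).
  { rewrite E. apply Cmult_neq_0; [exact Nq |]. intros K.
    assert (K1 : ((p + Cconj q) * / (p + Cconj q) = 1)%C) by now apply Cinv_r.
    rewrite K, Cmult_0_r in K1. apply RtoC_inj in K1. lra. }
  split; [exact N1 |]. rewrite E. unfold cayley. field. now split.
Qed.

Lemma cayley_schwarz (Q : C -> C) : hol 1 Q -> (forall z, disk 1 z -> 0 <= Re (Q z)) ->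
  0 < Re (Q 0) ->
  hol 1 (fun z => cayley (Q 0) (Q z)) /\ cayley (Q 0) (Q 0) = 0 /\
  (forall z, disk 1 z -> Cmod (cayley (Q 0) (Q z)) <= 1).
Proof.
  intros HQ Hp H0. repeat split.
  - apply hol_intro. intros z Hz. eexists. apply cder_div.
    + apply caratheodory_neq0; [now apply Hp | exact H0].
    + apply cd_minus; [now apply HQ | apply cd_const].
    + apply cd_plus; [now apply HQ | apply cd_const].
  - unfold cayley. replace (Q 0 - Q 0)%C with (RtoC 0) by ring. unfold Cdiv. ring.
  - intros z Hz. apply cayley_le1; [now apply Hp | exact H0].
Qed.

Lemma disk1_0 : disk 1 0.
Proof. unfold disk. rewrite Cmod_0. lra. Qed.

(** By Schwarz's lemma the Cayley image [w] of [Q z] satisfies [|w| <= |z| < 1], and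
    [Re p * |1 - w|^2 = Re q * (1 - |w|^2)] turns this into strict positivity. *)
Lemma Re_pos_of_nonneg (Q : C -> C) (z : C) : hol 1 Q -> (forall z, disk 1 z -> 0 <= Re (Q z)) ->
  0 < Re (Q 0) -> disk 1 z -> 0 < Re (Q z).
Proof.
  intros HQ Hp H0 Hz. destruct (cayley_schwarz Q HQ Hp H0) as (Hw & Hw0 & Hw1).
  assert (B := schwarz_lemma _ z Hw Hw0 Hw1 Hz). cbv beta in B.
  destruct (cayley_inv (Q z) (Q 0) (Hp z Hz) H0) as [N E].
  set (w := cayley (Q 0) (Q z)) in *. set (q := Q 0) in *. set (p := Q z) in *.
  assert (Hz' := Hz). unfold disk in Hz'.
  assert (Hw2 : Cmod w ^ 2 < 1) by (assert (H := Cmod_ge_0 w); nra).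
  rewrite Cmod_sqr in Hw2.
  assert (E2 : (p * (1 - w) = q + Cconj q * w)%C) by (rewrite E; field; exact N).
  destruct p as [a b], q as [c d], w as [u v]. simpl in *.
  assert (E3 := f_equal Re E2). assert (E4 := f_equal Im E2). simpl in E3, E4.
  assert (K : a * ((1 - u) ^ 2 + v ^ 2) = c * (1 - (u ^ 2 + v ^ 2))).
  { replace (a * ((1 - u) ^ 2 + v ^ 2)) with
      ((a * (1 + - u) - b * (0 + - v)) * (1 - u) - (a * (0 + - v) + b * (1 + - u)) * v) by ring.
    rewrite E3, E4. ring. }
  assert (0 < (1 - u) ^ 2 + v ^ 2).
  { nra. }
  assert (0 < c * (1 - (u ^ 2 + v ^ 2))) by (apply Rmult_lt_0_compat; nra).
  apply Rmult_lt_reg_r with ((1 - u) ^ 2 + v ^ 2); [assumption |]. lra.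
Qed.

(** In [p = (q + conj q * w) / (1 - w)] the numerator is at most [|q| (1 + |w|)], the denominator at
    least [1 - |w|], and [|w| <= |z|] by Schwarz's lemma. *)
Lemma caratheodory_growth (Q : C -> C) (z : C) : hol 1 Q -> (forall z, disk 1 z -> 0 <= Re (Q z)) ->
  0 < Re (Q 0) -> disk 1 z -> Cmod (Q z) <= Cmod (Q 0) * ((1 + Cmod z) / (1 - Cmod z)).
Proof.
  intros HQ Hp H0 Hz. destruct (cayley_schwarz Q HQ Hp H0) as (Hw & Hw0 & Hw1).
  assert (B := schwarz_lemma _ z Hw Hw0 Hw1 Hz). cbv beta in B.
  destruct (cayley_inv (Q z) (Q 0) (Hp z Hz) H0) as [N E]. rewrite E at 1.
  set (w := cayley (Q 0) (Q z)) in *. unfold disk in Hz.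
  unfold Cdiv, Rdiv. rewrite <- Rmult_assoc. apply Cmod_le_mult.
  - rewrite Rmult_plus_distr_l, Rmult_1_r. apply Cmod_le_plus; [apply Rle_refl |].
    apply Cmod_le_mult; [rewrite Cmod_conj; apply Rle_refl | exact B].
  - rewrite Cmod_inv by exact N. apply Rinv_le_contravar; [lra |].
    assert (T := Cmod_triangle (1 - w) w). replace (1 - w + w)%C with (RtoC 1) in T by ring.
    rewrite Cmod_1 in T. lra.
Qed.

(** The Cayley image of [Q] has derivative [Q' 0 / (2 Re (Q 0))] at 0, at most 1 in modulus by
    Schwarz's lemma. *)
Lemma caratheodory_derive0 (Q : C -> C) : hol 1 Q -> (forall z, disk 1 z -> 0 <= Re (Q z)) ->
  0 < Re (Q 0) -> Cmod (C_derive Q 0) <= 2 * Re (Q 0).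
Proof.
  intros HQ Hp H0. destruct (cayley_schwarz Q HQ Hp H0) as (Hw & Hw0 & Hw1).
  assert (B := schwarz_dslope _ 0 Hw Hw0 Hw1 disk1_0). rewrite dslope_0 in B.
  assert (N := caratheodory_neq0 (Q 0) (Q 0) (Hp 0 disk1_0) H0).
  assert (E : (Q 0 + Cconj (Q 0) = RtoC (2 * Re (Q 0)))%C).
  { apply injective_projections; simpl; unfold Re; ring. }
  assert (D : C_derive (fun z => cayley (Q 0) (Q z)) 0 = (C_derive Q 0 / RtoC (2 * Re (Q 0)))%C).
  { apply cder_C_derive. eapply cd_eq.
    - apply cder_div; [exact N | |].
      + apply cd_minus; [now apply HQ, disk1_0 | apply cd_const].
      + apply cd_plus; [now apply HQ, disk1_0 | apply cd_const].
    - cbv beta. rewrite <- E. field. exact N. }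
  rewrite D, Cmod_div, Cmod_R, Rabs_pos_eq in B; [| lra |].
  - apply Rmult_le_reg_r with (/ (2 * Re (Q 0))); [apply Rinv_0_lt_compat; lra |].
    rewrite Rinv_r by lra. exact B.
  - now rewrite <- E.
Qed.

(** For [|a| < 1], the disk automorphism that sends 0 to [a]; its derivative at 0 is [1 - |a|^2]. *)
Definition moebius (a u : C) : C := ((u + a) / (1 + Cconj a * u))%C.

Lemma moebius_disk (a u : C) : disk 1 a -> disk 1 u ->
  (1 + Cconj a * u <> 0)%C /\ disk 1 (moebius a u).
Proof.
  unfold disk. intros Ha Hu.
  assert (Ha0 := Cmod_ge_0 a). assert (Hu0 := Cmod_ge_0 u).
  assert (N : (1 + Cconj a * u <> 0)%C).
  { intros E. assert (H : Cmod (Cconj a * u)%C = 1).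
    { replace (Cconj a * u)%C with ((1 + Cconj a * u) - 1)%C by ring. rewrite E.
      replace (0 - 1)%C with (- (1))%C by ring. now rewrite Cmod_opp, Cmod_1. }
    rewrite Cmod_mult, Cmod_conj in H. nra. }
  split; [exact N |]. unfold moebius. rewrite Cmod_div by exact N.
  assert (P := proj1 (Cmod_gt_0 _) N).
  apply Rmult_lt_reg_r with (Cmod (1 + Cconj a * u)); [exact P |].
  unfold Rdiv. rewrite Rmult_assoc, Rinv_l, Rmult_1_l, Rmult_1_r by lra.
  assert (A2 : Cmod a ^ 2 < 1) by nra. assert (U2 : Cmod u ^ 2 < 1) by nra.
  rewrite Cmod_sqr in A2, U2. unfold Cmod. apply sqrt_lt_1_alt.
  split; [apply Rplus_le_le_0_compat; apply pow2_ge_0 |].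
  destruct a as [x y], u as [s t]; simpl in *.
  assert (0 < (1 - (x * (x * 1) + y * (y * 1))) * (1 - (s * (s * 1) + t * (t * 1))))
    by (apply Rmult_lt_0_compat; lra). nra.
Qed.

(** Precomposing with the automorphism that sends 0 to [a] reduces the bound to the one at the
    origin. *)
Lemma caratheodory_derive (Q : C -> C) (a : C) : hol 1 Q -> (forall z, disk 1 z -> 0 < Re (Q z)) ->
  disk 1 a -> Cmod (C_derive Q a) * (1 - Cmod a ^ 2) <= 2 * Re (Q a).
Proof.
  intros HQ Hp Ha.
  assert (DT : forall u, disk 1 u -> cder (moebius a) u
    ((1 * (1 + Cconj a * u) - (u + a) * Cconj a) / ((1 + Cconj a * u) * (1 + Cconj a * u)))%C).
  { intros u Hu. destruct (moebius_disk a u Ha Hu) as [N _].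
    eapply cd_eq; [apply cder_div; [exact N | |] |].
    - apply cd_plus; [apply cd_id | apply cd_const].
    - apply cd_plus; [apply cd_const | apply cder_mult; [apply cd_const | apply cd_id]].
    - cfield. exact N. }
  assert (M0 : moebius a 0 = a) by (unfold moebius; field).
  assert (HQT : hol 1 (fun u => Q (moebius a u))).
  { apply hol_intro. intros u Hu. eexists. apply (cder_comp Q (moebius a)).
    - apply HQ. now apply moebius_disk.
    - now apply DT. }
  assert (B := caratheodory_derive0 _ HQT). cbv beta in B. rewrite M0 in B.
  assert (D : C_derive (fun u => Q (moebius a u)) 0 = (C_derive Q a * RtoC (1 - Cmod a ^ 2))%C).
  { apply cder_C_derive. eapply cd_eq.
    - apply (cder_comp Q (moebius a)); [rewrite M0; now apply HQ | apply DT, disk1_0].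
    - f_equal. rewrite RtoC_minus, Cmod2_conj. field. }
  rewrite D, Cmod_mult, Cmod_R, Rabs_pos_eq in B.
  - apply B; [| now apply Hp]. intros z Hz. left. apply Hp. now apply moebius_disk.
  - unfold disk in Ha. assert (H := Cmod_ge_0 a). nra.
Qed.

(** * The analytic characterisation of spirallikeness *)

Lemma derive_nonneg_of_left_max (g : R -> R) (d : R) : is_derive g 0 d ->
  (forall t, t <= 0 -> g t <= g 0) -> 0 <= d.
Proof.
  intros Hg Hmax. apply is_derive_Reals in Hg. apply Rnot_lt_le. intros Hd.
  destruct (Hg (- d / 2) ltac:(lra)) as [delta H].
  assert (Hp := cond_pos delta). set (h := - (delta / 2)).
  specialize (H h ltac:(unfold h; lra)).
  specialize (H ltac:(unfold h; rewrite Rabs_left; lra)).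
  apply Rabs_def2 in H. specialize (Hmax (0 + h) ltac:(unfold h; lra)).
  assert (K : 0 <= (g (0 + h) - g 0) / h).
  { replace ((g (0 + h) - g 0) / h) with ((g 0 - g (0 + h)) / (delta / 2))
      by (unfold h; field; lra).
    apply Rdiv_le_0_compat; lra. }
  lra.
Qed.

Lemma pder_Cexp_ray (a b : R) : pder (fun t => Cexp (RtoC t * (a, b))%C) 0 (a, b).
Proof.
  apply pder_parts. unfold Cexp. simpl. split.
  - apply (is_derive_ext (fun t => exp (t * a) * cos (t * b))).
    + intros t. f_equal; f_equal; ring.
    + auto_derive; trivial. rewrite !Rmult_0_l, exp_0, cos_0, sin_0. ring.
  - apply (is_derive_ext (fun t => exp (t * a) * sin (t * b))).
    + intros t. f_equal; f_equal; ring.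
    + auto_derive; trivial. rewrite !Rmult_0_l, exp_0, cos_0, sin_0. ring.
Qed.

Lemma Cexp_Ci (t : R) : Cexp (Ci * t)%C = eit t.
Proof.
  unfold Cexp, eit. simpl.
  replace (0 * t - 1 * 0) with 0 by ring. replace (0 * 0 + 1 * t) with t by ring.
  rewrite exp_0. f_equal; ring.
Qed.
Lemma Cexp_0 : Cexp 0 = 1.
Proof. unfold Cexp. simpl. rewrite exp_0, cos_0, sin_0. unfold RtoC. f_equal; ring. Qed.

Lemma spirallike_hol (lambda : R) (f : C -> C) : spirallike lambda f -> hol 1 f.
Proof.
  intros (Hf & _). apply hol_intro. intros z Hz. destruct (Hf z Hz) as [l Hl].
  exists l. now apply cder_is_derive.
Qed.

(** For [t <= 0], [|om t z|^2] is at most its value [|z|^2] at [t = 0], so its derivative there is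
    nonnegative; half of that derivative is the stated real part. The flow produces [f / f'], the
    reciprocal of the quotient needed in the sequel. *)
Lemma spirallike_Re (lambda : R) (f : C -> C) (z : C) : spirallike lambda f -> disk 1 z ->
  0 <= Re (Cconj z * (eit lambda * f z / C_derive f z))%C.
Proof.
  intros Hs Hz. assert (Hf := spirallike_hol lambda f Hs).
  destruct Hs as (_ & f0 & Hi & _ & _ & Hsp).
  change (injective_on (disk 1) f) in Hi.
  destruct (inverse_exists f Hi) as [k Hk].
  assert (ND : forall z, disk 1 z -> C_derive f z <> 0)
    by (intros; now apply univalent_derive_neq0).
  assert (Kd : forall z, disk 1 z -> cder k (f z) (/ C_derive f z)%C).
  { intros u Hu. apply inverse_cder; trivial; [now apply Hf | now apply ND]. }
  set (c := fun t : R => Cexp (RtoC t * eit lambda)%C).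
  assert (Pre : forall t u, t <= 0 -> disk 1 u -> exists v, disk 1 v /\ f v = (f u * c t)%C).
  { intros t u Ht Hu. destruct (Hsp (f u)) with (z := (f u * c t)%C) as (v & Hv & E).
    - now exists u.
    - left. exists t. split; [exact Ht |]. unfold c. now rewrite Cexp_Ci.
    - now exists v. }
  set (om := fun (t : R) (u : C) => k (f u * c t)%C).
  assert (Bd : forall t, t <= 0 -> Cmod (om t z) <= Cmod z).
  { intros t Ht. apply schwarz_lemma; trivial.
    - apply hol_intro. intros u Hu. destruct (Pre t u Ht Hu) as (v & Hv & E).
      eexists. apply (cder_comp k (fun u => f u * c t)%C).
      + rewrite <- E. now apply Kd.
      + apply cder_mult; [now apply Hf | apply cd_const].
    - unfold om. replace (f 0 * c t)%C with (f 0) by (rewrite f0; ring). apply Hk, disk1_0.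
    - intros u Hu. destruct (Pre t u Ht Hu) as (v & Hv & E).
      unfold om. rewrite <- E, Hk by exact Hv. unfold disk in Hv. lra. }
  assert (c0 : c 0 = 1) by (unfold c; rewrite Cmult_0_l; apply Cexp_0).
  assert (D : pder (fun t => om t z) 0 (/ C_derive f z * (f z * eit lambda))%C).
  { eapply cd_eq.
    - apply (pder_comp k (fun t => f z * c t)%C).
      + rewrite c0, Cmult_1_r. now apply Kd.
      + apply pder_mult; [apply cd_const | apply pder_Cexp_ray].
    - fold (eit lambda). cring. }
  assert (om0 : om 0 z = z) by (unfold om; rewrite c0, Cmult_1_r; now apply Hk).
  assert (D2 := pder_Re _ _ _ (pder_mult _ _ _ _ _ (pder_conj _ _ _ D) D)). cbv beta in D2.
  apply derive_nonneg_of_left_max in D2.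
  - rewrite om0 in D2. set (l := (/ C_derive f z * (f z * eit lambda))%C) in *.
    replace (eit lambda * f z / C_derive f z)%C with l by (unfold l, Cdiv; ring).
    destruct l as [a b], z as [x y]. simpl in *. lra.
  - intros t Ht. specialize (Bd t Ht). rewrite om0.
    assert (B2 : Cmod (om t z) ^ 2 <= Cmod z ^ 2) by (apply pow_incr; split; [apply Cmod_ge_0 | exact Bd]).
    rewrite !Cmod_sqr in B2. destruct (om t z) as [a b], z as [x y]. simpl in *. lra.
Qed.

(** The function [Q] of the overview. Writing [dslope f z] for [f z / z] makes it holomorphic at 0
    as well. *)
Definition spiral_quotient (lambda : R) (f : C -> C) (z : C) : C :=
  (Cconj (eit lambda) * C_derive f z / dslope f z)%C.

Lemma eit_conj (t : R) : (eit t * Cconj (eit t) = 1)%C.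
Proof. rewrite <- Cmod2_conj, Cmod_eit. f_equal. ring. Qed.

Lemma spirallike_dslope_neq0 (lambda : R) (f : C -> C) (z : C) : spirallike lambda f ->
  disk 1 z -> dslope f z <> 0.
Proof.
  intros Hs Hz E. assert (Hf := spirallike_hol lambda f Hs).
  destruct Hs as (_ & f0 & Hi & _). change (injective_on (disk 1) f) in Hi.
  destruct (Ceq_dec z 0) as [-> | N].
  - rewrite dslope_0 in E. revert E. now apply univalent_derive_neq0.
  - apply N. apply Hi; [exact Hz | apply disk1_0 |].
    rewrite (dslope_eq f z), E. ring.
Qed.

Lemma spiral_quotient_hol (lambda : R) (f : C -> C) : spirallike lambda f ->
  hol 1 (spiral_quotient lambda f).
Proof.
  intros Hs. assert (Hf := spirallike_hol lambda f Hs).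
  apply hol_intro. intros z Hz. eexists. apply cder_div.
  - now apply (spirallike_dslope_neq0 lambda).
  - apply cder_mult; [apply cd_const | now apply (hol_derive 1)].
  - now apply (dslope_hol 1).
Qed.

Lemma spiral_quotient_0 (lambda : R) (f : C -> C) : spirallike lambda f ->
  spiral_quotient lambda f 0 = Cconj (eit lambda).
Proof.
  intros Hs. unfold spiral_quotient. rewrite dslope_0. field.
  rewrite <- dslope_0. apply (spirallike_dslope_neq0 lambda); [exact Hs | apply disk1_0].
Qed.

Lemma spiral_quotient_eq (lambda : R) (f : C -> C) (z : C) : spirallike lambda f -> disk 1 z ->
  (z * C_derive f z = eit lambda * f z * spiral_quotient lambda f z)%C.
Proof.
  intros Hs Hz. assert (N := spirallike_dslope_neq0 lambda f z Hs Hz).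
  destruct Hs as (_ & f0 & _). unfold spiral_quotient.
  replace (f z) with (z * dslope f z)%C.
  - transitivity ((eit lambda * Cconj (eit lambda)) * (z * C_derive f z))%C.
    + rewrite eit_conj. ring.
    + field. exact N.
  - rewrite (dslope_eq f z), f0. ring.
Qed.

(** The number in [spirallike_Re] equals [|z|^2 / q], a positive multiple of [conj q], so
    [Re q >= 0]. Strictness follows from the value at 0, whose real part is [cos lambda]. *)
Lemma spiral_quotient_Re (lambda : R) (f : C -> C) (z : C) : 0 < cos lambda ->
  spirallike lambda f -> disk 1 z -> 0 < Re (spiral_quotient lambda f z).
Proof.
  intros Hl Hs Hz. apply Re_pos_of_nonneg; trivial.
  - now apply spiral_quotient_hol.
  - clear z Hz. intros z Hz. assert (Hf := spirallike_hol lambda f Hs).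
    destruct (Ceq_dec z 0) as [-> | Nz].
    { rewrite spiral_quotient_0 by exact Hs. simpl. lra. }
    assert (H := spirallike_Re lambda f z Hs Hz).
    assert (Nd : C_derive f z <> 0) by (apply univalent_derive_neq0; trivial; apply Hs).
    assert (E := spiral_quotient_eq lambda f z Hs Hz).
    set (q := spiral_quotient lambda f z) in *.
    assert (Nq : q <> 0).
    { intros K. rewrite K, Cmult_0_r in E. revert E. now apply Cmult_neq_0. }
    replace (Cconj z * (eit lambda * f z / C_derive f z))%C
      with (RtoC (Cmod z ^ 2 * / Cmod q ^ 2) * Cconj q)%C in H.
    + assert (K : Re (RtoC (Cmod z ^ 2 * / Cmod q ^ 2) * Cconj q)%C =
        Cmod z ^ 2 * / Cmod q ^ 2 * Re q) by (simpl; unfold Re; ring).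
      rewrite K in H. assert (P1 : 0 < Cmod z) by now apply Cmod_gt_0.
      assert (P2 : 0 < Cmod q) by now apply Cmod_gt_0.
      assert (P : 0 < Cmod z ^ 2 * / Cmod q ^ 2)
        by (apply Rmult_lt_0_compat; [| apply Rinv_0_lt_compat]; apply pow_lt; lra).
      apply Rmult_le_reg_l with (1 := P). lra.
    + assert (P2 : Cmod q ^ 2 <> 0) by (apply pow_nonzero; assert (H2 := proj1 (Cmod_gt_0 q) Nq); lra).
      rewrite RtoC_mult, RtoC_inv, !Cmod2_conj by exact P2.
      assert (Ncq : Cconj q <> 0).
      { intros K. apply Nq. apply Cmod_eq_0. rewrite <- Cmod_conj, K. apply Cmod_0. }
      transitivity (Cconj z * (z * / q))%C; [field; now split |].
      f_equal. transitivity ((z * C_derive f z) / (q * C_derive f z))%C; [field; now split |].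
      rewrite E. field. now split.
  - rewrite spiral_quotient_0 by exact Hs. exact Hl.
Qed.

(** * The area in polar coordinates *)

(** Continuity along a compact segment is uniform in a neighbourhood of the parameter. The parameter
    space is left general, as it is once the line and once the plane. *)
Lemma locally_uniform_param {U : UniformSpace} (K : U -> R -> R) (p0 : U) (a b e : R) :
  0 < e ->
  (forall s, a <= s <= b -> continuous (fun p : U * R => K (fst p) (snd p)) (p0, s)) ->
  locally p0 (fun p => forall s, a <= s <= b -> Rabs (K p s - K p0 s) < e).
Proof.
  intros He Hc. assert (He2 : 0 < e / 2) by lra.
  assert (Hd : forall s, exists d : posreal, a <= s <= b -> forall p t, ball p0 d p ->
    Rabs (t - s) < d -> Rabs (K p t - K p0 s) < e / 2).
  { intros s. destruct (classic (a <= s <= b)) as [Hs | N].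
    - destruct (Hc s Hs _ (locally_ball (K p0 s) (mkposreal _ He2))) as [d Hd].
      exists d. intros _ p t Hp Ht. apply (Hd (p, t)). now split.
    - exists (mkposreal 1 Rlt_0_1). intros H. now destruct N. }
  assert (Hch : exists delta : R -> posreal, forall s, a <= s <= b -> forall p t, ball p0 (delta s) p ->
    Rabs (t - s) < delta s -> Rabs (K p t - K p0 s) < e / 2).
  { exists (fun s => proj1_sig (IndefiniteDescription.constructive_indefinite_description _ (Hd s))).
    intros s. exact (proj2_sig (IndefiniteDescription.constructive_indefinite_description _ (Hd s))). }
  destruct Hch as [delta Hdelta].
  destruct (compactness_value_1d a b delta) as [d Hcomp].
  exists d. intros p Hp s Hs. apply NNPP. intros Hbad.
  apply (Hcomp s Hs). intros (t & Ht & Hst & Hdt). apply Hbad.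
  assert (A1 := Hdelta t Ht p s (ball_le _ _ _ Hdt _ Hp) Hst).
  assert (A2 := Hdelta t Ht p0 s (ball_center _ _) Hst).
  replace (K p s - K p0 s) with ((K p s - K p0 t) - (K p0 s - K p0 t)) by ring.
  eapply Rle_lt_trans; [apply Rabs_triang |]. rewrite Rabs_Ropp. lra.
Qed.

Lemma continuous_RInt_param {U : UniformSpace} (K : U -> R -> R) (p0 : U) (a b : R) : a <= b ->
  (forall s, a <= s <= b -> continuous (fun p : U * R => K (fst p) (snd p)) (p0, s)) ->
  locally p0 (fun p => forall s, a <= s <= b -> continuous (K p) s) ->
  continuous (fun p => RInt (K p) a b) p0.
Proof.
  intros Hab Hc Hl P [eps HP]. unfold filtermap.
  (* The [+ 1] keeps the denominator positive when [a = b]. *)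
  assert (He : 0 < eps / (b - a + 1)) by (apply Rdiv_lt_0_compat; [apply cond_pos | lra]).
  assert (Hl0 := locally_singleton _ _ Hl).
  generalize (filter_and _ _ (locally_uniform_param K p0 a b _ He Hc) Hl). apply filter_imp.
  intros p [H1 H2]. apply HP. change (Rabs (RInt (K p) a b - RInt (K p0) a b) < eps).
  assert (I1 : ex_RInt (K p) a b) by now apply ex_RInt_cts.
  assert (I2 : ex_RInt (K p0) a b) by now apply ex_RInt_cts.
  assert (E : RInt (K p) a b - RInt (K p0) a b = RInt (fun s => K p s - K p0 s) a b)
    by (symmetry; now apply RInt_minusR).
  rewrite E.
  eapply Rle_lt_trans; [apply (abs_RInt_le_const _ _ _ (eps / (b - a + 1))); [exact Hab | |] |].
  - ct.
  - intros t Ht. left. now apply H1.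
  - assert (Hpos := cond_pos eps).
    apply Rmult_lt_reg_r with (b - a + 1); [lra |].
    replace ((b - a) * (eps / (b - a + 1)) * (b - a + 1)) with ((b - a) * eps) by (field; lra). nra.
Qed.

Lemma RInt_scaled (h : R -> R) (y : R) : (forall t, Rmin 0 y <= t <= Rmax 0 y -> continuous h t) ->
  y * RInt (fun s => h (y * s)) 0 1 = RInt h 0 y.
Proof.
  intros Hh.
  assert (I : ex_RInt h (y * 0 + 0) (y * 1 + 0)).
  { replace (y * 0 + 0) with 0 by ring. replace (y * 1 + 0) with y by ring.
    now apply ex_RInt_between. }
  assert (E := RInt_comp_linR h y 0 0 1 I).
  replace (y * 0 + 0) with 0 in E by ring. replace (y * 1 + 0) with y in E by ring.
  rewrite <- E. destruct (Req_dec y 0) as [-> | Ny].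
  { rewrite Rmult_0_l. symmetry. etransitivity.
    - apply RInt_ext. intros s _. instantiate (1 := fun _ => 0). simpl. ring.
    - rewrite RInt_constR. ring. }
  assert (I2 : ex_RInt (fun s => h (y * s)) 0 1).
  { apply ex_RInt_cts; [lra |]. intros s Hs.
    apply (cts_comp (fun s => y * s) h).
    - apply Hh. unfold Rmin, Rmax. repeat destruct Rle_dec; nra.
    - ct. }
  rewrite <- RInt_scalR by exact I2. apply RInt_ext. intros s _. do 2 f_equal. ring.
Qed.

Lemma RInt_periodic (h : R -> R) (T a : R) : (forall t, continuous h t) ->
  (forall t, h (t + T) = h t) -> RInt h a (a + T) = RInt h 0 T.
Proof.
  intros Hc HT.
  assert (I : forall u v, ex_RInt h u v)
    by (intros; apply ex_RInt_between; auto).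
  assert (C1 := RInt_ChaslesR h a 0 (a + T) (I _ _) (I _ _)).
  assert (C2 := RInt_ChaslesR h 0 T (a + T) (I _ _) (I _ _)).
  assert (E := RInt_comp_linR h 1 T 0 a (I _ _)).
  replace (1 * 0 + T) with T in E by ring. replace (1 * a + T) with (a + T) in E by ring.
  assert (E2 : RInt h T (a + T) = RInt h 0 a).
  { rewrite <- E. apply RInt_ext. intros t _. rewrite !Rmult_1_l. apply HT. }
  assert (S := RInt_swapR h 0 a (I _ _)). lra.
Qed.

Lemma sin_add_2PI (x : R) : sin (x + 2 * PI) = sin x.
Proof. rewrite sin_plus, sin_2PI, cos_2PI. ring. Qed.
Lemma cos_add_2PI (x : R) : cos (x + 2 * PI) = cos x.
Proof. rewrite cos_plus, sin_2PI, cos_2PI. ring. Qed.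

(** The vertical primitive of [g] from the real axis, rescaled to [[0, 1]]: over a fixed interval,
    joint continuity and the derivative in [x] are statements about integrals with a parameter. *)
Definition vprim (g : C -> R) (x y : R) : R := y * RInt (fun s => g (x, y * s)) 0 1.

Lemma disk_coord (rad x y x' y' : R) : disk rad (x, y) -> Rabs x' <= Rabs x -> Rabs y' <= Rabs y ->
  disk rad (x', y').
Proof.
  unfold disk. intros H H1 H2. apply Rle_lt_trans with (Cmod (x, y)); [| exact H].
  now apply Cmod_le_coord.
Qed.

Lemma vprim_cts (rad : R) (g : C -> R) (x y : R) : (forall z, disk rad z -> continuous g z) ->
  disk rad (x, y) -> continuous (fun p : R * R => vprim g (fst p) (snd p)) (x, y).
Proof.
  intros Hg Hz. apply cts_Rmult; [apply continuous_snd |].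
  assert (Hd : forall p : C, disk rad p -> forall s, 0 <= s <= 1 -> disk rad (fst p, snd p * s)).
  { intros [u v] Hp s Hs. cbn [fst snd]. apply (disk_coord rad u v); trivial; [lra |].
    rewrite Rabs_mult, (Rabs_pos_eq s) by lra. assert (H := Rabs_pos v). nra. }
  apply (continuous_RInt_param (U := C_UniformSpace) (fun p s => g (fst p, snd p * s)) (x, y)); [lra | |].
  - intros s Hs. apply (cts_comp (fun p : C * R => (fst (fst p), snd (fst p) * snd p) : C) g).
    + auto.
    + apply continuous_pair_C.
      * apply (cts_comp (fun p : C * R => fst p) (fun z : C => fst z)); apply continuous_fst.
      * apply cts_Rmult; [| apply continuous_snd].
        apply (cts_comp (fun p : C * R => fst p) (fun z : C => snd z));
          [apply continuous_snd | apply continuous_fst].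
  - generalize (disk_open rad (x, y) Hz). apply filter_imp. intros p Hp s Hs.
    apply (cts_comp (fun s => (fst p, snd p * s) : C) g).
    + auto.
    + apply continuous_pair_C; [apply continuous_const |].
      apply cts_Rmult; [apply continuous_const | apply continuous_id].
Qed.

Lemma vprim_RInt (rad : R) (g : C -> R) (x y : R) : (forall z, disk rad z -> continuous g z) ->
  disk rad (x, y) -> vprim g x y = RInt (fun t => g (x, t)) 0 y.
Proof.
  intros Hg Hz. apply (RInt_scaled (fun t => g (x, t))). intros t Ht.
  apply (cts_comp (fun t => (x, t) : C) g).
  - apply Hg. apply (disk_coord rad x y); trivial; [lra |].
    replace 0 with (0 * y) in Ht by ring. apply (Rabs_between0 0 y); [lra | exact Ht].
  - ct.
Qed.

Lemma vprim_dy (rad : R) (g : C -> R) (x y : R) : (forall z, disk rad z -> continuous g z) ->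
  disk rad (x, y) -> is_derive (fun v => vprim g x v) y (g (x, y)).
Proof.
  intros Hg Hz.
  assert (Ly : locally y (fun t => disk rad (x, t))).
  { assert (K : continuous (fun t : R => (x, t) : C) y)
      by ct.
    exact (K _ (disk_open rad (x, y) Hz)). }
  assert (Cg : forall t, disk rad (x, t) -> continuous (fun t => g (x, t)) t).
  { intros t Ht. apply (cts_comp (fun t => (x, t) : C) g); [now apply Hg |].
    apply continuous_pair_C; [apply continuous_const | apply continuous_id]. }
  apply (is_derive_RInt (fun t => g (x, t)) _ 0 y); [| now apply Cg].
  revert Ly. apply filter_imp. intros v Hv. rewrite (vprim_RInt rad) by trivial.
  apply (RInt_correct (V := R_CompleteNormedModule)).
  apply ex_RInt_between. intros t Ht. apply Cg.
  apply (disk_coord rad x v); trivial; [lra |].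
  replace 0 with (0 * v) in Ht by ring. apply (Rabs_between0 0 v); [lra | exact Ht].
Qed.

Lemma vprim_dx (rad : R) (g gx : C -> R) (x y : R) : (forall z, disk rad z -> continuous g z) ->
  (forall z, disk rad z -> continuous gx z) ->
  (forall u v, disk rad (u, v) -> is_derive (fun u => g (u, v)) u (gx (u, v))) ->
  disk rad (x, y) -> is_derive (fun u => vprim g u y) x (vprim gx x y).
Proof.
  intros Hg Hgx HD Hz.
  destruct (proj1 (locally_Cmod _ _) (disk_open rad (x, y) Hz)) as (d & Hd & HH).
  assert (Hy := Rabs_pos y).
  (* Chosen so that moving [x] by [e] and stretching the vertical segment by the factor [1 + e]
     displaces its endpoint by at most [e * (1 + Rabs y) = d / 2]. *)
  set (e := d / (2 * (1 + Rabs y))).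
  assert (He : 0 < e) by (apply Rdiv_lt_0_compat; lra).
  assert (Ee : e * (1 + Rabs y) = d / 2) by (unfold e; field; lra).
  assert (InD : forall u s, x - e < u < x + e -> - e < s < 1 + e -> disk rad (u, y * s)).
  { intros u s Hu Hs. apply (disk_coord rad u (y * (1 + e))); [| lra |].
    - apply HH. eapply Rle_lt_trans; [apply Cmod_le_ReIm |]. simpl.
      assert (Rabs (u + - x) <= e) by (apply Rabs_le; lra).
      replace (y * (1 + e) + - y) with (y * e) by ring.
      rewrite Rabs_mult, (Rabs_pos_eq e) by lra. nra.
    - rewrite !Rabs_mult. apply Rmult_le_compat_l; [exact Hy |].
      rewrite (Rabs_pos_eq (1 + e)) by lra. apply Rabs_le. lra. }
  apply (is_derive_scal (fun u => RInt (fun s => g (u, y * s)) 0 1) x y).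
  apply (RInt_param_derive_loc (fun u s => g (u, y * s)) (fun u s => gx (u, y * s))
    (x - e) (x + e) (- e) (1 + e)); try lra.
  - auto.
  - intros u t Hu Ht. apply (cts_comp (fun p : R * R => (fst p, y * snd p) : C) gx).
    + auto.
    + apply continuous_pair_C; [apply continuous_fst |].
      apply cts_Rmult; [apply continuous_const | apply continuous_snd].
  - intros u t Hu Ht. apply (cts_comp (fun s => (u, y * s) : C) g).
    + auto.
    + apply continuous_pair_C; [apply continuous_const |].
      apply cts_Rmult; [apply continuous_const | apply continuous_id].
Qed.

Lemma vprim_chain (rad : R) (g gx : C -> R) (u v : R -> R) (t u' v' : R) :
  (forall z, disk rad z -> continuous g z) -> (forall z, disk rad z -> continuous gx z) ->
  (forall u v, disk rad (u, v) -> is_derive (fun u => g (u, v)) u (gx (u, v))) ->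
  disk rad (u t, v t) -> is_derive u t u' -> is_derive v t v' ->
  is_derive (fun t => vprim g (u t) (v t)) t (vprim gx (u t) (v t) * u' + g (u t, v t) * v').
Proof.
  intros Hg Hgx HD Hz Hu Hv. apply is_derive_Reals.
  apply derivable_pt_lim_comp_2d; [| now apply is_derive_Reals | now apply is_derive_Reals].
  apply filterdiff_differentiable_pt_lim.
  apply (is_derive_filterdiff (vprim g) (u t) (v t) (vprim gx)).
  - generalize (disk_open rad (u t, v t) Hz). apply filter_imp. intros [x y] Hp. cbn [fst snd].
    now apply (vprim_dx rad).
  - now apply (vprim_dy rad).
  - now apply (vprim_cts rad).
Qed.

(** The integral of [vprim g dx] around the circle of radius [r], taken clockwise as
    [(r sin p, r cos p)]: for positive [r] the upper half comes first, from left to right. By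
    Green's theorem it is the integral of [g] over the disk, and it is smooth in [r], unlike the
    limits of the vertical sections. *)
Definition polar_area (g : C -> R) (r : R) : R :=
  RInt (fun p => vprim g (r * sin p) (r * cos p) * (r * cos p)) (- (PI / 2)) (3 * (PI / 2)).

Lemma disk_polar (rad r p : R) : Rabs r < rad -> disk rad (r * sin p, r * cos p).
Proof.
  intros Hr. unfold disk.
  replace (r * sin p, r * cos p) with (RtoC r * eit (PI / 2 - p))%C.
  - rewrite Cmod_RtoC_mult, Cmod_eit. lra.
  - unfold eit. rewrite cos_shift, sin_shift. apply injective_projections; simpl; ring.
Qed.

Lemma polar_area_0 (g : C -> R) : polar_area g 0 = 0.
Proof.
  unfold polar_area. etransitivity.
  - apply RInt_ext. intros p _. instantiate (1 := fun _ => 0). simpl. ring.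
  - rewrite RInt_constR. ring.
Qed.

Lemma polar_cts (rad r p : R) (g : C -> R) : (forall z, disk rad z -> continuous g z) ->
  Rabs r < rad ->
  continuous (fun q : R * R => g (fst q * sin (snd q), fst q * cos (snd q))) (r, p).
Proof.
  intros Hg Hr.
  apply (cts_comp (fun q : R * R => (fst q * sin (snd q), fst q * cos (snd q)) : C) g).
  - apply Hg. now apply disk_polar.
  - apply continuous_pair_C; (apply cts_Rmult; [apply continuous_fst |]);
      [apply cts_sin | apply cts_cos]; apply continuous_snd.
Qed.

Lemma continuous_fix_fst {V : UniformSpace} (F : R * R -> V) (x y : R) :
  continuous F (x, y) -> continuous (fun t => F (x, t)) y.
Proof.
  intros H. apply (cts_comp (fun t : R => (x, t) : C) F); [exact H |].
  apply continuous_pair_C; [apply continuous_const | apply continuous_id].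
Qed.

(** The radial derivative of the integrand is [r * g] plus the angular derivative of
    [W = vprim g * sin p]. The latter integrates to zero over a period and takes the terms with [gx]
    along. *)
Lemma polar_area_derive (rad : R) (g gx : C -> R) (r : R) :
  (forall z, disk rad z -> continuous g z) -> (forall z, disk rad z -> continuous gx z) ->
  (forall u v, disk rad (u, v) -> is_derive (fun u => g (u, v)) u (gx (u, v))) ->
  Rabs r < rad ->
  is_derive (polar_area g) r (r * RInt (fun t => g (circle r t)) 0 (2 * PI)).
Proof.
  intros Hg Hgx HD Hr.
  assert (HPI := PI_pos).
  assert (CG : forall u p, Rabs u < rad -> continuous (fun q : R * R =>
    vprim g (fst q * sin (snd q)) (fst q * cos (snd q))) (u, p)).
  { intros u p Hu. apply (polar_cts rad u p (fun z => vprim g (fst z) (snd z))); [| exact Hu].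
    intros [x y] Hz. now apply (vprim_cts rad). }
  assert (CGx : forall u p, Rabs u < rad -> continuous (fun q : R * R =>
    vprim gx (fst q * sin (snd q)) (fst q * cos (snd q))) (u, p)).
  { intros u p Hu. apply (polar_cts rad u p (fun z => vprim gx (fst z) (snd z))); [| exact Hu].
    intros [x y] Hz. now apply (vprim_cts rad). }
  assert (Cs : forall q, continuous (fun q : R * R => sin (snd q)) q)
    by (intros; apply cts_sin, continuous_snd).
  assert (Cc : forall q, continuous (fun q : R * R => cos (snd q)) q)
    by (intros; apply cts_cos, continuous_snd).
  set (H' := fun u p => (vprim gx (u * sin p) (u * cos p) * sin p +
     g (u * sin p, u * cos p) * cos p) * (u * cos p) + vprim g (u * sin p) (u * cos p) * cos p).
  assert (CH' : forall u p, Rabs u < rad -> continuous (fun q : R * R => H' (fst q) (snd q)) (u, p)).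
  { intros u p Hu. unfold H'. apply cts_Rplus.
    - apply cts_Rmult; [apply cts_Rplus; apply cts_Rmult |].
      + now apply CGx.
      + apply Cs.
      + now apply (polar_cts rad).
      + apply Cc.
      + apply cts_Rmult; [apply continuous_fst | apply Cc].
    - ct. }
  assert (E : RInt (H' r) (- (PI / 2)) (3 * (PI / 2)) = r * RInt (fun t => g (circle r t)) 0 (2 * PI)).
  { set (W := fun p => vprim g (r * sin p) (r * cos p) * sin p).
    set (W' := fun p => (vprim gx (r * sin p) (r * cos p) * (r * cos p) +
      g (r * sin p, r * cos p) * (- (r * sin p))) * sin p + vprim g (r * sin p) (r * cos p) * cos p).
    assert (DW : forall p, is_derive W p (W' p)).
    { intros p. unfold W, W'.
      apply (is_derive_mult (fun p => vprim g (r * sin p) (r * cos p)) sin); [| | apply Rmult_comm].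
      - apply (vprim_chain rad g gx (fun p => r * sin p) (fun p => r * cos p)); trivial.
        + now apply disk_polar.
        + auto_derive; trivial; ring.
        + auto_derive; trivial; ring.
      - auto_derive; trivial; ring. }
    assert (CW' : forall p, continuous W' p).
    { intros p. unfold W'.
      assert (K1 := continuous_fix_fst _ _ _ (CG r p Hr)).
      assert (K2 := continuous_fix_fst _ _ _ (CGx r p Hr)).
      assert (K3 := continuous_fix_fst _ _ _ (polar_cts rad r p g Hg Hr)). cbn [fst snd] in K1, K2, K3.
      assert (K4 : continuous sin p) by apply continuous_sin.
      assert (K5 : continuous cos p) by apply continuous_cos.
      assert (K6 : continuous (fun p => r * sin p) p)
        by ct.
      assert (K7 : continuous (fun p => r * cos p) p)
        by ct.
      apply cts_Rplus; apply cts_Rmult; trivial. apply cts_Rplus; apply cts_Rmult; trivial.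
      now apply cts_Ropp. }
    set (h := fun p => g (r * sin p, r * cos p)).
    assert (Ch : forall p, continuous h p).
    { intros p. exact (continuous_fix_fst _ _ _ (polar_cts rad r p g Hg Hr)). }
    assert (EW : RInt W' (- (PI / 2)) (3 * (PI / 2)) = 0).
    { rewrite (RInt_FTC W W') by (auto; lra). unfold W.
      replace (3 * (PI / 2)) with (- (PI / 2) + 2 * PI) by field.
      rewrite sin_add_2PI, cos_add_2PI. rring. }
    rewrite (RInt_ext (H' r) (fun p => 1 * W' p + r * h p)).
    - rewrite RInt_lin, EW by ct.
      rewrite Rmult_0_r, Rplus_0_l. f_equal.
      (* The substitution [p = PI / 2 - t] turns [(sin p, cos p)] into [eit t]; periodicity then
         moves the interval to [[0, 2 PI]]. *)
      assert (E1 := RInt_comp_linR h (-1) (PI / 2) PI (- PI)).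
      replace (-1 * PI + PI / 2) with (- (PI / 2)) in E1 by field.
      replace (-1 * - PI + PI / 2) with (3 * (PI / 2)) in E1 by field.
      rewrite <- E1 by ct.
      set (k := fun t => g (circle r t)).
      assert (Ek : forall t, h (-1 * t + PI / 2) = k t).
      { intros t. unfold h, k. replace (-1 * t + PI / 2) with (PI / 2 - t) by ring.
        rewrite sin_shift, cos_shift. f_equal. unfold circle, eit.
        apply injective_projections; simpl; ring. }
      assert (Ck : forall t, continuous k t).
      { intros t. apply (cts_comp (circle r) g); [| apply cts_circle, continuous_id].
        apply Hg. unfold disk, circle. rewrite Cmod_RtoC_mult, Cmod_eit. lra. }
      assert (I : forall a b, ex_RInt k a b)
        by (intros; apply ex_RInt_between; auto).
      rewrite (RInt_ext _ (fun t => -1 * k t)) by (intros; now rewrite Ek).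
      rewrite RInt_scalR by apply I.
      assert (E2 := RInt_periodic k (2 * PI) (- PI) Ck).
      replace (- PI + 2 * PI) with PI in E2 by ring.
      fold k. rewrite <- E2.
      + rewrite (RInt_swapR k PI (- PI)) by apply I. rring.
      + intros t. unfold k, circle, eit. now rewrite cos_add_2PI, sin_add_2PI.
    - intros p _. unfold H', W', h. assert (S := sin2_cos2 p). unfold Rsqr in S.
      replace (r * g (r * sin p, r * cos p)) with
        (r * g (r * sin p, r * cos p) * (sin p * sin p + cos p * cos p)) by (rewrite S; ring).
      rring. }
  rewrite <- E.
  apply (RInt_param_derive (fun u p => vprim g (u * sin p) (u * cos p) * (u * cos p)) H' (- rad) rad).
  - lra.
  - apply Rabs_def2 in Hr. lra.
  - intros u p Hu. assert (Hu' : Rabs u < rad) by (apply Rabs_def1; lra).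
    unfold H'.
    apply (is_derive_mult (fun u => vprim g (u * sin p) (u * cos p)) (fun u => u * cos p));
      [| | apply Rmult_comm].
    + apply (vprim_chain rad g gx (fun u => u * sin p) (fun u => u * cos p)); trivial.
      * now apply disk_polar.
      * auto_derive; trivial; ring.
      * auto_derive; trivial; ring.
    + auto_derive; trivial; ring.
  - intros u p Hu. apply CH'. apply Rabs_def1; lra.
  - intros u p Hu. assert (Hu' : Rabs u < rad) by (apply Rabs_def1; lra).
    apply cts_Rmult; [exact (continuous_fix_fst _ _ _ (CG u p Hu')) |].
    apply cts_Rmult; [apply continuous_const | apply continuous_cos].
Qed.

(** A vertical section contributes the difference of [vprim] at its two ends. Substituting
    [x = r sin p] gives the upper half circle, and the reflection [p -> PI - p] accounts for the
    lower one. *)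
Lemma RInt_disk_polar (rad r : R) (g : C -> R) :
  (forall z, disk rad z -> continuous g z) -> 0 < r < rad -> RInt_disk g r = polar_area g r.
Proof.
  intros Hg Hr. assert (HPI := PI_pos).
  set (s := fun x => sqrt (r ^ 2 - x ^ 2)).
  set (h := fun x => vprim g x (s x) - vprim g x (- s x)).
  assert (Bs : forall x, - r <= x <= r -> disk rad (x, s x)).
  { intros x Hx. unfold disk, Cmod. cbn [fst snd]. unfold s. rewrite pow2_sqrt by nra.
    replace (x ^ 2 + (r ^ 2 - x ^ 2)) with (r ^ 2) by ring. rewrite sqrt_pow2; lra. }
  assert (E1 : RInt_disk g r = RInt h (- r) r).
  { unfold RInt_disk. apply RInt_ext. intros x Hx. rewrite Rmin_left, Rmax_right in Hx by lra.
    fold (s x). specialize (Bs x ltac:(lra)).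
    assert (Hs : 0 <= s x) by apply sqrt_pos.
    assert (Cg : forall t, - s x <= t <= s x -> continuous (fun t => g (x, t)) t).
    { intros t Ht. apply (cts_comp (fun t => (x, t) : C) g).
      - apply Hg. apply (disk_coord rad x (s x)); trivial; [lra |].
        rewrite (Rabs_pos_eq (s x)) by exact Hs. apply Rabs_le. lra.
      - ct. }
    unfold h. rewrite !(vprim_RInt rad); trivial.
    2: { apply (disk_coord rad x (s x)); trivial; [lra |]. rewrite Rabs_Ropp. lra. }
    assert (I : forall a b, - s x <= a <= s x -> - s x <= b <= s x -> ex_RInt (fun t => g (x, t)) a b).
    { intros a b Ha Hb. apply ex_RInt_between.
      intros t Ht. apply Cg. unfold Rmin, Rmax in Ht. destruct Rle_dec; lra. }
    assert (C1 := RInt_ChaslesR (fun t => g (x, t)) (- s x) 0 (s x)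
      ltac:(apply I; lra) ltac:(apply I; lra)).
    assert (C2 := RInt_swapR (fun t => g (x, t)) 0 (- s x) ltac:(apply I; lra)).
    change (RInt (fun y : R => g (x, y)) (- s x) (s x) =
      RInt (fun t : R => g (x, t)) 0 (s x) - RInt (fun t : R => g (x, t)) 0 (- s x)). lra. }
  assert (Cs : forall x, continuous s x).
  { intros x. apply cts_sqrt, cts_Rminus; [apply continuous_const | apply cts_Rpow, continuous_id]. }
  assert (Ch : forall x, - r <= x <= r -> continuous h x).
  { intros x Hx. assert (B := Bs x Hx). apply cts_Rminus.
    - apply (cts_comp (fun x => (x, s x) : C) (fun z : C => vprim g (fst z) (snd z))).
      + now apply (vprim_cts rad).
      + ct.
    - apply (cts_comp (fun x => (x, - s x) : C) (fun z : C => vprim g (fst z) (snd z))).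
      + apply (vprim_cts rad); trivial. apply (disk_coord rad x (s x)); trivial; [lra |].
        rewrite Rabs_Ropp. lra.
      + ct. }
  set (k := fun p => vprim g (r * sin p) (r * cos p) * (r * cos p)).
  assert (Ck : forall p, continuous k p).
  { intros p. apply cts_Rmult; [| apply cts_Rmult; [apply continuous_const | apply continuous_cos]].
    apply (cts_comp (fun p => (r * sin p, r * cos p) : C) (fun z : C => vprim g (fst z) (snd z))).
    - apply (vprim_cts rad); trivial. apply disk_polar. rewrite Rabs_pos_eq; lra.
    - ct. }
  assert (I : forall a b, ex_RInt k a b)
    by (intros; apply ex_RInt_between; auto).
  assert (E2 := RInt_comp (V := R_CompleteNormedModule) h (fun p => r * sin p) (fun p => r * cos p)
    (- (PI / 2)) (PI / 2)).
  cbv beta in E2. rewrite sin_neg, sin_PI2, Rmult_1_r in E2.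
  replace (r * - (1)) with (- r) in E2 by ring.
  rewrite E1, <- E2; clear E2.
  - assert (E3 := RInt_comp_linR k (-1) PI (- (PI / 2)) (PI / 2) (I _ _)).
    replace (-1 * - (PI / 2) + PI) with (3 * (PI / 2)) in E3 by field.
    replace (-1 * (PI / 2) + PI) with (PI / 2) in E3 by field.
    assert (Ck2 : forall p, continuous (fun p => k (-1 * p + PI)) p).
    { intros p. apply (cts_comp (fun p => -1 * p + PI) k); [apply Ck |].
      apply cts_Rplus; [apply cts_Rmult; [apply continuous_const | apply continuous_id] |
        apply continuous_const]. }
    assert (E3' : RInt (fun p => k (-1 * p + PI)) (- (PI / 2)) (PI / 2) =
      RInt k (PI / 2) (3 * (PI / 2))).
    { rewrite (RInt_scalR (fun p => k (-1 * p + PI))), (RInt_swapR k (PI / 2)) in E3 by ct. lra. }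
    assert (E4 := RInt_ChaslesR k (- (PI / 2)) (PI / 2) (3 * (PI / 2))
      (I _ _) (I _ _)).
    unfold polar_area. fold k. rewrite <- E4, <- E3', <- RInt_plusR; [| apply I | ct].
    apply RInt_ext. intros p Hp. rewrite Rmin_left, Rmax_right in Hp by lra.
    assert (Hc : 0 <= cos p) by (apply cos_ge_0; lra).
    assert (Esp : s (r * sin p) = r * cos p).
    { unfold s. replace (r ^ 2 - (r * sin p) ^ 2) with ((r * cos p) ^ 2).
      - rewrite sqrt_pow2; trivial. nra.
      - assert (S := sin2_cos2 p). unfold Rsqr in S. nra. }
    unfold scal; simpl; unfold mult; simpl. unfold h, k. rewrite Esp.
    replace (-1 * p + PI) with (PI - p) by ring. rewrite sin_PI_x.
    assert (Ecos : cos (PI - p) = - cos p) by (rewrite cos_minus, cos_PI, sin_PI; ring).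
    rewrite Ecos. replace (r * - cos p) with (- (r * cos p)) by ring. rring.
  - intros p Hp. apply Ch. assert (SB := SIN_bound p). nra.
  - intros p _. split; [auto_derive; trivial; ring |].
    apply cts_Rmult; [apply continuous_const | apply continuous_cos].
Qed.

Definition jac (f : C -> C) (z : C) : R := Cmod (C_derive f z) ^ 2.

Definition jac_dx (f : C -> C) (z : C) : R :=
  2 * (Re (C_derive f z) * Re (C_derive (C_derive f) z) +
       Im (C_derive f z) * Im (C_derive (C_derive f) z)).

Lemma jac_cts (f : C -> C) (z : C) : hol 1 f -> disk 1 z -> continuous (jac f) z.
Proof.
  intros Hf Hz. apply cts_Rpow, cts_Cmod. apply (hol_cts 1); trivial. now apply hol_derive.
Qed.

Lemma jac_dx_cts (f : C -> C) (z : C) : hol 1 f -> disk 1 z -> continuous (jac_dx f) z.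
Proof.
  intros Hf Hz.
  assert (H1 : continuous (C_derive f) z) by (apply (hol_cts 1); trivial; now apply hol_derive).
  assert (H2 : continuous (C_derive (C_derive f)) z)
    by (apply (hol_cts 1); trivial; now apply hol_derive, hol_derive).
  apply cts_Rmult; [apply continuous_const |].
  apply cts_Rplus; apply cts_Rmult; now (apply cts_Re || apply cts_Im).
Qed.

Lemma pder_hline (u v : R) : pder (fun s => (s, v) : C) u 1.
Proof.
  apply pder_parts. simpl. split; [apply (is_derive_id u) | apply (is_derive_const v u)].
Qed.

Lemma jac_derive_x (f : C -> C) (u v : R) : hol 1 f -> disk 1 (u, v) ->
  is_derive (fun s => jac f (s, v)) u (jac_dx f (u, v)).
Proof.
  intros Hf Hz.
  assert (D : pder (fun s => C_derive f (s, v)) u (C_derive (C_derive f) (u, v))).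
  { eapply cd_eq; [apply (pder_comp (C_derive f) (fun s => (s, v) : C)) |].
    - now apply (hol_derive 1 f Hf).
    - apply pder_hline.
    - cring. }
  assert (D1 := pder_Re _ _ _ D). assert (D2 := pder_Im _ _ _ D).
  apply (is_derive_ext (fun s => Re (C_derive f (s, v)) * Re (C_derive f (s, v)) +
    Im (C_derive f (s, v)) * Im (C_derive f (s, v)))).
  - intros s. unfold jac. rewrite Cmod_sqr. rring.
  - assert (E := is_derive_plus _ _ _ _ _
      (is_derive_mult _ _ _ _ _ D1 D1 Rmult_comm) (is_derive_mult _ _ _ _ _ D2 D2 Rmult_comm)).
    unfold plus, mult in E; simpl in E.
    replace (jac_dx f (u, v)) with
      (Re (C_derive (C_derive f) (u, v)) * Re (C_derive f (u, v)) +
       Re (C_derive f (u, v)) * Re (C_derive (C_derive f) (u, v)) +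
       (Im (C_derive (C_derive f) (u, v)) * Im (C_derive f (u, v)) +
        Im (C_derive f (u, v)) * Im (C_derive (C_derive f) (u, v)))) by (unfold jac_dx; ring).
    exact E.
Qed.

Lemma A_polar (f : C -> C) (r : R) : hol 1 f -> 0 < r < 1 -> A r f = polar_area (jac f) r.
Proof.
  intros Hf Hr. apply (RInt_disk_polar 1 r (jac f)); [| exact Hr].
  intros z Hz. now apply jac_cts.
Qed.

Lemma area_derive (f : C -> C) (r : R) : hol 1 f -> Rabs r < 1 ->
  is_derive (polar_area (jac f)) r (r * RInt (fun t => jac f (circle r t)) 0 (2 * PI)).
Proof.
  intros Hf Hr. apply (polar_area_derive 1 (jac f) (jac_dx f)); trivial.
  - intros z Hz. now apply jac_cts.
  - intros z Hz. now apply jac_dx_cts.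
  - intros u v Hz. now apply jac_derive_x.
Qed.

(** * Green's formula on circles *)

Lemma disk_circle (rad r t : R) : Rabs r < rad -> disk rad (circle r t).
Proof. intros H. unfold disk, circle. rewrite Cmod_RtoC_mult, Cmod_eit. lra. Qed.

Lemma pder_radius (r t : R) : pder (fun u => circle u t) r (eit t).
Proof.
  eapply cd_eq; [apply pder_mult; [apply cd_id | apply cd_const] | cring].
Qed.

Lemma cts_circle2 (p : R * R) : continuous (fun p : R * R => circle (fst p) (snd p)) p.
Proof. apply cts_Cmult; [apply cts_RtoC, continuous_fst | apply cts_eit, continuous_snd]. Qed.

Lemma cts_comp_circle2 {V : UniformSpace} (rad : R) (g : C -> V) (r t : R) :
  (forall z, disk rad z -> continuous g z) -> Rabs r < rad ->
  continuous (fun p : R * R => g (circle (fst p) (snd p))) (r, t).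
Proof.
  intros Hg Hr. apply (cts_comp (fun p : R * R => circle (fst p) (snd p)) g); [| apply cts_circle2].
  apply Hg. now apply disk_circle.
Qed.

Lemma cts_comp_circle {V : UniformSpace} (rad : R) (g : C -> V) (r t : R) :
  (forall z, disk rad z -> continuous g z) -> Rabs r < rad ->
  continuous (fun t => g (circle r t)) t.
Proof.
  intros Hg Hr. apply (cts_comp (circle r) g); [| apply cts_circle, continuous_id].
  apply Hg. now apply disk_circle.
Qed.

(** On a circle the angular derivative of [f] is [i z f']. Hence [Re (moment f)] is Green's
    integrand [Im (conj f * df/dt)], and [Im (moment f)] is [-1/2] times the angular derivative of
    [|f|^2]. *)
Definition moment (f : C -> C) (z : C) : C := (Cconj (f z) * (z * C_derive f z))%C.

Lemma moment_cts (f : C -> C) (z : C) : hol 1 f -> disk 1 z -> continuous (moment f) z.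
Proof.
  intros Hf Hz. apply cts_Cmult; [apply cts_Cconj; now apply (hol_cts 1) |].
  apply cts_Cmult; [apply continuous_id |]. apply (hol_cts 1); trivial. now apply hol_derive.
Qed.

Lemma Cconj_mult_self (z : C) : (Cconj z * z)%C = RtoC (Cmod z ^ 2).
Proof. rewrite Cmod2_conj. ring. Qed.

(** [r] times the radial derivative [H'] is [2 r^2 |f'|^2 - i D], where [D] is the angular
    derivative of [moment f] and integrates to zero. Dividing by [r] needs [r <> 0]; at 0 mere
    differentiability is kept, for the sake of continuity. *)
Lemma moment_derive (f : C -> C) (r : R) : hol 1 f -> Rabs r < 1 ->
  exists l, pder (fun u => CInt (fun t => moment f (circle u t)) 0 (2 * PI)) r l /\
    (r <> 0 -> l = RtoC (2 * (r * RInt (fun t => jac f (circle r t)) 0 (2 * PI)))).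
Proof.
  intros Hf Hr. assert (Hf1 := hol_derive 1 f Hf). assert (Hf2 := hol_derive 1 _ Hf1).
  set (f1 := C_derive f) in *. set (f2 := C_derive f1) in *.
  set (H' := fun u t => (Cconj (f1 (circle u t) * eit t) * (circle u t * f1 (circle u t)) +
    Cconj (f (circle u t)) * (eit t * f1 (circle u t) + circle u t * (f2 (circle u t) * eit t)))%C).
  assert (C0 : forall z, disk 1 z -> continuous f z) by (intros; now apply (hol_cts 1)).
  assert (C1 : forall z, disk 1 z -> continuous f1 z) by (intros; now apply (hol_cts 1)).
  assert (C2 : forall z, disk 1 z -> continuous f2 z) by (intros; now apply (hol_cts 1)).
  assert (CH' : forall u t, Rabs u < 1 -> continuous (fun p : R * R => H' (fst p) (snd p)) (u, t)).
  { intros u t Hu. unfold H'.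
    assert (K0 := cts_comp_circle2 1 f u t C0 Hu). assert (K1 := cts_comp_circle2 1 f1 u t C1 Hu).
    assert (K2 := cts_comp_circle2 1 f2 u t C2 Hu). assert (K3 := cts_circle2 (u, t)).
    assert (K4 : continuous (fun p : R * R => eit (snd p)) (u, t)) by apply cts_eit, continuous_snd.
    apply cts_Cplus; apply cts_Cmult.
    - ct.
    - ct.
    - ct.
    - ct. }
  exists (CInt (H' r) 0 (2 * PI)). split.
  - apply (CInt_param_derive (fun u t => moment f (circle u t)) H' (-1) 1).
    + apply PI2_nonneg.
    + apply Rabs_def2 in Hr. lra.
    + intros u t Hu. assert (Hd : disk 1 (circle u t)) by (apply disk_circle, Rabs_def1; lra).
      unfold moment. eapply cd_eq; [apply pder_mult; [| apply pder_mult] |].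
      * apply pder_conj. apply (pder_comp f (fun u => circle u t)); [now apply Hf | apply pder_radius].
      * apply pder_radius.
      * apply (pder_comp f1 (fun u => circle u t)); [now apply Hf1 | apply pder_radius].
      * reflexivity.
    + intros u t Hu. apply CH'. apply Rabs_def1; lra.
    + intros u t Hu. apply (cts_comp_circle 1); [| apply Rabs_def1; lra].
      intros z Hz. now apply moment_cts.
  - intros Nr. set (J := RInt (fun t => jac f (circle r t)) 0 (2 * PI)).
    assert (CH : forall t, continuous (H' r) t) by (intros t; exact (continuous_fix_fst _ _ _ (CH' r t Hr))).
    set (D := fun t => (Cconj (f1 (circle r t) * (Ci * circle r t)) * (circle r t * f1 (circle r t)) +
      Cconj (f (circle r t)) * ((Ci * circle r t) * f1 (circle r t) +
        circle r t * (f2 (circle r t) * (Ci * circle r t))))%C).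
    assert (DD : forall t, pder (fun t => moment f (circle r t)) t (D t)).
    { intros t. assert (Hd : disk 1 (circle r t)) by now apply disk_circle.
      unfold moment. eapply cd_eq; [apply pder_mult; [| apply pder_mult] |].
      - apply pder_conj. apply (pder_comp f (circle r)); [now apply Hf | apply pder_circle].
      - apply pder_circle.
      - apply (pder_comp f1 (circle r)); [now apply Hf1 | apply pder_circle].
      - reflexivity. }
    assert (CD : forall t, continuous D t).
    { intros t. unfold D.
      assert (K0 := cts_comp_circle 1 f r t C0 Hr). assert (K1 := cts_comp_circle 1 f1 r t C1 Hr).
      assert (K2 := cts_comp_circle 1 f2 r t C2 Hr).
      apply cts_Cplus; apply cts_Cmult.
      - ct.
      - ct.
      - ct.
      - ct. }
    assert (ID : CInt D 0 (2 * PI) = 0).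
    { rewrite (CInt_FTC (fun t => moment f (circle r t))) by (auto using PI2_nonneg).
      rewrite circle_2PI. ring. }
    assert (CJ : forall t, continuous (fun t => RtoC (jac f (circle r t))) t).
    { intros t. apply cts_RtoC. apply (cts_comp_circle 1); [| exact Hr]. intros z Hz. now apply jac_cts. }
    assert (IJ : CInt (fun t => RtoC (jac f (circle r t))) 0 (2 * PI) = RtoC J).
    { unfold CInt, RtoC. simpl. f_equal. rewrite RInt_constR. rring. }
    assert (E : (RtoC r * CInt (H' r) 0 (2 * PI) = RtoC (2 * (r * r)) * RtoC J)%C).
    { rewrite <- IJ.
      replace (RtoC (2 * (r * r)) * CInt (fun t => RtoC (jac f (circle r t))) 0 (2 * PI))%C with
        (RtoC (2 * (r * r)) * CInt (fun t => RtoC (jac f (circle r t))) 0 (2 * PI) +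
         (- Ci) * CInt D 0 (2 * PI))%C by (rewrite ID; ring).
      rewrite <- !CInt_scal by auto using PI2_nonneg.
      rewrite <- CInt_plus.
      - apply CInt_ext. intros t. unfold H', D, jac. fold f1.
        assert (Hc : (Cconj (circle r t) * circle r t)%C = (RtoC (r * r))).
        { rewrite Cconj_mult_self. unfold circle. rewrite Cmod_RtoC_mult, Cmod_eit.
          f_equal. rewrite Rmult_1_r, <- Rsqr_pow2, <- Rsqr_abs. reflexivity. }
        assert (Hce : (RtoC r * eit t)%C = circle r t) by reflexivity.
        assert (Hce' : (RtoC r * Cconj (eit t))%C = Cconj (circle r t)).
        { unfold circle. rewrite Cmult_conj. f_equal. unfold Cconj, RtoC; simpl. f_equal. ring. }
        rewrite !Cmult_conj.
        assert (HCi : Cconj Ci = (- Ci)%C) by (unfold Cconj, Ci, Copp; simpl; f_equal; ring).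
        rewrite HCi.
        transitivity ((Cconj (f1 (circle r t)) * (RtoC r * Cconj (eit t)) * (circle r t * f1 (circle r t)) +
          Cconj (f (circle r t)) * ((RtoC r * eit t) * f1 (circle r t) +
            circle r t * (f2 (circle r t) * (RtoC r * eit t)))))%C; [ring |].
        rewrite Hce, Hce'.
        replace (RtoC (2 * (r * r)) * RtoC (Cmod (f1 (circle r t)) ^ 2))%C with
          (2 * (Cconj (circle r t) * circle r t) * (Cconj (f1 (circle r t)) * f1 (circle r t)))%C
          by (rewrite Hc, Cconj_mult_self, !RtoC_mult; ring).
        assert (HI : (Ci * Ci = - (1))%C) by (apply injective_projections; simpl; ring).
        set (c := circle r t). set (cc := Cconj c). set (a := f1 c). set (ca := Cconj a).
        set (b := f2 c). set (cf := Cconj (f c)).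
        transitivity (2 * (cc * c) * (ca * a) + (Ci * Ci) * (ca * cc * (c * a)) -
           (Ci * Ci) * (cf * (c * a + c * (b * c))))%C; [rewrite HI |]; ring.
      - intros t _. ct.
      - intros t _. ct. }
    assert (NR : RtoC r <> 0) by (intros K; now apply RtoC_inj in K).
    transitivity (/ RtoC r * (RtoC r * CInt (H' r) 0 (2 * PI)))%C; [field; exact NR |].
    rewrite E, !RtoC_mult. field. exact NR.
Qed.

Lemma moment_Im (f : C -> C) (r : R) : hol 1 f -> Rabs r < 1 ->
  RInt (fun t => Im (moment f (circle r t))) 0 (2 * PI) = 0.
Proof.
  intros Hf Hr.
  assert (D : forall t, is_derive (fun t => Re (Cconj (f (circle r t)) * f (circle r t))%C) t
    (-2 * Im (moment f (circle r t)))).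
  { intros t. assert (Hd : disk 1 (circle r t)) by now apply disk_circle.
    assert (D1 : pder (fun t => f (circle r t)) t (C_derive f (circle r t) * (Ci * circle r t))%C).
    { apply (pder_comp f (circle r)); [now apply Hf | apply pder_circle]. }
    assert (D2 := pder_Re _ _ _ (pder_mult _ _ _ _ _ (pder_conj _ _ _ D1) D1)). cbv beta in D2.
    replace (-2 * Im (moment f (circle r t))) with
      (Re (Cconj (C_derive f (circle r t) * (Ci * circle r t)) * f (circle r t) +
        Cconj (f (circle r t)) * (C_derive f (circle r t) * (Ci * circle r t)))%C); [exact D2 |].
    unfold moment. destruct (f (circle r t)) as [a b], (C_derive f (circle r t)) as [c d],
      (circle r t) as [x y]. simpl. ring. }
  assert (Cm : forall t, continuous (fun t => Im (moment f (circle r t))) t).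
  { intros t. apply (cts_Im (fun t => moment f (circle r t))). apply (cts_comp_circle 1); trivial.
    intros z Hz. now apply moment_cts. }
  assert (E := RInt_FTC _ _ 0 (2 * PI) PI2_nonneg (fun t _ => D t)).
  cbv beta in E. rewrite circle_2PI, Rminus_diag in E.
  assert (E2 : RInt (fun t => -2 * Im (moment f (circle r t))) 0 (2 * PI) =
    -2 * RInt (fun t => Im (moment f (circle r t))) 0 (2 * PI)).
  { apply (RInt_scalR (fun t => Im (moment f (circle r t)))).
    apply ex_RInt_cts; auto using PI2_nonneg. }
  rewrite E2 in E. assert (K : -2 * RInt (fun t => Im (moment f (circle r t))) 0 (2 * PI) = 0).
  { apply E. intros t _. apply cts_Rmult; [apply continuous_const | apply Cm]. }
  lra.
Qed.

(* Green's formula: [f] maps the circle to a curve enclosing twice the area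
   [Im (int conj f df) = int Re (conj f * z f') dt]. *)
Lemma area_green (f : C -> C) (r : R) : hol 1 f -> 0 <= r < 1 ->
  CInt (fun t => moment f (circle r t)) 0 (2 * PI) = RtoC (2 * polar_area (jac f) r).
Proof.
  intros Hf Hr.
  set (X := fun u => (CInt (fun t => moment f (circle u t)) 0 (2 * PI) - RtoC (2 * polar_area (jac f) u))%C).
  assert (D : forall u, Rabs u < 1 -> exists l, pder X u l /\ (u <> 0 -> l = 0)).
  { intros u Hu. destruct (moment_derive f u Hf Hu) as (l & Hl & E).
    eexists. split.
    - apply cd_minus; [exact Hl |]. apply pder_RtoC.
      apply (is_derive_scal (polar_area (jac f)) u 2). now apply area_derive.
    - intros Nu. rewrite (E Nu). ring. }
  assert (E : X r = X 0).
  { apply const_of_pder0; [lra | |].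
    - intros u Hu. destruct (D u ltac:(apply Rabs_def1; lra)) as (l & Hl & E).
      now rewrite E in Hl by lra.
    - intros u Hu. destruct (D u ltac:(apply Rabs_def1; lra)) as (l & Hl & _).
      exact (pder_cont _ _ _ Hl). }
  assert (E0 : X 0 = 0).
  { unfold X. rewrite polar_area_0, Rmult_0_r.
    rewrite (CInt_ext _ (fun _ => RtoC 0)).
    - rewrite CInt_const. ring.
    - intros t. unfold moment, circle. ring. }
  rewrite E0 in E. unfold X in E.
  replace (CInt (fun t => moment f (circle r t)) 0 (2 * PI)) with
    (CInt (fun t => moment f (circle r t)) 0 (2 * PI) - RtoC (2 * polar_area (jac f) r) +
     RtoC (2 * polar_area (jac f) r))%C by ring.
  rewrite E. ring.
Qed.

(** * The isoperimetric inequality *)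

Lemma nondecr_of_derive (g d : R -> R) (a b : R) : a <= b ->
  (forall t, a <= t <= b -> is_derive g t (d t)) -> (forall t, a <= t <= b -> 0 <= d t) -> g a <= g b.
Proof.
  intros Hab HD Hd. destruct (MVT_gen g a b d) as (c & Hc & E).
  - rewrite Rmin_left, Rmax_right by exact Hab. intros t Ht. apply HD. lra.
  - rewrite Rmin_left, Rmax_right by exact Hab. intros t Ht. apply continuity_pt_filterlim.
    eapply is_derive_continuous. now apply HD.
  - rewrite Rmin_left, Rmax_right in Hc by exact Hab. specialize (Hd c Hc). nra.
Qed.

Lemma derive_tan_ode (k u : R) : cos (k * u) <> 0 ->
  is_derive (fun u => - k * (sin (k * u) / cos (k * u))) u
    (- (k ^ 2 + (- k * (sin (k * u) / cos (k * u))) ^ 2)).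
Proof.
  intros Hc. auto_derive; [exact Hc |].
  set (s := sin (k * u)) in *. set (c := cos (k * u)) in *.
  apply Rmult_eq_reg_r with (c ^ 2); [| now apply pow_nonzero].
  transitivity (- k ^ 2 * (s * s + c * c)); [field; exact Hc |].
  transitivity (- k ^ 2 * c ^ 2 - k ^ 2 * s ^ 2); [ring |]. field. exact Hc.
Qed.

(* Completing the square against [y^2 * w], where [w = - k tan (k (phi - PI / 2))] solves the
   Riccati equation [w' = - (k^2 + w^2) phi']; for [k < 1] it is regular on the whole arc. *)
Lemma wirtinger_weighted (y y' phi phi' : R -> R) (a b : R) : a <= b ->
  (forall t, a <= t <= b -> is_derive y t (y' t)) -> (forall t, a <= t <= b -> continuous y' t) ->
  (forall t, a <= t <= b -> is_derive phi t (phi' t)) ->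
  (forall t, a <= t <= b -> continuous phi' t) ->
  (forall t, a <= t <= b -> 0 < phi' t) -> phi a = 0 -> phi b = PI -> y a = 0 -> y b = 0 ->
  RInt (fun t => y t ^ 2 * phi' t) a b <= RInt (fun t => y' t ^ 2 / phi' t) a b.
Proof.
  intros Hab Dy Cy' Dp Cp' Pp Ea Eb Ya Yb.
  assert (Cy : forall t, a <= t <= b -> continuous y t).
  { intros t Ht. eapply is_derive_continuous. now apply Dy. }
  assert (IX : ex_RInt (fun t => y t ^ 2 * phi' t) a b).
  { ct. }
  assert (IY : ex_RInt (fun t => y' t ^ 2 / phi' t) a b).
  { apply ex_RInt_cts; trivial. intros t Ht. apply cts_Rdiv; [| apply cts_Rpow |]; auto.
    specialize (Pp t Ht). lra. }
  set (X := RInt (fun t => y t ^ 2 * phi' t) a b) in *.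
  set (Y := RInt (fun t => y' t ^ 2 / phi' t) a b) in *.
  assert (HPI := PI_pos).
  assert (Rng : forall t, a <= t <= b -> 0 <= phi t <= PI).
  { intros t Ht. rewrite <- Ea at 1. rewrite <- Eb. split.
    - apply (nondecr_of_derive phi phi'); [lra | |]; intros s Hs; [apply Dp | left; apply Pp]; lra.
    - apply (nondecr_of_derive phi phi'); [lra | |]; intros s Hs; [apply Dp | left; apply Pp]; lra. }
  (* For [k < 1] the angle [k (phi - PI / 2)] stays strictly inside [(- PI / 2, PI / 2)], so the
     tangent has no pole even at the ends. *)
  assert (Main : forall k, 0 < k < 1 -> k ^ 2 * X <= Y).
  { intros k Hk.
    set (T := fun u => - k * (sin (k * u) / cos (k * u))).
    set (w := fun t => T (phi t - PI / 2)).
    assert (Hcos : forall t, a <= t <= b -> cos (k * (phi t - PI / 2)) <> 0).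
    { intros t Ht. specialize (Rng t Ht).
      assert (0 < cos (k * (phi t - PI / 2))); [| lra]. apply cos_gt_0; nra. }
    assert (Dw : forall t, a <= t <= b -> is_derive w t (- (k ^ 2 + w t ^ 2) * phi' t)).
    { intros t Ht. assert (H1 := derive_tan_ode k (phi t - PI / 2) (Hcos t Ht)).
      assert (H2 : is_derive (fun t => phi t - PI / 2) t (phi' t)).
      { replace (phi' t) with (phi' t - 0) by ring.
        apply (is_derive_minus phi (fun _ => PI / 2)); [now apply Dp | apply (is_derive_const (PI / 2) t)]. }
      assert (H3 := is_derive_comp _ (fun t => phi t - PI / 2) t _ _ H1 H2).
      unfold scal in H3; simpl in H3; unfold mult in H3; simpl in H3.
      unfold w, T. rewrite Rmult_comm. exact H3. }
    assert (Cw : forall t, a <= t <= b -> continuous w t).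
    { intros t Ht. eapply is_derive_continuous. now apply Dw. }
    set (D := fun t => 2 * y t * y' t * w t + y t ^ 2 * (- (k ^ 2 + w t ^ 2) * phi' t)).
    assert (DD : forall t, a <= t <= b -> is_derive (fun t => y t ^ 2 * w t) t (D t)).
    { intros t Ht.
      assert (H1 := is_derive_mult _ _ _ _ _ (is_derive_mult _ _ _ _ _ (Dy t Ht) (Dy t Ht) Rmult_comm)
        (Dw t Ht) Rmult_comm).
      unfold plus, mult in H1; simpl in H1.
      apply (is_derive_ext (fun t => y t * y t * w t)); [intros s; rring |].
      replace (D t) with ((y' t * y t + y t * y' t) * w t + y t * y t * (- (k ^ 2 + w t ^ 2) * phi' t))
        by (unfold D; ring). exact H1. }
    assert (CD : forall t, a <= t <= b -> continuous D t).
    { intros t Ht. unfold D. apply cts_Rplus.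
      - ct.
      - ct. }
    assert (ID : RInt D a b = 0).
    { rewrite (RInt_FTC (fun t => y t ^ 2 * w t) D) by trivial. rewrite Ya, Yb. rring. }
    assert (ID' : ex_RInt D a b) by now apply ex_RInt_cts.
    replace (k ^ 2 * X) with (1 * RInt D a b + k ^ 2 * X) by (rewrite ID; rring).
    unfold X. rewrite <- RInt_lin by trivial. apply RInt_le; trivial.
    - ct.
    - intros t Ht. assert (Ht' : a <= t <= b) by lra. specialize (Pp t Ht').
      unfold D. set (p := phi' t) in *.
      replace (1 * (2 * y t * y' t * w t + y t ^ 2 * (- (k ^ 2 + w t ^ 2) * p)) + k ^ 2 * (y t ^ 2 * p))
        with (y' t ^ 2 / p - (y' t - y t * p * w t) ^ 2 / p) by (field; lra).
      assert (0 <= (y' t - y t * p * w t) ^ 2 / p)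
        by (apply Rdiv_le_0_compat; [apply pow2_ge_0 | exact Pp]).
      lra. }
  apply Rnot_lt_le. intros Hbad.
  assert (Y0 : 0 <= Y).
  { specialize (Main (1 / 2) ltac:(lra)).
    assert (0 <= X); [| nra]. apply RInt_ge_0; trivial. intros t Ht.
    apply Rmult_le_pos; [apply pow2_ge_0 | left; apply Pp; lra]. }
  assert (X0 : 0 < X) by lra.
  (* Replaces the limit [k -> 1]: if [Y < X], then [q] lies strictly between [Y / X] and 1, and
     [k = sqrt q] violates [Main]. *)
  set (q := (1 + Y / X) / 2).
  assert (Hq : Y / X < 1).
  { apply Rmult_lt_reg_r with X; [exact X0 |]. unfold Rdiv. rewrite Rmult_assoc, Rinv_l; lra. }
  assert (Hq0 : 0 <= Y / X) by (apply Rdiv_le_0_compat; lra).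
  assert (Hs : 0 < sqrt q < 1).
  { split; [apply sqrt_lt_R0; unfold q; lra |]. rewrite <- sqrt_1. apply sqrt_lt_1_alt. unfold q; lra. }
  specialize (Main (sqrt q) Hs). rewrite pow2_sqrt in Main by (unfold q; lra).
  assert (E : Y / X * X = Y) by (field; lra). unfold q in Main. nra.
Qed.

(** [phi = k (S - S a)] is arc length rescaled to [[0, PI]]. Pointwise
    [- y x' <= (y^2 k s + x'^2 / (k s)) / 2], and [x'^2 = s^2 - y'^2]; Wirtinger's inequality
    cancels the terms in [y] and [y'], leaving [l / (2 k) = l^2 / (2 PI)]. *)
Lemma isoperimetric_arc (x y x' y' S s : R -> R) (a b : R) : a < b ->
  (forall t, a <= t <= b -> is_derive y t (y' t)) ->
  (forall t, a <= t <= b -> continuous x' t) -> (forall t, a <= t <= b -> continuous y' t) ->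
  (forall t, a <= t <= b -> is_derive S t (s t)) -> (forall t, a <= t <= b -> continuous s t) ->
  (forall t, a <= t <= b -> 0 < s t) ->
  (forall t, a <= t <= b -> x' t ^ 2 + y' t ^ 2 = s t ^ 2) -> y a = 0 -> y b = 0 ->
  - RInt (fun t => y t * x' t) a b <= (S b - S a) ^ 2 / (2 * PI).
Proof.
  intros Hab Dy Cx' Cy' DS Cs Ps Hs Ya Yb.
  assert (HPI := PI_pos).
  assert (Cy : forall t, a <= t <= b -> continuous y t).
  { intros t Ht. eapply is_derive_continuous. now apply Dy. }
  set (l := S b - S a).
  assert (Is : ex_RInt s a b) by ct.
  assert (El : RInt s a b = l) by (apply RInt_FTC; trivial; lra).
  assert (Hl : 0 < l).
  { rewrite <- El. apply RInt_gt_0; trivial.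
    intros t Ht. apply Ps. lra. }
  set (k := PI / l). assert (Hk : 0 < k) by (apply Rdiv_lt_0_compat; lra).
  assert (Ekl : k * l = PI) by (unfold k; field; lra).
  assert (W := wirtinger_weighted y y' (fun t => k * (S t - S a)) (fun t => k * s t) a b).
  assert (IX : ex_RInt (fun t => y t ^ 2 * (k * s t)) a b).
  { ct. }
  assert (IY : ex_RInt (fun t => y' t ^ 2 / (k * s t)) a b).
  { apply ex_RInt_cts; [lra |]. intros t Ht. specialize (Ps t Ht).
    apply cts_Rdiv; [nra | apply cts_Rpow; auto |]. apply cts_Rmult; [apply continuous_const | auto]. }
  assert (W' : RInt (fun t => y t ^ 2 * (k * s t)) a b <= RInt (fun t => y' t ^ 2 / (k * s t)) a b).
  { apply W; trivial.
    - lra.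
    - intros t Ht. apply (is_derive_scal (fun t => S t - S a) t k).
      replace (s t) with (s t - 0) by ring.
      apply (is_derive_minus S (fun _ => S a)); [now apply DS | apply (is_derive_const (S a) t)].
    - ct.
    - intros t Ht. specialize (Ps t Ht). nra.
    - ring. }
  clear W. set (X := RInt (fun t => y t ^ 2 * (k * s t)) a b) in *.
  set (Y := RInt (fun t => y' t ^ 2 / (k * s t)) a b) in *.
  assert (Ixy : ex_RInt (fun t => y t * x' t) a b).
  { ct. }
  (* The gap between the two integrands is [(y k s + x')^2 / (2 k s)]. *)
  assert (B : - RInt (fun t => y t * x' t) a b <= 1 / 2 * X + 1 * (/ (2 * k) * l + - (1 / 2) * Y)).
  { unfold X, Y. rewrite <- El.
    rewrite <- RInt_lin by trivial.
    rewrite <- RInt_lin; trivial.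
    2: { apply ex_RInt_cts; [lra |]. intros t Ht. specialize (Ps t Ht).
      apply cts_Rplus; apply cts_Rmult; try apply continuous_const; [auto |].
      apply cts_Rdiv; [nra | apply cts_Rpow; auto |]. apply cts_Rmult; [apply continuous_const | auto]. }
    replace (- RInt (fun t => y t * x' t) a b) with (-1 * RInt (fun t => y t * x' t) a b + 0 * RInt s a b)
      by ring.
    rewrite <- RInt_lin by trivial.
    apply RInt_le; [lra | | |].
    - ct.
    - apply ex_RInt_cts; [lra |]. intros t Ht. specialize (Ps t Ht).
      apply cts_Rplus; apply cts_Rmult; try apply continuous_const.
      + ct.
      + apply cts_Rplus; apply cts_Rmult; try apply continuous_const; [auto |].
        apply cts_Rdiv; [nra | apply cts_Rpow; auto |]. apply cts_Rmult; [apply continuous_const | auto].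
    - intros t Ht. assert (Ht' : a <= t <= b) by lra. specialize (Ps t Ht'). specialize (Hs t Ht').
      set (u := s t) in *.
      replace (1 / 2 * (y t ^ 2 * (k * u)) + 1 * (/ (2 * k) * u + - (1 / 2) * (y' t ^ 2 / (k * u)))) with
        (1 / 2 * (y t ^ 2 * (k * u) + (u ^ 2 - y' t ^ 2) / (k * u))) by (field; lra).
      rewrite <- Hs. replace (x' t ^ 2 + y' t ^ 2 - y' t ^ 2) with (x' t ^ 2) by ring.
      assert (Hku : 0 < k * u) by nra.
      assert (0 <= (y t * (k * u) + x' t) ^ 2 / (k * u))
        by (apply Rdiv_le_0_compat; [apply pow2_ge_0 | exact Hku]).
      replace ((y t * (k * u) + x' t) ^ 2 / (k * u)) with
        (y t ^ 2 * (k * u) + x' t ^ 2 / (k * u) + 2 * (y t * x' t)) in H by (field; lra).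
      lra. }
  replace (l ^ 2 / (2 * PI)) with (/ (2 * k) * l) by (rewrite <- Ekl; field; lra). lra.
Qed.

Lemma isoperimetric (g d : R -> C) :
  (forall t, pder g t (d t)) -> (forall t, continuous d t) -> (forall t, d t <> 0) ->
  g (2 * PI) = g 0 ->
  2 * PI * RInt (fun t => Im (Cconj (g t) * d t)%C) 0 (2 * PI) <=
    RInt (fun t => Cmod (d t)) 0 (2 * PI) ^ 2.
Proof.
  intros Dg Cd Nd Hper. assert (HPI := PI_pos).
  assert (Cg : forall t, continuous g t) by (intros t; exact (pder_cont _ _ _ (Dg t))).
  set (s := fun t => Cmod (d t)).
  assert (Cs : forall t, continuous s t) by (intros t; now apply cts_Cmod).
  assert (Ps : forall t, 0 < s t) by (intros t; now apply Cmod_gt_0).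
  set (S := (fun t => RInt s 0 t) : R -> R).
  assert (DS : forall t, is_derive S t (s t)).
  { intros t. apply (is_derive_RInt s S 0 t); [| apply Cs]. apply filter_forall. intros u.
    apply (RInt_correct (V := R_CompleteNormedModule)).
    apply ex_RInt_between. auto. }
  assert (S0 : S 0 = 0) by exact (RInt_point (V := R_CompleteNormedModule) 0 s).
  set (L := S (2 * PI)).
  assert (HL : 0 < L).
  { apply RInt_gt_0; auto. lra. }
  (* The cut point halves the arc length. *)
  destruct (IVT_gen S 0 (2 * PI) (L / 2)) as (th & Hth & Eth).
  { intros t. apply continuity_pt_filterlim. eapply is_derive_continuous. apply DS. }
  { rewrite S0. fold L. rewrite Rmin_left, Rmax_right; lra. }
  rewrite Rmin_left, Rmax_right in Hth by lra.
  assert (Hth' : 0 < th < 2 * PI).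
  { split; apply Rnot_le_lt; intros K.
    - assert (th = 0) by lra. subst th. lra.
    - assert (th = 2 * PI) by lra. subst th. fold L in Eth. lra. }
  (* [e] is the unit direction of the chord; if its two ends coincide, the direction is arbitrary
     and 1 is taken. *)
  assert (He : exists e, Cmod e = 1 /\ Im (Cconj e * (g th - g 0))%C = 0).
  { destruct (Ceq_dec (g th - g 0) 0) as [E | N].
    - exists 1. split; [apply Cmod_1 |]. rewrite E. simpl. ring.
    - assert (P := proj1 (Cmod_gt_0 _) N). set (c := (g th - g 0)%C) in *.
      exists (c * RtoC (/ Cmod c))%C. split.
      + rewrite Cmod_mult, Cmod_R, Rabs_pos_eq; [apply Rinv_r; lra |].
        left. now apply Rinv_0_lt_compat.
      + destruct c as [p q]. simpl. ring. }
  destruct He as (e & He1 & He2).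
  set (z := fun t => (Cconj e * (g t - g 0))%C). set (z' := fun t => (Cconj e * d t)%C).
  assert (Dz : forall t, pder z t (z' t)).
  { intros t. eapply cd_eq.
    - apply pder_mult; [apply cd_const |]. apply cd_minus; [apply Dg | apply cd_const].
    - unfold z'. cring. }
  assert (Cz' : forall t, continuous z' t)
    by (intros t; apply cts_Cmult; [apply continuous_const | apply Cd]).
  assert (Cz : forall t, continuous z t) by (intros t; exact (pder_cont _ _ _ (Dz t))).
  assert (z0 : z 0 = 0) by (unfold z; ring).
  assert (z2 : z (2 * PI) = 0) by (unfold z; rewrite Hper; ring).
  (* In coordinates with the chord on the real axis, [x y' - y x' = (x y)' - 2 y x'], and [x y]
     vanishes at both ends of the arc. *)
  assert (Arc : forall a b, a < b -> Im (z a) = 0 -> Im (z b) = 0 ->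
    RInt (fun t => Im (Cconj (z t) * z' t)%C) a b <= (S b - S a) ^ 2 / PI).
  { intros a b Hab Ha Hb.
    assert (B := isoperimetric_arc (fun t => Re (z t)) (fun t => Im (z t)) (fun t => Re (z' t))
      (fun t => Im (z' t)) S s a b Hab).
    assert (B' : - RInt (fun t => Im (z t) * Re (z' t)) a b <= (S b - S a) ^ 2 / (2 * PI)).
    { apply B; clear B.
      - intros t _. apply pder_Im, Dz.
      - ct.
      - ct.
      - intros t _. apply DS.
      - intros t _. apply Cs.
      - intros t _. apply Ps.
      - intros t _. rewrite <- Cmod_sqr. unfold z', s. now rewrite Cmod_mult, Cmod_conj, He1, Rmult_1_l.
      - exact Ha.
      - exact Hb. }
    assert (I1 : ex_RInt (fun t => Im (z t) * Re (z' t)) a b).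
    { ct. }
    set (D := fun t => Re (z' t) * Im (z t) + Re (z t) * Im (z' t)).
    assert (CD : forall t, continuous D t).
    { intros t. apply cts_Rplus; apply cts_Rmult; now (apply cts_Re || apply cts_Im). }
    assert (ID : RInt D a b = 0).
    { rewrite (RInt_FTC (fun t => Re (z t) * Im (z t)) D); auto; [| lra |].
      - rewrite Ha, Hb. rring.
      - intros t _. apply (is_derive_mult (fun t => Re (z t)) (fun t => Im (z t)));
          [apply pder_Re, Dz | apply pder_Im, Dz | apply Rmult_comm]. }
    rewrite (RInt_ext _ (fun t => 1 * D t + -2 * (Im (z t) * Re (z' t)))).
    - rewrite RInt_lin, ID; trivial; [| apply ex_RInt_cts; auto; lra].
      replace ((S b - S a) ^ 2 / PI) with (2 * ((S b - S a) ^ 2 / (2 * PI))) by (field; lra). lra.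
    - intros t _. unfold D. simpl. unfold Re, Im. rring. }
  assert (A1 := Arc 0 th ltac:(lra) ltac:(rewrite z0; reflexivity) He2).
  assert (A2 := Arc th (2 * PI) ltac:(lra) He2 ltac:(rewrite z2; reflexivity)).
  rewrite S0, Eth in A1. rewrite Eth in A2. fold L in A2.
  assert (Cm : forall t, continuous (fun t => Im (Cconj (z t) * z' t)%C) t).
  { ct. }
  assert (Im1 : forall a b, ex_RInt (fun t => Im (Cconj (z t) * z' t)%C) a b).
  { intros a b. apply ex_RInt_between. auto. }
  assert (Ch := RInt_ChaslesR _ 0 th (2 * PI) (Im1 _ _) (Im1 _ _)).
  assert (Tot : RInt (fun t => Im (Cconj (z t) * z' t)%C) 0 (2 * PI) <= L ^ 2 / (2 * PI)).
  { rewrite <- Ch. replace (L ^ 2 / (2 * PI)) with ((L / 2 - 0) ^ 2 / PI + (L - L / 2) ^ 2 / PI)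
      by (field; lra). apply Rplus_le_compat; assumption. }
  (* The rotation has modulus 1, and the translation contributes a multiple of the integral of [d],
     which vanishes on a closed curve. *)
  assert (Eq : RInt (fun t => Im (Cconj (z t) * z' t)%C) 0 (2 * PI) =
    RInt (fun t => Im (Cconj (g t) * d t)%C) 0 (2 * PI)).
  { assert (E : CInt (fun t => Cconj (z t) * z' t)%C 0 (2 * PI) =
      (CInt (fun t => Cconj (g t) * d t)%C 0 (2 * PI) - Cconj (g 0%R) * CInt d 0 (2 * PI))%C).
    { rewrite <- CInt_scal by auto using PI2_nonneg. rewrite <- CInt_minus.
      - apply CInt_ext. intros t. unfold z, z'. rewrite Cmult_conj, Cconj_conj.
        transitivity ((Cconj e * e) * (Cconj (g t - g 0%R) * d t))%C; [ring |].
        rewrite Cconj_mult_self, He1.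
        replace (Cconj (g t - g 0%R))%C with (Cconj (g t) - Cconj (g 0%R))%C
          by (apply injective_projections; simpl; ring).
        replace (RtoC (1 ^ 2)) with (RtoC 1) by (f_equal; ring). ring.
      - intros t _. apply cts_Cmult; [now apply cts_Cconj | apply Cd].
      - intros t _. apply cts_Cmult; [apply continuous_const | apply Cd]. }
    rewrite (CInt_FTC g d 0 (2 * PI)) in E by auto using PI2_nonneg.
    rewrite Hper in E. apply (f_equal Im) in E.
    etransitivity; [exact E |]. simpl. unfold Im, Re. ring. }
  rewrite Eq in Tot. change (RInt (fun t => Cmod (d t)) 0 (2 * PI)) with L.
  replace (L ^ 2) with (2 * PI * (L ^ 2 / (2 * PI))) by (field; lra).
  apply Rmult_le_compat_l; [lra | exact Tot].
Qed.

(** * Length and area *)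

Lemma L_circle (f : C -> C) (r : R) :
  L r f = RInt (fun t => r * Cmod (C_derive f (circle r t))) 0 (2 * PI).
Proof. apply RInt_ext. intros t _. now rewrite Cexp_Ci. Qed.

(** The isoperimetric inequality gives [4 PI A <= L^2]. It asks for a speed that never vanishes, and
    this is where univalence is used. *)
Lemma length_lower (lambda : R) (f : C -> C) (r : R) : spirallike lambda f -> 0 < r < 1 ->
  2 * sqrt (PI * A r f) <= L r f.
Proof.
  intros Hs Hr. assert (Hf := spirallike_hol lambda f Hs). assert (HPI := PI_pos).
  assert (Hrr : Rabs r < 1) by (apply Rabs_def1; lra).
  assert (C1 : forall z, disk 1 z -> continuous (C_derive f) z)
    by (intros; apply (hol_cts 1); trivial; now apply hol_derive).
  set (d := fun t => (C_derive f (circle r t) * (Ci * circle r t))%C).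
  assert (Hd : forall t, Cmod (d t) = r * Cmod (C_derive f (circle r t))).
  { intros t. unfold d. rewrite !Cmod_mult, Cmod_Ci, Cmod_circle by lra. ring. }
  assert (Cd : forall t, continuous d t).
  { intros t. apply cts_Cmult; [now apply (cts_comp_circle 1) |].
    apply cts_Cmult; [apply continuous_const | apply cts_circle, continuous_id]. }
  assert (I := isoperimetric (fun t => f (circle r t)) d).
  assert (I' : 2 * PI * RInt (fun t => Im (Cconj (f (circle r t)) * d t)%C) 0 (2 * PI) <=
    RInt (fun t => Cmod (d t)) 0 (2 * PI) ^ 2).
  { apply I; clear I.
    - intros t. apply (pder_comp f (circle r)); [| apply pder_circle]. now apply Hf, disk_circle.
    - exact Cd.
    - intros t K. assert (E := Hd t). rewrite K, Cmod_0 in E.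
      assert (P : 0 < Cmod (C_derive f (circle r t))).
      { apply Cmod_gt_0. apply univalent_derive_neq0; trivial; [apply Hs | now apply disk_circle]. }
      nra.
    - now rewrite circle_2PI. }
  assert (EL : RInt (fun t => Cmod (d t)) 0 (2 * PI) = L r f).
  { rewrite L_circle. apply RInt_ext. intros t _. apply Hd. }
  assert (EA : RInt (fun t => Im (Cconj (f (circle r t)) * d t)%C) 0 (2 * PI) = 2 * A r f).
  { assert (G := area_green f r Hf ltac:(lra)). apply (f_equal Re) in G.
    rewrite (A_polar f r Hf Hr). etransitivity; [| exact G].
    apply RInt_ext. intros t _. unfold moment, d. simpl. unfold Re, Im. rring. }
  rewrite EL, EA in I'.
  assert (HL : 0 <= L r f).
  { rewrite <- EL. apply RInt_ge_0; [apply PI2_nonneg | |].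
    - ct.
    - intros; apply Cmod_ge_0. }
  assert (S : sqrt (PI * A r f) <= L r f / 2); [| lra].
  rewrite <- (sqrt_pow2 (L r f / 2)) by lra. apply sqrt_le_1_alt. lra.
Qed.

(** * The principal logarithm on the right half-plane *)

(** The real part avoids [Cmod], and thereby a square root, so that [auto_derive] yields the partial
    derivatives directly. *)
Definition Clog (z : C) : C := (ln (Re z ^ 2 + Im z ^ 2) / 2, atan (Im z / Re z)).

Lemma cder_Clog (z : C) : 0 < Re z -> cder Clog z (/ z)%C.
Proof.
  intros Hz.
  assert (NZ : forall w : C, 0 < Re w -> w <> 0).
  { intros w Hw E. rewrite E in Hw. simpl in Hw. lra. }
  apply (cder_of_partials Clog (fun w => / w)%C).
  - apply cts_Cinv; [now apply NZ | apply continuous_id].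
  - assert (Lz : locally z (fun w => 0 < Re w)).
    { apply (continuous_Re z (fun x => 0 < x)). apply locally_R. exists (Re z).
      split; [exact Hz |]. intros y Hy. apply Rabs_def2 in Hy. lra. }
    revert Lz. apply filter_imp. intros [x y] Hx. simpl in Hx.
    assert (P : 0 < x ^ 2 + y ^ 2) by nra.
    split; apply pder_parts; unfold Clog; simpl; split.
    + auto_derive; [lra | field; nra].
    + auto_derive; [lra |]. unfold Rsqr. field. split; nra.
    + auto_derive; [lra | field; nra].
    + auto_derive; [lra |]. unfold Rsqr. field. split; nra.
Qed.

Lemma concave_nonneg (h h1 h2 : R -> R) (a b t : R) : a <= t <= b ->
  (forall s, a <= s <= b -> is_derive h s (h1 s)) ->
  (forall s, a <= s <= b -> is_derive h1 s (h2 s)) ->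
  (forall s, a <= s <= b -> h2 s <= 0) -> 0 <= h a -> 0 <= h b -> 0 <= h t.
Proof.
  intros Ht D1 D2 Hneg Ha Hb. apply Rnot_lt_le. intros Hbad.
  assert (MVT : forall u v, a <= u -> u < v -> v <= b -> exists c, u <= c <= v /\ h v - h u = h1 c * (v - u)).
  { intros u v Hu Huv Hv. destruct (MVT_gen h u v h1) as (c & Hc & E);
      rewrite ?Rmin_left, ?Rmax_right in * by lra.
    - intros s Hs. apply D1. lra.
    - intros s Hs. apply continuity_pt_filterlim.
      eapply is_derive_continuous. apply D1. lra.
    - now exists c. }
  assert (a <> t) by (intros ->; lra). assert (t <> b) by (intros ->; lra).
  destruct (MVT a t) as (c1 & Hc1 & E1); try lra.
  destruct (MVT t b) as (c2 & Hc2 & E2); try lra.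
  assert (M : h1 c2 <= h1 c1).
  { apply Ropp_le_cancel. apply (nondecr_of_derive (fun s => - h1 s) (fun s => - h2 s)); [lra | |].
    - intros s Hs. apply (is_derive_opp h1 s). apply D2. lra.
    - intros s Hs. assert (K := Hneg s ltac:(lra)). lra. }
  assert (h1 c1 < 0) by nra. assert (0 < h1 c2) by nra. lra.
Qed.

(** The tangent lies below its chord on [[0, PI / 4]]. Multiplied by the cosine, the difference is
    concave and vanishes at both ends. *)
Lemma sin_le_chord (b : R) : 0 <= b <= PI / 4 -> sin b <= 4 / PI * b * cos b.
Proof.
  intros Hb. assert (HPI := PI_pos). assert (HPI4 := PI_4).
  assert (K : 0 <= 4 / PI * b * cos b - sin b); [| lra].
  apply (concave_nonneg (fun b => 4 / PI * b * cos b - sin b)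
    (fun b => 4 / PI * (cos b - b * sin b) - cos b)
    (fun b => 4 / PI * (- 2 * sin b - b * cos b) + sin b) 0 (PI / 4)); trivial.
  - intros s _. auto_derive; trivial. ring.
  - intros s _. auto_derive; trivial. ring.
  - intros s Hs. assert (S1 : 0 <= sin s) by (apply sin_ge_0; lra).
    assert (S2 : 0 <= cos s) by (apply cos_ge_0; lra).
    assert (Q : 1 <= 4 / PI).
    { apply Rmult_le_reg_r with PI; [exact HPI |]. unfold Rdiv. rewrite Rmult_assoc, Rinv_l; lra. }
    assert (0 <= s * cos s) by (apply Rmult_le_pos; lra). nra.
  - rewrite sin_0. lra.
  - rewrite cos_PI4, sin_PI4. apply Req_le. assert (S2 : 0 < sqrt 2) by (apply sqrt_lt_R0; lra).
    field. split; lra.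
Qed.

(** With [a = 2 b], [1 - cos a = 2 sin^2 b] and [sin a = 2 sin b cos b], so the claim is
    [sin_le_chord] multiplied by [2 sin b]. *)
Lemma one_le_cos_arg (a : R) : 0 <= a <= PI / 2 -> 1 <= cos a + 2 / PI * a * sin a.
Proof.
  intros Ha. assert (HPI := PI_pos).
  assert (B := sin_le_chord (a / 2) ltac:(lra)).
  assert (S : 0 <= sin (a / 2)) by (apply sin_ge_0; lra).
  replace a with (2 * (a / 2)) at 1 3 by field. rewrite cos_2a_sin, sin_2a.
  replace (2 / PI * a) with (4 / PI * (a / 2)) by (field; lra). nra.
Qed.

(** [one_le_cos_arg] at the argument of [z], scaled by the modulus. Both sides are even in the
    argument, which settles negative ones. *)
Lemma Cmod_le_arg (z : C) : 0 < Re z ->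
  Cmod z <= Re z + 2 / PI * (Im z * atan (Im z / Re z)).
Proof.
  intros Hz. destruct z as [u v]. unfold Re, Im in *. cbn [fst snd] in *.
  set (x := v / u). assert (Ev : v = u * x) by (unfold x; field; lra).
  assert (Hm : Cmod (u, v) = u * sqrt (1 + x²)).
  { unfold Cmod. cbn [fst snd]. rewrite Ev. unfold Rsqr.
    replace (u ^ 2 + (u * x) ^ 2) with (u ^ 2 * (1 + x * x)) by ring.
    rewrite sqrt_mult, sqrt_pow2 by nra. reflexivity. }
  assert (Hs : 0 < sqrt (1 + x²)) by (apply sqrt_lt_R0; assert (H := Rle_0_sqr x); lra).
  assert (K : 1 <= cos (atan x) + 2 / PI * atan x * sin (atan x)).
  { destruct (Rle_dec 0 (atan x)) as [H | H].
    - apply one_le_cos_arg. split; [exact H |]. left. apply atan_bound.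
    - assert (K := one_le_cos_arg (- atan x)). rewrite cos_neg, sin_neg in K.
      assert (B := atan_bound x). specialize (K ltac:(lra)). lra. }
  rewrite cos_atan, sin_atan in K. rewrite Hm, Ev.
  apply Rmult_le_compat_l with (r := u * sqrt (1 + x²)) in K; [| apply Rmult_le_pos; lra].
  replace (u * sqrt (1 + x²) * (1 / sqrt (1 + x²) + 2 / PI * atan x * (x / sqrt (1 + x²)))) with
    (u + 2 / PI * (u * x * atan x)) in K; [lra |].
  assert (HPI := PI_pos). field. split; lra.
Qed.

(** By parity [lambda = s >= 0]. Up to [s = PI / 2 - 1] the bounds [sin s <= 1] and [cos s <= 1]
    suffice; beyond it [cos s <= PI / 2 - s] gives an upper bound decreasing in [s]. Both estimates
    equal [4 (PI - 1)] at the break point. *)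
Lemma spiral_constant (lambda : R) : - (PI / 2) < lambda < PI / 2 ->
  4 * (lambda * sin lambda) + 2 * PI * cos lambda <= 4 * (PI - 1).
Proof.
  assert (Main : forall s, 0 <= s <= PI / 2 -> 4 * (s * sin s) + 2 * PI * cos s <= 4 * (PI - 1)).
  { intros s Hs. assert (SB := SIN_bound s). assert (CB := COS_bound s).
    destruct (Rle_dec s (PI / 2 - 1)) as [H | H]; [nra |].
    assert (C1 : cos s <= PI / 2 - s).
    { rewrite <- sin_shift. set (d := PI / 2 - s).
      destruct (Req_dec d 0) as [-> | N]; [rewrite sin_0; lra |].
      left. apply sin_lt_x. unfold d in *. lra. }
    assert (H2 := PI2_1). nra. }
  intros Hl. destruct (Rle_dec 0 lambda) as [H | H].
  - apply Main. lra.
  - specialize (Main (- lambda) ltac:(lra)). rewrite sin_neg, cos_neg in Main. lra.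
Qed.

(* The mean of [Re (Q log Q)] over the circle is its value at 0, and
   [(PI / 2) (|q| - Re q) <= Im q * arg q] pointwise. *)
Lemma spiral_quotient_mean (lambda : R) (f : C -> C) (r : R) : - (PI / 2) < lambda < PI / 2 ->
  spirallike lambda f -> 0 < r < 1 ->
  RInt (fun t => Cmod (spiral_quotient lambda f (circle r t))) 0 (2 * PI) <=
    4 * (cos lambda * ln ((1 + r) / (1 - r))) + 4 * (lambda * sin lambda) + 2 * PI * cos lambda.
Proof.
  intros Hl Hs Hr. assert (HPI := PI_pos).
  assert (Hcos : 0 < cos lambda) by (apply cos_gt_0; lra).
  assert (Hrr : Rabs r < 1) by (apply Rabs_def1; lra).
  set (Q := spiral_quotient lambda f).
  assert (HQ : hol 1 Q) by now apply spiral_quotient_hol.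
  assert (PQ : forall z, disk 1 z -> 0 < Re (Q z)) by (intros; now apply spiral_quotient_Re).
  assert (Q0 : Q 0 = Cconj (eit lambda)) by now apply spiral_quotient_0.
  set (W := fun z => (Q z * Clog (Q z))%C).
  assert (HW : hol 1 W).
  { apply hol_intro. intros z Hz. eexists. apply cder_mult; [now apply HQ |].
    apply (cder_comp Clog Q); [| now apply HQ]. now apply cder_Clog, PQ. }
  assert (MQ := mean_value_property 1 r Q HQ ltac:(lra)).
  assert (MW := mean_value_property 1 r W HW ltac:(lra)).
  apply (f_equal Re) in MQ. apply (f_equal Re) in MW.
  assert (E0 : Re (RtoC (2 * PI) * Q 0)%C = 2 * PI * cos lambda).
  { rewrite Q0. simpl. ring. }
  (* [Q 0 = e^(-i lambda)] has logarithm [-i lambda], and [Re (e^(-i lambda) * (-i lambda)) = -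
     lambda sin lambda]. *)
  assert (EW : Re (RtoC (2 * PI) * W 0)%C = 2 * PI * (- (lambda * sin lambda))).
  { unfold W. rewrite Q0. unfold Clog, eit, Cconj. simpl.
    replace (cos lambda * (cos lambda * 1) + - sin lambda * (- sin lambda * 1)) with 1.
    - rewrite ln_1. replace (- sin lambda / cos lambda) with (- tan lambda) by (unfold tan; field; lra).
      rewrite atan_opp, atan_tan by lra. field.
    - assert (S := sin2_cos2 lambda). unfold Rsqr in S. lra. }
  rewrite E0 in MQ. rewrite EW in MW. unfold CInt in MQ, MW. cbn [Re fst] in MQ, MW.
  change (RInt (fun t => Re (Q (circle r t))) 0 (2 * PI) = 2 * PI * cos lambda) in MQ.
  change (RInt (fun t => Re (W (circle r t))) 0 (2 * PI) = 2 * PI * (- (lambda * sin lambda))) in MW.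
  set (Lam := ln ((1 + r) / (1 - r))).
  assert (CQ : forall t, continuous (fun t => Q (circle r t)) t).
  { intros t. apply (cts_comp_circle 1); trivial. intros z Hz. now apply (hol_cts 1). }
  assert (CW : forall t, continuous (fun t => W (circle r t)) t).
  { intros t. apply (cts_comp_circle 1); trivial. intros z Hz. now apply (hol_cts 1). }
  assert (IQ : ex_RInt (fun t => Re (Q (circle r t))) 0 (2 * PI)).
  { ct. }
  assert (IW : ex_RInt (fun t => Re (W (circle r t))) 0 (2 * PI)).
  { ct. }
  (* The bound is a combination of the means of [Re Q] and [Re W], so the claim reduces to [|q| <=
     (1 + 2 / PI * Lam) Re q - 2 / PI * Re (q log q)] pointwise. *)
  replace (4 * (cos lambda * Lam) + 4 * (lambda * sin lambda) + 2 * PI * cos lambda) with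
    ((1 + 2 / PI * Lam) * (2 * PI * cos lambda) + (- (2 / PI)) * (2 * PI * (- (lambda * sin lambda))))
    by (field; lra).
  rewrite <- MQ, <- MW, <- RInt_lin by trivial.
  apply RInt_le; [apply PI2_nonneg | | |].
  - ct.
  - ct.
  - intros t _. assert (Hd : disk 1 (circle r t)) by now apply disk_circle.
    assert (P := PQ _ Hd). assert (B := Cmod_le_arg _ P).
    (* As [|Q 0| = 1], the growth bound is exactly [(1 + r) / (1 - r)], and its logarithm is
       [Lam]. *)
    assert (G := caratheodory_growth Q (circle r t) HQ
      (fun z Hz => Rlt_le _ _ (PQ z Hz)) (PQ 0 disk1_0) Hd).
    rewrite Q0, Cmod_conj, Cmod_eit, Cmod_circle, Rmult_1_l in G by lra.
    unfold W. set (q := Q (circle r t)) in *.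
    assert (Pq : 0 < Cmod q).
    { eapply Rlt_le_trans; [exact P |]. eapply Rle_trans; [apply Rle_abs | apply Re_le_Cmod]. }
    assert (EL : ln (Re q ^ 2 + Im q ^ 2) / 2 = ln (Cmod q)).
    { rewrite <- Cmod_sqr. replace (Cmod q ^ 2) with (Cmod q * Cmod q) by ring.
      rewrite ln_mult by exact Pq. field. }
    assert (HL : ln (Cmod q) <= Lam).
    { unfold Lam. destruct G as [G | G]; [left; now apply ln_increasing | rewrite G; lra]. }
    assert (ERe : Re (q * Clog q)%C = Re q * ln (Cmod q) - Im q * atan (Im q / Re q)).
    { unfold Clog. rewrite EL. reflexivity. }
    rewrite ERe.
    assert (K : Re q * ln (Cmod q) <= Re q * Lam) by (apply Rmult_le_compat_l; lra).
    assert (HP : 0 < 2 / PI) by (apply Rdiv_lt_0_compat; lra). nra.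
Qed.

(** * The weighted mean of |Q| and its growth with the radius *)

Lemma nondecr_of_derive_open (g d : R -> R) (a b : R) : a <= b ->
  (forall t, a < t < b -> is_derive g t (d t)) -> (forall t, a < t < b -> 0 <= d t) ->
  (forall t, a <= t <= b -> continuous g t) -> g a <= g b.
Proof.
  intros Hab HD Hd HC.
  (* The mean value theorem may return an endpoint, where nothing is known about [d]; there the
     value 0 is put in its place. *)
  set (e := fun t => if Rlt_dec a t then if Rlt_dec t b then d t else 0 else 0).
  assert (E : forall t, a < t < b -> e t = d t).
  { intros t Ht. unfold e. destruct (Rlt_dec a t); [destruct (Rlt_dec t b) |]; trivial; lra. }
  assert (He : forall t, 0 <= e t).
  { intros t. unfold e. destruct (Rlt_dec a t); [destruct (Rlt_dec t b) |]; try lra. apply Hd. lra. }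
  destruct (MVT_gen g a b e) as (c & _ & EQ).
  - rewrite Rmin_left, Rmax_right by exact Hab. intros t Ht. rewrite E by exact Ht. now apply HD.
  - rewrite Rmin_left, Rmax_right by exact Hab. intros t Ht. apply continuity_pt_filterlim. now apply HC.
  - specialize (He c). nra.
Qed.

Lemma derive_Cmod (g : R -> C) (t : R) (d : C) : pder g t d -> g t <> 0 ->
  is_derive (fun u => Cmod (g u)) t (Re (Cconj (g t) * d)%C / Cmod (g t)).
Proof.
  intros D N. assert (P := proj1 (Cmod_gt_0 _) N).
  assert (D1 := pder_Re _ _ _ D). assert (D2 := pder_Im _ _ _ D).
  assert (E := is_derive_plus _ _ _ _ _
      (is_derive_mult _ _ _ _ _ D1 D1 Rmult_comm) (is_derive_mult _ _ _ _ _ D2 D2 Rmult_comm)).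
  unfold plus, mult in E; simpl in E.
  assert (Ep : forall u, Re (g u) * Re (g u) + Im (g u) * Im (g u) = Cmod (g u) ^ 2)
    by (intros u; rewrite Cmod_sqr; ring).
  assert (F : is_derive sqrt (Cmod (g t) ^ 2) (/ (2 * Cmod (g t)))).
  { auto_derive; [now apply pow_lt |]. rewrite sqrt_pow2 by lra. field. lra. }
  rewrite <- Ep in F at 1.
  assert (G := is_derive_comp sqrt (fun u => Re (g u) * Re (g u) + Im (g u) * Im (g u)) t _ _ F E).
  unfold scal in G; simpl in G; unfold mult in G; simpl in G.
  apply (is_derive_ext (fun u => sqrt (Re (g u) * Re (g u) + Im (g u) * Im (g u)))).
  - intros u. rewrite Ep. apply sqrt_pow2, Cmod_ge_0.
  - replace (Re (Cconj (g t) * d)%C / Cmod (g t)) with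
      ((Re d * Re (g t) + Re (g t) * Re d + (Im d * Im (g t) + Im (g t) * Im d)) * / (2 * Cmod (g t)));
      [exact G |].
    simpl. unfold Re, Im. field. lra.
Qed.

(* Differentiating [int |f^2 Q|] in the radius: [2 |f f' Q| = 2 rho |f'|^2] integrates to the area,
   and [|Q'| <= 2 Re Q / (1 - rho^2)] leaves [int |f|^2 Re Q = 2 A cos lambda]. *)
Lemma spiral_weighted_mean (lambda : R) (f : C -> C) (r : R) : - (PI / 2) < lambda < PI / 2 ->
  spirallike lambda f -> 0 < r < 1 ->
  0 < A r f /\
  RInt (fun t => Cmod (f (circle r t) * (circle r t * C_derive f (circle r t)))%C) 0 (2 * PI) <=
    A r f * (2 + 2 * (cos lambda * ln ((1 + r) / (1 - r)))).
Proof.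
  intros Hl Hs Hr. assert (HPI := PI_pos).
  assert (Hf := spirallike_hol lambda f Hs). assert (Hf1 := hol_derive 1 f Hf).
  assert (Hcos : 0 < cos lambda) by (apply cos_gt_0; lra).
  set (Q := spiral_quotient lambda f).
  assert (HQ : hol 1 Q) by now apply spiral_quotient_hol.
  assert (PQ : forall z, disk 1 z -> 0 < Re (Q z)) by (intros; now apply spiral_quotient_Re).
  assert (QE : forall z, disk 1 z -> (z * C_derive f z = eit lambda * f z * Q z)%C)
    by (intros; now apply spiral_quotient_eq).
  assert (Hf0 : forall z, disk 1 z -> z <> 0 -> f z <> 0).
  { intros z Hz Nz E. destruct Hs as (_ & f0 & Hi & _). apply Nz. apply Hi; trivial.
    - exact disk1_0.
    - now rewrite E, f0. }
  set (a := polar_area (jac f)).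
  (* [moment f = e^(i lambda) |f|^2 Q]. Its imaginary part has mean zero on circles, so the mean of
     [|f|^2 Re Q] is [cos lambda] times Green's integral. *)
  assert (Weight : forall z, disk 1 z ->
    Cmod (f z) ^ 2 * Re (Q z) = cos lambda * Re (moment f z) + sin lambda * Im (moment f z)).
  { intros z Hz. unfold moment. rewrite (QE z Hz).
    replace (Cconj (f z) * (eit lambda * f z * Q z))%C with (eit lambda * (RtoC (Cmod (f z) ^ 2) * Q z))%C
      by (rewrite <- Cconj_mult_self; ring).
    destruct (Q z) as [x y]. set (m := Cmod (f z) ^ 2). unfold eit. simpl.
    assert (S := sin2_cos2 lambda). unfold Rsqr in S.
    transitivity (m * x * (sin lambda * sin lambda + cos lambda * cos lambda)); [rewrite S |]; ring. }
  assert (IM : forall u, 0 <= u < 1 -> RInt (fun t => Cmod (f (circle u t)) ^ 2 * Re (Q (circle u t))) 0 (2 * PI)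
    = 2 * a u * cos lambda).
  { intros u Hu. assert (Hu' : Rabs u < 1) by (apply Rabs_def1; lra).
    assert (Cm : forall t, continuous (fun t => moment f (circle u t)) t).
    { intros t. apply (cts_comp_circle 1); trivial. intros z Hz. now apply moment_cts. }
    rewrite (RInt_ext _ (fun t => cos lambda * Re (moment f (circle u t)) +
      sin lambda * Im (moment f (circle u t)))).
    - rewrite RInt_lin.
      + rewrite (moment_Im f u Hf Hu'). assert (G := area_green f u Hf Hu). apply (f_equal Re) in G.
        change (RInt (fun t => Re (moment f (circle u t))) 0 (2 * PI) = 2 * a u) in G.
        rewrite G. rring.
      + ct.
      + ct.
    - intros t _. apply Weight. now apply disk_circle. }
  assert (C0 : forall z, disk 1 z -> continuous f z) by (intros; now apply (hol_cts 1)).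
  assert (C1 : forall z, disk 1 z -> continuous (C_derive f) z) by (intros; now apply (hol_cts 1)).
  assert (CQ : forall z, disk 1 z -> continuous Q z) by (intros; now apply (hol_cts 1)).
  assert (CWt : forall u t, Rabs u < 1 -> continuous (fun t => Cmod (f (circle u t)) ^ 2 * Re (Q (circle u t))) t).
  { intros u t Hu. apply cts_Rmult.
    - apply cts_Rpow, (cts_Cmod (fun t => f (circle u t))). now apply (cts_comp_circle 1).
    - apply (cts_Re (fun t => Q (circle u t))). now apply (cts_comp_circle 1). }
  (* The mean just computed is that of a positive function, which makes the area positive. *)
  assert (Apos : forall u, 0 < u < 1 -> 0 < a u).
  { intros u Hu. assert (Hu' : Rabs u < 1) by (apply Rabs_def1; lra).
    assert (P : 0 < 2 * a u * cos lambda); [| nra].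
    rewrite <- (IM u) by lra. apply RInt_gt_0; [lra | |].
    - intros t _. assert (Hd : disk 1 (circle u t)) by now apply disk_circle.
      apply Rmult_lt_0_compat; [| now apply PQ]. apply pow_lt, Cmod_gt_0, Hf0; trivial.
      intros E. assert (H : Cmod (circle u t) = u) by (apply Cmod_circle; lra).
      rewrite E, Cmod_0 in H. lra.
    - auto. }
  rewrite (A_polar f r Hf Hr). fold a. split; [now apply Apos |].
  set (F := fun z => (f z * (z * C_derive f z))%C).
  (* Near [z] the function [F] is [e^(i lambda) f^2 Q]. Differentiating this form brings in [Q'],
     which is controlled by [Re Q], in place of the second derivative of [f]. *)
  assert (DF : forall z, disk 1 z -> cder F z
    (eit lambda * (2 * (f z * C_derive f z * Q z) + f z * f z * C_derive Q z))%C).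
  { intros z Hz. apply (cd_ext_loc _ (fun z => eit lambda * (f z * f z * Q z))%C).
    - generalize (disk_open 1 z Hz). apply filter_imp. intros w Hw. unfold F.
      rewrite (QE w Hw). cring.
    - eapply cd_eq.
      + apply cder_mult; [apply cd_const |]. apply cder_mult; [apply cder_mult |];
          [apply Hf | apply Hf | apply HQ]; exact Hz.
      + cring. }
  set (F' := fun z => (eit lambda * (2 * (f z * C_derive f z * Q z) + f z * f z * C_derive Q z))%C) in *.
  assert (CF : forall z, disk 1 z -> continuous F z)
    by (intros z Hz; exact (cder_cont _ _ _ (DF z Hz))).
  assert (CF' : forall z, disk 1 z -> continuous F' z).
  { intros z Hz. assert (CQ' : continuous (C_derive Q) z)
      by (apply (hol_cts 1); trivial; now apply hol_derive).
    apply cts_Cmult; [apply continuous_const |]. apply cts_Cplus.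
    - ct.
    - ct. }
  set (N := fun u => RInt (fun t => Cmod (F (circle u t))) 0 (2 * PI)).
  set (N1 := fun u t => Re (Cconj (F (circle u t)) * (F' (circle u t) * eit t))%C / Cmod (F (circle u t))).
  assert (NF : forall u t, 0 < u < 1 -> F (circle u t) <> 0).
  { intros u t Hu. assert (Hd : disk 1 (circle u t)) by (apply disk_circle, Rabs_def1; lra).
    assert (Nc : circle u t <> 0).
    { intros E. assert (H : Cmod (circle u t) = u) by (apply Cmod_circle; lra).
      rewrite E, Cmod_0 in H. lra. }
    unfold F. apply Cmult_neq_0; [now apply Hf0 |]. apply Cmult_neq_0; [exact Nc |].
    apply univalent_derive_neq0; trivial. apply Hs. }
  assert (CN1 : forall u t, 0 < u < 1 -> continuous (fun p : R * R => N1 (fst p) (snd p)) (u, t)).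
  { intros u t Hu. assert (Hu' : Rabs u < 1) by (apply Rabs_def1; lra).
    assert (K1 := cts_comp_circle2 1 F u t CF Hu'). assert (K2 := cts_comp_circle2 1 F' u t CF' Hu').
    apply cts_Rdiv.
    - apply Rgt_not_eq, Cmod_gt_0. now apply NF.
    - apply (cts_Re (fun p : R * R => Cconj (F (circle (fst p) (snd p))) *
        (F' (circle (fst p) (snd p)) * eit (snd p)))%C).
      apply cts_Cmult; [now apply cts_Cconj |]. apply cts_Cmult; [exact K2 | apply cts_eit, continuous_snd].
    - ct. }
  assert (DN : forall u, 0 < u < 1 -> is_derive N u (RInt (N1 u) 0 (2 * PI))).
  { intros u Hu. apply (RInt_param_derive (fun u t => Cmod (F (circle u t))) N1 0 1);
      trivial using PI2_nonneg.
    - intros v t Hv. assert (Hd : disk 1 (circle v t)) by (apply disk_circle, Rabs_def1; lra).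
      apply (derive_Cmod (fun u => F (circle u t))); [| now apply NF].
      apply (pder_comp F (fun u => circle u t)); [now apply DF | apply pder_radius].
    - intros v t Hv. apply (cts_Cmod (fun t => F (circle v t))). apply (cts_comp_circle 1); trivial.
      apply Rabs_def1; lra. }
  (* At radius 0 [F] vanishes on the whole circle and [derive_Cmod] does not apply; continuity is
     enough there. *)
  assert (CN : forall u, 0 <= u < 1 -> continuous N u).
  { intros u Hu. assert (Hu' : Rabs u < 1) by (apply Rabs_def1; lra).
    apply (continuous_RInt_param (fun u t => Cmod (F (circle u t))) u); [apply PI2_nonneg | |].
    - intros s _. apply (cts_Cmod (fun p : R * R => F (circle (fst p) (snd p)))).
      now apply (cts_comp_circle2 1).
    - apply locally_R. exists (1 - u). split; [lra |]. intros v Hv s _.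
      apply (cts_Cmod (fun t => F (circle v t))). apply (cts_comp_circle 1); trivial.
      apply Rabs_def2 in Hv. destruct (Rle_dec 0 v); [rewrite Rabs_pos_eq; lra |].
      rewrite Rabs_left by lra. lra. }
  set (J := fun u => RInt (fun t => jac f (circle u t)) 0 (2 * PI)).
  assert (Da : forall u, 0 <= u < 1 -> is_derive a u (u * J u)).
  { intros u Hu. apply area_derive; trivial. apply Rabs_def1; lra. }
  set (lg := fun u => ln ((1 + u) / (1 - u))).
  assert (Dl : forall u, 0 <= u < 1 -> is_derive lg u (2 / (1 - u ^ 2))).
  { intros u Hu. unfold lg. auto_derive.
    - split; [lra |]. split; [| trivial]. apply Rdiv_lt_0_compat; lra.
    - field. repeat split; nra. }
  (* [Psi r] is the desired bound. Its derivative exceeds the estimate for that of [N] exactly by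
     the nonnegative term with [lg], so [Psi - N] is nondecreasing from the value 0. *)
  set (Psi := fun u => 2 * a u + 2 * cos lambda * (a u * lg u)).
  set (Psi' := fun u => 2 * (u * J u) + 2 * cos lambda * (u * J u * lg u + a u * (2 / (1 - u ^ 2)))).
  assert (DP : forall u, 0 <= u < 1 -> is_derive Psi u (Psi' u)).
  { intros u Hu. apply (is_derive_plus (fun u => 2 * a u) (fun u => 2 * cos lambda * (a u * lg u))).
    - apply (is_derive_scal a). now apply Da.
    - apply (is_derive_scal (fun u => a u * lg u)).
      apply (is_derive_mult a lg); [now apply Da | now apply Dl | apply Rmult_comm]. }
  assert (CJ : forall u t, Rabs u < 1 -> continuous (fun t => jac f (circle u t)) t).
  { intros u t Hu. apply (cts_comp_circle 1); trivial. intros z Hz. now apply jac_cts. }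
  assert (J0 : forall u, Rabs u < 1 -> 0 <= J u).
  { intros u Hu. apply RInt_ge_0; [apply PI2_nonneg | |].
    - ct.
    - intros t _. apply pow2_ge_0. }
  assert (Key : forall u, 0 < u < 1 -> RInt (N1 u) 0 (2 * PI) <= Psi' u).
  { intros u Hu. assert (Hu' : Rabs u < 1) by (apply Rabs_def1; lra).
    assert (Hl0 : 0 <= lg u).
    { unfold lg. rewrite <- ln_1. apply ln_le; [lra |].
      apply Rmult_le_reg_r with (1 - u); [lra |]. unfold Rdiv. rewrite Rmult_assoc, Rinv_l; lra. }
    assert (Hu2 : 0 < 1 - u ^ 2) by nra.
    apply Rle_trans with (2 * u * J u + 2 / (1 - u ^ 2) * (2 * a u * cos lambda)).
    - rewrite <- (IM u) by lra. unfold J. rewrite <- RInt_lin.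
      + apply RInt_le; [apply PI2_nonneg | | |].
        * apply ex_RInt_cts; [apply PI2_nonneg |]. intros t _.
          exact (continuous_fix_fst (fun p => N1 (fst p) (snd p)) u t (CN1 u t Hu)).
        * ct.
        * intros t _. assert (Hd : disk 1 (circle u t)) by now apply disk_circle.
          assert (PF := proj1 (Cmod_gt_0 _) (NF u t Hu)).
          apply Rle_trans with (Cmod (F' (circle u t))).
          { unfold N1. apply Rmult_le_reg_r with (Cmod (F (circle u t))); [exact PF |].
            unfold Rdiv. rewrite Rmult_assoc, Rinv_l, Rmult_1_r by lra.
            eapply Rle_trans; [apply Rle_abs |]. eapply Rle_trans; [apply Re_le_Cmod |].
            rewrite !Cmod_mult, Cmod_conj, Cmod_eit. lra. }
          assert (Hc : Cmod (circle u t) = u) by (apply Cmod_circle; lra).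
          (* This identity turns [2 |f f' Q|] into [2 u |f'|^2], the integrand of twice the
             derivative of the area. *)
          assert (Hfq : Cmod (f (circle u t)) * Cmod (Q (circle u t)) = u * Cmod (C_derive f (circle u t))).
          { transitivity (Cmod (circle u t * C_derive f (circle u t))%C).
            - rewrite (QE _ Hd), !Cmod_mult, Cmod_eit. ring.
            - now rewrite Cmod_mult, Hc. }
          assert (HD := caratheodory_derive Q (circle u t) HQ PQ Hd). rewrite Hc in HD.
          unfold F', jac. set (z := circle u t) in *.
          rewrite Cmod_mult, Cmod_eit, Rmult_1_l.
          eapply Rle_trans; [apply Cmod_triangle |]. apply Rplus_le_compat.
          -- rewrite !Cmod_mult, Cmod_R, Rabs_pos_eq by lra. apply Req_le.
             replace (2 * (Cmod (f z) * Cmod (C_derive f z) * Cmod (Q z))) with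
               (2 * Cmod (C_derive f z) * (Cmod (f z) * Cmod (Q z))) by ring.
             rewrite Hfq. ring.
          -- rewrite !Cmod_mult.
             assert (HD' : Cmod (C_derive Q z) <= 2 / (1 - u ^ 2) * Re (Q z)).
             { apply Rmult_le_reg_r with (1 - u ^ 2); [exact Hu2 |].
               replace (2 / (1 - u ^ 2) * Re (Q z) * (1 - u ^ 2)) with (2 * Re (Q z)) by (field; lra).
               exact HD. }
             apply Rmult_le_compat_l with (r := Cmod (f z) * Cmod (f z)) in HD';
               [| apply Rmult_le_pos; apply Cmod_ge_0].
             eapply Rle_trans; [exact HD' |]. apply Req_le. ring.
      + ct.
      + ct.
    - unfold Psi'. assert (K := J0 u Hu').
      assert (0 <= cos lambda * (u * J u * lg u))
        by (apply Rmult_le_pos; [lra |]; apply Rmult_le_pos; [apply Rmult_le_pos |]; lra).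
      lra. }
  assert (Fin : Psi 0 - N 0 <= Psi r - N r).
  { apply (nondecr_of_derive_open (fun u => Psi u - N u) (fun u => Psi' u - RInt (N1 u) 0 (2 * PI)));
      [lra | | |].
    - intros u Hu. apply (is_derive_minus Psi N); [apply DP | apply DN]; lra.
    - intros u Hu. assert (K := Key u ltac:(lra)). lra.
    - intros u Hu. apply cts_Rminus; [| apply CN; lra].
      eapply is_derive_continuous. apply DP. lra. }
  assert (P0 : Psi 0 = 0) by (unfold Psi, a; rewrite polar_area_0; ring).
  assert (N0 : N 0 = 0).
  { unfold N. rewrite (RInt_ext _ (fun _ => 0)).
    - rewrite RInt_constR. rring.
    - intros t _. unfold F, circle. rewrite Cmult_0_l, Cmult_0_l, Cmult_0_r. apply Cmod_0. }
  change (N r <= a r * (2 + 2 * (cos lambda * lg r))).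
  replace (a r * (2 + 2 * (cos lambda * lg r))) with (Psi r) by (unfold Psi; ring). lra.
Qed.

(** * The upper bound for the length *)

(** The Cauchy-Schwarz inequality for [|f| |Q|] is used as [m q <= k / 2 * m^2 q + q / (2 k)] with a
    suitable weight [k], which needs only the linearity and monotonicity of the integral. *)
Lemma length_upper (lambda : R) (f : C -> C) (r : R) : - (PI / 2) < lambda < PI / 2 ->
  spirallike lambda f -> 0 < r < 1 ->
  L r f <= sqrt (A r f) *
    (2 * sqrt 2 * cos lambda * ln ((1 + r) / (1 - r)) + sqrt 2 * PI).
Proof.
  intros Hl Hs Hr. assert (HPI := PI_pos).
  assert (Hf := spirallike_hol lambda f Hs).
  assert (Hrr : Rabs r < 1) by (apply Rabs_def1; lra).
  assert (Hcos : 0 < cos lambda) by (apply cos_gt_0; lra).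
  destruct (spiral_weighted_mean lambda f r Hl Hs Hr) as [HA HN].
  assert (HI := spiral_quotient_mean lambda f r Hl Hs Hr).
  assert (HC := spiral_constant lambda Hl).
  assert (Hlam : 0 <= ln ((1 + r) / (1 - r))).
  { rewrite <- ln_1. apply ln_le; [lra |].
    apply Rmult_le_reg_r with (1 - r); [lra |]. unfold Rdiv. rewrite Rmult_assoc, Rinv_l; lra. }
  set (Lam := ln ((1 + r) / (1 - r))) in *. set (c := cos lambda * Lam) in *.
  assert (Hc : 0 <= c) by (unfold c; nra).
  set (Q := spiral_quotient lambda f) in *.
  set (N := RInt (fun t => Cmod (f (circle r t) * (circle r t * C_derive f (circle r t)))%C) 0 (2 * PI)) in *.
  set (I := RInt (fun t => Cmod (Q (circle r t))) 0 (2 * PI)) in *.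
  set (T := sqrt (A r f) * (sqrt 2 * (PI + 2 * c))).
  replace (sqrt (A r f) * (2 * sqrt 2 * cos lambda * Lam + sqrt 2 * PI)) with T
    by (unfold T, c; ring).
  assert (T2 : T ^ 2 = 2 * A r f * (PI + 2 * c) ^ 2).
  { unfold T. rewrite !Rpow_mult_distr, !pow2_sqrt by lra. ring. }
  assert (HT : 0 < T).
  { unfold T. apply Rmult_lt_0_compat; [now apply sqrt_lt_R0 |].
    apply Rmult_lt_0_compat; [apply sqrt_lt_R0; lra | lra]. }
  set (Y := 4 * (c + PI - 1)).
  assert (HPI1 := PI2_1).
  assert (HY : 0 < Y) by (unfold Y; lra).
  assert (HI' : I <= Y) by (unfold Y; lra).
  set (X := A r f * (2 + 2 * c)) in *.
  (* The inequality of the means for the factors [2 + 2 c] and [2 c + 2 PI - 2]; the gap is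
     [2 (PI - 2)^2] times the area. *)
  assert (HXY : X * Y <= T ^ 2).
  { rewrite T2. unfold X, Y.
    replace (2 * A r f * (PI + 2 * c) ^ 2) with
      (A r f * (2 + 2 * c) * (4 * (c + PI - 1)) + A r f * (2 * (PI - 2) ^ 2)) by ring.
    assert (0 <= A r f * (2 * (PI - 2) ^ 2))
      by (apply Rmult_le_pos; [lra |]; assert (P := pow2_ge_0 (PI - 2)); lra).
    lra. }
  (* With this weight the bound becomes [(X Y + T^2) / (2 T)], at most [T] because [X Y <= T^2]. *)
  set (k := Y / T). assert (Hk : 0 < k) by (apply Rdiv_lt_0_compat; lra).
  assert (C0 : forall z, disk 1 z -> continuous f z) by (intros; now apply (hol_cts 1)).
  assert (C1 : forall z, disk 1 z -> continuous (C_derive f) z)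
    by (intros; apply (hol_cts 1); trivial; now apply hol_derive).
  assert (CQ : forall z, disk 1 z -> continuous Q z)
    by (intros; apply (hol_cts 1); trivial; now apply spiral_quotient_hol).
  assert (K0 := fun t => cts_comp_circle 1 f r t C0 Hrr).
  assert (K1 := fun t => cts_comp_circle 1 _ r t C1 Hrr).
  assert (K2 := fun t => cts_comp_circle 1 _ r t CQ Hrr).
  assert (B : L r f <= k / 2 * N + / (2 * k) * I).
  { rewrite L_circle. unfold N, I. rewrite <- RInt_lin by ct.
    apply RInt_le; [apply PI2_nonneg | | |].
    - ct.
    - ct.
    - intros t _. assert (Hd : disk 1 (circle r t)) by now apply disk_circle.
      assert (E := spiral_quotient_eq lambda f (circle r t) Hs Hd). fold Q in E.
      rewrite E.
      assert (Hc' : Cmod (circle r t) = r) by (apply Cmod_circle; lra).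
      assert (E1 : r * Cmod (C_derive f (circle r t)) = Cmod (f (circle r t)) * Cmod (Q (circle r t))).
      { transitivity (Cmod (circle r t * C_derive f (circle r t))%C).
        - now rewrite Cmod_mult, Hc'.
        - rewrite E, !Cmod_mult, Cmod_eit. ring. }
      rewrite E1, !Cmod_mult, Cmod_eit.
      set (m := Cmod (f (circle r t))). set (q := Cmod (Q (circle r t))).
      assert (Hq : 0 <= q) by apply Cmod_ge_0.
      replace (k / 2 * (m * (1 * m * q)) + / (2 * k) * q) with
        (m * q + / (2 * k) * (q * (k * m - 1) ^ 2)) by (field; lra).
      assert (0 <= / (2 * k) * (q * (k * m - 1) ^ 2)).
      { apply Rmult_le_pos; [left; apply Rinv_0_lt_compat; lra |].
        apply Rmult_le_pos; [exact Hq | apply pow2_ge_0]. }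
      lra. }
  eapply Rle_trans; [exact B |].
  apply Rle_trans with (k / 2 * X + / (2 * k) * Y).
  - apply Rplus_le_compat; apply Rmult_le_compat_l; trivial; [lra |].
    left. apply Rinv_0_lt_compat. lra.
  - apply Rmult_le_reg_r with (2 * T); [lra |].
    replace ((k / 2 * X + / (2 * k) * Y) * (2 * T)) with (X * Y + T ^ 2)
      by (unfold k; field; split; lra).
    replace (T * (2 * T)) with (T ^ 2 + T ^ 2) by ring. lra.
Qed.

Theorem theorem1p3 (lambda : R) (Hlambda : - (PI / 2) < lambda < PI / 2)
  (f : C -> C) (Hf : spirallike lambda f)
  (r : R) (Hr : 0 < r < 1) :
  2 * sqrt (PI * A r f) <= L r f /\
  L r f <= sqrt (A r f) *
    (2 * sqrt 2 * cos lambda * ln ((1 + r) / (1 - r)) + sqrt 2 * PI).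
Proof.
  split; [now apply (length_lower lambda) | now apply length_upper].
Qed.
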